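(* Let $\{c_k\}_{k\in\mathbb{Z}}$ be a family of strictly positive real numbers such that, for some $\alpha\in(0,\infty)$, $$\lim_{k\to\infty}\frac1k\sum_{j=0}^{k-1}\frac1{c_j}=\alpha,\qquad \lim_{k\to\infty}\frac1k\sum_{j=1}^{k}\frac1{c_{-j}}=\alpha .$$ Let $\rho_0:\mathbb{R}\to[0,\infty)$ be a bounded Borel function and let $\{\mu_n\}_{n\ge 0}$ be a family of probability measures on $\{0,1\}^{\mathbb{Z}}$ such that, for all $\varphi\in C_0(\mathbb{R})\cap L^1(\mathbb{R})$ and all $\delta>0$, $$\lim_{n\to\infty}\mu_n\left(\left|\frac1n\sum_{j\in\mathbb{Z}}\varphi\left(\frac jn\right)\eta_j-\int_{\mathbb{R}}\varphi(x)\rho_0(x)\,dx\right|>\delta\right)=0 .$$ Then, for all $t>0$, $\varphi\in C_c(\mathbb{R})$ and $\delta>0$, $$\lim_{n\to\infty}\mathbb{P}_{\mu_n}\left(\left|\frac1n\sum_{j\in\mathbb{Z}}\varphi\left(\frac jn\right)\eta_j(n^2t)-\int_{\mathbb{R}}\varphi(x)\rho(x,t)\,dx\right|>\delta\right)=0,$$ where $\mathbb{P}_{\mu_n}$ is the law of the exclusion process with rates $\{c_k\}$ and initial distribution $\mu_n$, and $\rho:\mathbb{R}\times[0,\infty)\to\mathbb{R}$ is the solution of the heat equation $\partial_t\rho=(1/\alpha)\,\partial_x^2\rho$ with condition $\rho(\cdot,0)=\rho_0$ at time $t=0$, that is, for $t>0$, $$\rho(x,t)=\int_{\mathbb{R}}p(t,x-y)\rho_0(y)\,dy,$$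 with $p(t,\cdot)$ the density of a centered Gaussian random variable of variance $2t/\alpha$.
   Context: $C_0(\mathbb{R})$ denotes the continuous functions on $\mathbb{R}$ vanishing at infinity, and $C_c(\mathbb{R})$ the continuous functions with compact support. Exclusion process with rates $\{c_k\}$: the Markov process $\eta(t)=(\eta_k(t))_{k\in\mathbb{Z}}$ on $\{0,1\}^{\mathbb{Z}}$ with generator acting on cylinder functions by $\mathcal{L}f(\eta)=\sum_{k\in\mathbb{Z}}c_k\left(f(\eta^{k,k+1})-f(\eta)\right)$, where $\eta^{k,k+1}$ is obtained from $\eta$ by exchanging the values $\eta_k$ and $\eta_{k+1}$. It is constructed by the graphical representation: let $N_k(\cdot)$, $k\in\mathbb{Z}$, be independent Poisson processes with $E(N_k(t))=c_kt$, defined on a probability space $(\Omega,\mathcal{F},P)$. For $t>0$ let $\mathcal{G}_t$ be the random graph with vertex set $\mathbb{Z}$ and edges $\{k,k+1\}$ such that $N_k(t)\ge 1$; almost surely all connected components of $\mathcal{G}_t$ are finite for all $t>0$. Given $\eta(0)$, the configuration $\eta(t)$ is obtained on each (finite) connected component of $\mathcal{G}_t$ by exchanging, in chronological order of the jump times in $(0,t]$, the values at $k$ and $k+1$ at each jump time of $N_k$, for each edge $\{k,k+1\}$ of the component. For a probability measure $\mu$ on $\{0,1\}^{\mathbb{Z}}$, $\mathbb{P}_\mu$ is the law of this process when $\eta(0)$ has distribution $\mu$ and is independent of the Poisson processes. *)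

(* Defs.v *)
From HB Require Import structures.
From mathcomp Require Import all_boot all_order all_algebra finmap.
From mathcomp Require Import all_classical all_reals all_analysis.

Set Implicit Arguments.
Unset Strict Implicit.
Unset Printing Implicit Defensive.

Import Order.TTheory GRing.Theory Num.Theory.
Import numFieldNormedType.Exports.

Local Open Scope classical_set_scope.
Local Open Scope ring_scope.

Definition cylinders : set_system (int -> bool) :=
  [set A | exists (k : int) (B : set bool), A = [set eta | B (eta k)]].

(* {0,1}^Z with its product sigma-algebra *)
Definition config := g_sigma_algebraType cylinders.

Section poisson_processes.
Context {R : realType} {d : measure_display} {Omega : measurableType d}.
Variable P : probability Omega R.

Definition mutually_independent (I : choiceType) (F : I -> set_system Omega) :=
  forall (J : {fset I}) (A : I -> set Omega),
    (forall i, i \in J -> F i (A i)) ->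
    P (\bigcap_(i in [set` J]) A i) = (\prod_(i <- J) P (A i))%E.

Definition sigma_rv (X : Omega -> nat) : set_system Omega :=
  preimage_set_system setT X measurable.

Definition sigma_process (N : R -> Omega -> nat) : set_system Omega :=
  <<s \bigcup_(t in [set t | 0 <= t]) sigma_rv (N t) >>.

(* Only times t >= 0 matter. The path properties are required of every sample
   path; nat carries the discrete topology, so that right-continuity means
   being constant on some [t, t + e[. *)
Record poisson_process (c : R) (N : R -> Omega -> nat) : Prop := {
  poisson_measurable : forall t, 0 <= t -> measurable_fun setT (N t) ;
  poisson_start : forall w, N 0 w = 0%N ;
  poisson_nondecreasing :
    forall w s t, 0 <= s -> s <= t -> (N s w <= N t w)%N ;
  poisson_right_continuous :
    forall w t, 0 <= t -> \forall s \near t^'+, N s w = N t w ;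
  poisson_increments : forall s t (m : nat), 0 <= s -> s < t ->
    P [set w | (N t w - N s w)%N = m] = (poisson_pmf (c * (t - s)) m)%:E ;
  poisson_independent_increments : forall u : nat -> R,
    0 <= u 0%N -> {homo u : i j / (i <= j)%N >-> i <= j} ->
    mutually_independent
      (fun i => sigma_rv (fun w => (N (u i.+1) w - N (u i) w)%N)) }.

Definition independent_poisson_processes
    (c : int -> R) (N : int -> R -> Omega -> nat) : Prop :=
  (forall k, poisson_process (c k) (N k)) /\
  mutually_independent (fun k => sigma_process (N k)).

End poisson_processes.

(* Here [N k s] is the number of jumps in [0, s] of the path attached to the
   edge {k, k + 1}. *)
Section graphical_representation.
Context {R : realType}.
Variable N : int -> R -> nat.

Definition edge (t : R) : rel int := fun x y =>
  ((y == x + 1) && (1 <= N x t)%N) || ((x == y + 1) && (1 <= N y t)%N).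

Definition component (t : R) (x : int) : set int :=
  [set y | exists2 p : seq int, path (edge t) x p & y = last x p].

Definition component_edges (t : R) (x : int) : set int :=
  [set k | component t x k /\ (1 <= N k t)%N].

Definition jump_times (k : int) (t : R) : set R :=
  [set s | 0 < s <= t /\ forall r, 0 <= r < s -> (N k r < N k s)%N].

(* [fset_set] is empty on infinite sets: on the null event that the component
   of x is infinite, no exchange is performed. *)
Definition jumps (t : R) (x : int) : seq (R * int) :=
  sort (fun a b => a.1 <= b.1)
    [seq (s, k) | k <- fset_set (component_edges t x),
                  s <- fset_set (jump_times k t)].

Definition exchange (eta : config) (k : int) : config := fun j =>
  if j == k then eta (k + 1) else if j == k + 1 then eta k else eta j.

Definition exclusion (eta0 : config) (t : R) : config := fun x =>
  foldl (fun eta a => exchange eta a.2) eta0 (jumps t x) x.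

End graphical_representation.

(* Law of the process (eta(s))_s when eta(0) has law mu and is independent of
   the Poisson processes: the underlying space is config * Omega under the
   product measure. *)
Definition exclusion_law {R : realType} {d : measure_display}
    {Omega : measurableType d} (P : probability Omega R)
    (N : int -> R -> Omega -> nat) (mu : probability config R)
    (A : set (R -> config)) : \bar R :=
  (mu \x P)%E [set z | A (exclusion (fun k s => N k s z.2) z.1)].

Section hydrodynamics.
Context {R : realType}.
Local Notation leb := (@lebesgue_measure R).

Definition C0 (phi : R -> R) : Prop :=
  [/\ continuous phi, phi x @[x --> +oo] --> (0 : R)
    & phi x @[x --> -oo] --> (0 : R)].

Definition L1 (phi : R -> R) : Prop :=
  leb.-integrable setT (fun x => (phi x)%:E).

Definition Cc (phi : R -> R) : Prop :=
  continuous phi /\ compact (closure [set x | phi x != 0]).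

(* Sum over Z as positive part minus negative part. When the family is not
   absolutely summable the value is infinite (-oo when both parts diverge), so
   that such a sum is at infinite distance from every real number. *)
Definition sumZ (u : int -> R) : \bar R :=
  (\esum_(j in [set: int]) (u^\+ j)%:E - \esum_(j in [set: int]) (u^\- j)%:E)%E.

Definition empirical (n : nat) (phi : R -> R) (eta : config) : \bar R :=
  ((n%:R^-1)%:E * sumZ (fun j => phi (j%:~R / n%:R) * (eta j)%:R)%R)%E.

Definition deviates (n : nat) (phi rho : R -> R) (delta : R) : set config :=
  [set eta | (delta%:E <
    `| empirical n phi eta - \int[leb]_x (phi x * rho x)%:E |)%E].

(* The second argument of [normal_pdf] is the standard deviation. *)
Definition heat_kernel (alpha t : R) : R -> R :=
  normal_pdf 0 (Num.sqrt (2 * t / alpha)).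

Definition heat_solution (alpha : R) (rho0 : R -> R) (x t : R) : R :=
  \int[leb]_y (heat_kernel alpha t (x - y) * rho0 y).

End hydrodynamics.

(* Main.v *)
Require Import Defs.
From HB Require Import structures.
From mathcomp Require Import all_boot all_order all_algebra finmap.
From mathcomp Require Import all_classical all_reals all_analysis.
From mathcomp Require Import measurable_realfun zify ring lra.

(** Fix an initial configuration, a test function [phi] supported in [[-r, r]] and
    a scale [n]. Far to the left and to the right there are edges that do not ring
    before time [n ^ 2 t], because the resistances [1 / c k] are infinitely often
    at least half of their mean ([walls_probability]); between two such edges the
    process only depends on the Poisson processes of a finite box. Cut time into
    [m] cells. When [m] is large, with high probability no cell sees two jumps in
    the box ([calm_probability]), and then the process is obtained by performing,
    cell after cell, the exchanges of the edges that have rung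
    ([exclusion_box]). These exchanges are independent ([ring_list_law]).

    Along a finite chain of independent exchanges, the linear functional
    [sum_j a j * eta j] has mean [sum_j (U a) j * eta0 j], where [U] averages [a]
    successively across the bonds. Its variance is at most half of
    [sum_j (a j) ^ 2] ([expect_variance]): at each step, the variance created is
    at most half of the decrease of the squared norm of the averaged test
    function. For [a j = phi (j / n)] this is of order [n], which is negligible
    with respect to [n ^ 2]. The problem is thus reduced to the linear evolution of
    the test function, and it remains to prove that
    [n ^ -1 * sum_j | (U a) j - f (j / n) |] tends to [0], where [f] is the heat
    flow of [phi] at time [t] ([evolution_converges]).

    [U] is a product of sweeps, each of which contracts the sup norm and equals
    [1 + h L + O(h ^ 2)], with [L] the generator of the random walk with
    conductances [c]. It suffices to exhibit an approximate solution. For a smooth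
    solution [w] of the heat equation, let [v] be the [corrected] lattice function,
    whose increments are those of [w (k / n)] multiplied by [1 / (alpha * c k)].
    The flux of [v] in the disordered medium is the flux of [w] in the homogeneous
    one, so [L v] is exactly a discrete Laplacian of [w]; and [v] is uniformly
    close to [w], by Abel summation, because the averages of [1 / c k - alpha] tend
    to [0] ([corrected_close]). This gives [caloric_converges]. A general [phi] is
    uniformly approximated by mixtures of narrow Gaussians, which evolve
    explicitly ([gaussian_approximation]), and uniform convergence becomes
    convergence of the sums because the same correction, applied to [k ^ 2],
    controls second moments ([second_moment_tail]).

    The empirical average of the process at time [n ^ 2 t] is therefore close to
    the average of [f] against the initial configuration. As [f] is an
    admissible test function ([heat_solution_C0], [heat_solution_L1]), the latter
    is close to the integral of [f * rho0], which is the integral of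
    [phi * rho(., t)] by symmetry of the heat kernel ([heat_duality]). All this
    holds for each initial configuration that is close to the initial profile
    ([deviation_sections]). Integrating over the initial configuration requires
    that the process be measurable, which is proved by writing it, on every
    sample path, as a limit of its discretizations ([measurable_exclusion]). *)

Set Implicit Arguments.
Unset Strict Implicit.
Unset Printing Implicit Defensive.

Import Order.TTheory GRing.Theory Num.Theory.
Import numFieldNormedType.Exports.

Local Open Scope classical_set_scope.
Local Open Scope ring_scope.

(** * Random exchanges across bonds, and the variance of linear functionals *)

Section bond.
Context {R : realType}.
Implicit Types (u v a g : int -> R) (k j : int) (p : R) (s : seq int).

(** The signed unit charge of a bond. Averaging across a bond and the generator
    both move a function along it, which makes summation by parts immediate. *)
Definition dipole k j : R := (j == k)%:R - (j == k + 1)%:R.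

(** The mean effect of an exchange performed with probability [p]: each end of
    the bond keeps its value or takes the other one. *)
Definition bond_step p k u : int -> R :=
  fun j => u j + p * (u (k + 1) - u k) * dipole k j.

Lemma sum_dipole s k g : uniq s -> k \in s -> k + 1 \in s ->
  \sum_(j <- s) dipole k j * g j = g k - g (k + 1).
Proof.
move=> us ks k1s.
have sumd i : i \in s -> \sum_(j <- s) (j == i)%:R * g j = g i.
  move=> iS; rewrite (bigD1_seq i)//= eqxx mul1r big1 ?addr0// => j ji.
  by rewrite (negbTE ji) mul0r.
under eq_bigr do rewrite /dipole mulrBl.
by rewrite sumrB !sumd.
Qed.

Lemma neq_succ k : (k == k + 1) = false.
Proof. by apply/negP => /eqP; lia. Qed.

Lemma ler_dipole k j : `|dipole k j| <= 1.
Proof.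
rewrite /dipole; case: eqVneq => [->|_]; first by rewrite neq_succ subr0 normr1.
by case: eqP => _; rewrite ?sub0r ?subr0 ?normrN ?normr1 ?normr0 ?ler01.
Qed.

Lemma bond_stepE p k u j : bond_step p k u j =
  if j == k then (1 - p) * u k + p * u (k + 1)
  else if j == k + 1 then (1 - p) * u (k + 1) + p * u k else u j.
Proof.
rewrite /bond_step /dipole; case: eqVneq => [->|jk].
  by rewrite neq_succ subr0 mulr1; ring.
by case: eqVneq => [->|_] /=; ring.
Qed.

Lemma exchangeE (eta : config) k j :
  (exchange eta k j)%:R = bond_step 1 k (fun i => (eta i)%:R) j.
Proof.
rewrite bond_stepE /exchange; case: eqP => _; first by ring.
by case: eqP => _ //; ring.
Qed.

Definition pairing s u v : R := \sum_(j <- s) u j * v j.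

Lemma pairing_step s p k u v : uniq s -> k \in s -> k + 1 \in s ->
  pairing s (bond_step p k u) v =
  pairing s u v - p * (u (k + 1) - u k) * (v (k + 1) - v k).
Proof.
move=> us ks k1s; rewrite /pairing /bond_step.
under eq_bigr do rewrite mulrDl -[_ * _ * _ * v _]mulrA.
rewrite big_split /= -mulr_sumr (sum_dipole v us ks k1s); ring.
Qed.

Lemma pairingC s u v : pairing s u v = pairing s v u.
Proof. by rewrite /pairing; under eq_bigr do rewrite mulrC. Qed.

(** The energy lost by the test function pays for the variance that the same
    step creates; compare [expect_variance]. *)
Lemma pairing_step_energy s p k u : uniq s -> k \in s -> k + 1 \in s ->
  pairing s (bond_step p k u) (bond_step p k u) =
  pairing s u u - 2 * (p * (1 - p)) * (u (k + 1) - u k) ^+ 2.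
Proof.
move=> us ks k1s; rewrite pairing_step// pairingC pairing_step//.
rewrite !bond_stepE eqxx [k + 1 == k]eq_sym neq_succ eqxx; ring.
Qed.

End bond.

Section bernoulli_chain.
Context {R : realType}.
Implicit Types (l : seq (int * R)) (s : seq int) (a : int -> R).
Local Notation obs := (config -> R).

Definition occ (eta : config) : int -> R := fun j => (eta j)%:R.

(** Iterated expectations describe the law of a finite chain of independent
    exchanges without choosing a probability space for it. *)
Fixpoint expect l (G : obs) (eta : config) : R :=
  if l is (k, p) :: l' then
    (1 - p) * expect l' G eta + p * expect l' G (exchange eta k)
  else G eta.

(** The last exchange performed is the first one to act on the test function:
    [evolve] is dual to [expect]. *)
Definition evolve l a : int -> R :=
  foldr (fun kp u => bond_step kp.2 kp.1 u) a l.

Definition bernoulli l := forall kp, kp \in l -> 0 <= kp.2 <= 1.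

Definition inside s l := forall kp, kp \in l -> kp.1 \in s /\ kp.1 + 1 \in s.

Lemma bernoulli_cons kp l : bernoulli (kp :: l) -> 0 <= kp.2 <= 1 /\ bernoulli l.
Proof.
move=> h; split; first by apply: h; rewrite mem_head.
by move=> x xl; apply: h; rewrite inE xl orbT.
Qed.

Lemma inside_cons s kp l : inside s (kp :: l) ->
  [/\ kp.1 \in s, kp.1 + 1 \in s & inside s l].
Proof.
move=> h; have [] := h kp; first by rewrite mem_head.
by move=> ? ?; split=> // x xl; apply: h; rewrite inE xl orbT.
Qed.

Lemma expect_le l (F G : obs) eta : bernoulli l ->
  (forall e, F e <= G e) -> expect l F eta <= expect l G eta.
Proof.
elim: l eta => [|[k p] l IH] eta /=; first by move=> _; apply.
move=> /bernoulli_cons[/= /andP[p0 p1] bl] FG.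
by apply: lerD; rewrite ler_wpM2l ?IH//; lra.
Qed.

Lemma expectZ l (F : obs) c eta :
  expect l (fun e => c * F e) eta = c * expect l F eta.
Proof. by elim: l eta => [//|[k p] l IH] eta /=; rewrite !IH; ring. Qed.

Lemma pairing_exchange s a k eta : uniq s -> k \in s -> k + 1 \in s ->
  pairing s a (occ (exchange eta k)) =
  pairing s a (occ eta) -
  (a (k + 1) - a k) * (occ eta (k + 1) - occ eta k).
Proof.
move=> us ks k1s; rewrite pairingC.
have -> : occ (exchange eta k) = bond_step 1 k (occ eta).
  by apply/funext => j; rewrite /occ exchangeE.
by rewrite pairing_step// pairingC; ring.
Qed.

(** An exchange with probability [p] adds to the variance [p * (1 - p)] times the
    squares of the increments of the averaged test function and of the
    configuration across the bond. The latter is at most [1], and the squared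
    norm of the test function loses twice the remaining quantity: the total
    variance is at most half of the energy lost along the chain, whatever the
    number of exchanges. *)
Lemma expect_variance s l a eta : uniq s -> bernoulli l -> inside s l ->
  expect l (fun e => (pairing s a (occ e) -
                      pairing s (evolve l a) (occ eta)) ^+ 2) eta
  <= (pairing s a a - pairing s (evolve l a) (evolve l a)) / 2.
Proof.
move=> us; move: eta.
(* An arbitrary centring [m] is needed for the induction, since the first
   exchange changes the mean of the remaining chain. *)
suff H eta : bernoulli l -> inside s l -> forall m,
    expect l (fun e => (pairing s a (occ e) - m) ^+ 2) eta
    <= (pairing s a a - pairing s (evolve l a) (evolve l a)) / 2
       + (pairing s (evolve l a) (occ eta) - m) ^+ 2.
  move=> eta bl il; apply: (le_trans (H eta bl il _)).
  by rewrite subrr expr0n addr0.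
elim: l eta => [|[k p] l IH] eta /=; first by move=> _ _ m; rewrite subrr mul0r add0r.
move=> /bernoulli_cons[/= /andP[p0 p1] bl] /inside_cons[/= ks k1s il] m.
set u := evolve l a.
have q0 : 0 <= 1 - p by lra.
have h1 := ler_wpM2l q0 (IH eta bl il m).
have h2 := ler_wpM2l p0 (IH (exchange eta k) bl il m).
apply: (le_trans (lerD h1 h2)).
rewrite -/u pairing_exchange// pairing_step_energy// pairing_step//.
set x := pairing s a a; set y := pairing s u u; set z := pairing s u (occ eta).
set d := u (k + 1) - u k; set o := occ eta (k + 1) - occ eta k.
have o1 : o ^+ 2 <= 1.
  rewrite /o /occ; case: (eta _); case: (eta _); rewrite ?subr0 ?subrr ?sub0r ?sqrrN ?expr1n ?expr0n //=.
have h : p * (1 - p) * d ^+ 2 * o ^+ 2 <= p * (1 - p) * d ^+ 2.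
  by rewrite ler_piMr// mulr_ge0 ?sqr_ge0// mulr_ge0.
nra.
Qed.

Lemma pairing_ge0 s a : 0 <= pairing s a a.
Proof. by apply: sumr_ge0 => j _; rewrite -expr2 sqr_ge0. Qed.

Lemma expect_chebyshev s l a (eta : config) (delta : R) : uniq s ->
  bernoulli l -> inside s l -> 0 < delta ->
  expect l (fun e => (delta < `|pairing s a (occ e) -
              pairing s (evolve l a) (occ eta)|)%R%:R) eta
  <= pairing s a a / (2 * delta ^+ 2).
Proof.
move=> us bl il d0; set m := pairing s (evolve l a) (occ eta).
have d2 : 0 < delta ^+ 2 by rewrite exprn_gt0.
apply: (@le_trans _ _ (expect l (fun e => (delta ^+ 2)^-1 *
    (pairing s a (occ e) - m) ^+ 2) eta)).
  apply: expect_le => // e; case: ltP => [h|h] /=.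
    rewrite mulrC ler_pdivlMr// mul1r -[leRHS]real_normK ?num_real//.
    by rewrite ler_pXn2r ?nnegrE ?(ltW h)// ltW.
  by rewrite mulr_ge0 ?sqr_ge0 ?invr_ge0 ?(ltW d2).
have -> : pairing s a a / (2 * delta ^+ 2) =
          (delta ^+ 2)^-1 * (pairing s a a / 2) by field; rewrite gt_eqF.
rewrite expectZ ler_wpM2l ?invr_ge0 ?(ltW d2)//.
apply: (le_trans (expect_variance a eta us bl il)).
by rewrite ler_pM2r ?invr_gt0// lerBlDr lerDl pairing_ge0.
Qed.

End bernoulli_chain.

(** * Abel summation against sublinear partial sums *)

Section antidifference.
Context {R : realType}.
Implicit Types (g F : int -> R) (k : int).

Definition antidiff g k : R :=
  match k with
  | Posz n => \sum_(0 <= i < n) g i%:Z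
  | Negz n => - \sum_(0 <= i < n.+1) g (Negz i)
  end.

Lemma NegzD1 n : Negz n + 1 = - n%:Z.
Proof. by rewrite NegzE -addn1 PoszD opprD addrNK. Qed.

Lemma Negz_succ n : Negz n.+1 + 1 = Negz n.
Proof. by rewrite NegzD1 NegzE. Qed.

Lemma antidiff_succ g k : antidiff g (k + 1) - antidiff g k = g k.
Proof.
case: k => [n|[|n]].
- by rewrite -PoszD addn1 /= big_nat_recr//=; ring.
- by rewrite /= big_nat1 opprK big_nil add0r.
- by rewrite Negz_succ /= [\sum_(0 <= i < n.+2) _]big_nat_recr//=; ring.
Qed.

Lemma antidiffB g1 g2 k :
  antidiff (fun k => g1 k - g2 k) k = antidiff g1 k - antidiff g2 k.
Proof. by case: k => n /=; rewrite sumrB// opprB opprK addrC. Qed.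

Lemma antidiffK F k : antidiff (fun k => F (k + 1) - F k) k = F k - F 0.
Proof.
case: k => n /=.
  elim: n => [|n IH]; first by rewrite big_nil subrr.
  by rewrite big_nat_recr//= IH -PoszD addn1; ring.
elim: n => [|n IH]; first by rewrite big_nat1 NegzD1 oppr0; ring.
by rewrite big_nat_recr//= Negz_succ opprD IH; ring.
Qed.

(** Summation by parts replaces the size of [A], about which nothing is known,
    by the size of its partial sums. *)
Lemma abel_bound (A G : nat -> R) n (s := fun n => \sum_(0 <= i < n) A i) :
  `|\sum_(0 <= i < n) A i * G i| <=
  `|s n| * `|G n| + \sum_(0 <= i < n) `|s i.+1| * `|G i.+1 - G i|.
Proof.
suff H : `|\sum_(0 <= i < n) A i * G i - s n * G n| <=
         \sum_(0 <= i < n) `|s i.+1| * `|G i.+1 - G i|.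
  rewrite -[X in `|X| <= _](subrK (s n * G n)) -normrM.
  by apply: (le_trans (ler_normD _ _)); rewrite [leRHS]addrC lerD2r.
elim: n => [|n IH]; first by rewrite /s !big_nil mul0r subrr normr0.
have sS : s n.+1 = s n + A n by rewrite /s big_nat_recr.
rewrite [leRHS]big_nat_recr//= big_nat_recr//=.
have -> : \sum_(0 <= i < n) A i * G i + A n * G n - s n.+1 * G n.+1 =
  (\sum_(0 <= i < n) A i * G i - s n * G n) - s n.+1 * (G n.+1 - G n).
  by rewrite sS; ring.
by apply: (le_trans (ler_normB _ _)); rewrite normrM lerD2r.
Qed.

End antidifference.

Section sublinear.
Context {R : realType}.

(** Partial sums that are negligible with respect to their length; with the
    additive constant the bound holds at every length and can be summed. *)
Definition sublinear (A : nat -> R) := forall e : R, 0 < e ->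
  exists2 C : R, 0 <= C & forall n, `|\sum_(0 <= i < n) A i| <= e * n%:R + C.

Lemma cesaro_sublinear (x : nat -> R) (l : R) :
  n%:R^-1 * \sum_(0 <= i < n) x i @[n --> \oo] --> l ->
  sublinear (fun i => x i - l).
Proof.
move=> xl e e0.
have /cvgrPdist_le/(_ e e0)[n0 _ H] := xl.
exists (\sum_(0 <= i < n0) `|x i - l|); first exact: sumr_ge0.
move=> n; have [nn0|n0n] := ltnP n n0.
  apply: (le_trans (ler_norm_sum _ _ _)).
  rewrite (big_cat_nat (n := n) (p := n0))//= ?(ltnW nn0)//.
  by rewrite addrCA lerDl addr_ge0 ?sumr_ge0// mulr_ge0 // ltW.
have := H n n0n; rewrite /=; case: n n0n => [|n] n0n Hn.
  by rewrite big_nil normr0 mulr0 add0r sumr_ge0.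
have n1 : 0 < n.+1%:R :> R by rewrite ltr0n.
have -> : \sum_(0 <= i < n.+1) (x i - l) =
   - (n.+1%:R * (l - n.+1%:R^-1 * \sum_(0 <= i < n.+1) x i)).
  rewrite sumrB big_const_nat iter_addr_0 subn0 mulrBr mulrA divff ?gt_eqF//.
  by rewrite mul1r -mulr_natl; ring.
rewrite normrN normrM gtr0_norm// mulrC.
apply: (@le_trans _ _ (e * n.+1%:R)); first by rewrite ler_pM2r.
by rewrite lerDl sumr_ge0.
Qed.

(** Comparison with the telescoping increments of [- 2 * n / (n + i)]. *)
Lemma sum_inv_sq (n k : nat) : (0 < n)%N ->
  \sum_(0 <= i < k) n%:R / (n + i)%:R ^+ 2 <= 2 :> R.
Proof.
move=> n0.
suff H : \sum_(0 <= i < k) n%:R / (n + i)%:R ^+ 2 <= 2 - 2 * n%:R / (n + k)%:R :> R.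
  by apply: (le_trans H); rewrite gerBl divr_ge0 ?mulr_ge0.
elim: k => [|k IH].
  rewrite big_nil addn0 mulfK ?subrr// pnatr_eq0 -lt0n//.
rewrite big_nat_recr//=; apply: (le_trans (lerD IH (lexx _))).
have p : 1 <= (n + k)%:R :> R by rewrite ler1n; lia.
rewrite addnS -[(n + k).+1%:R]natr1; set x : R := (n + k)%:R in p *.
have n1 : 0 <= n%:R :> R by [].
have -> : 2 - 2 * n%:R / x + n%:R / x ^+ 2 =
  2 - 2 * n%:R / (x + 1) - n%:R * ((x - 1) / (x ^+ 2 * (x + 1))).
  by field; rewrite gt_eqF ?gt_eqF//; lra.
rewrite gerBl mulr_ge0// divr_ge0//; first lra.
by rewrite mulr_ge0// ?sqr_ge0//; lra.
Qed.

(** The hypotheses on [G] are those satisfied by the increments of a lattice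
    function [f (i / n)] whose first two derivatives decay like the inverse cube.
    Partial sums of [A] up to [i] are at most a small multiple of [n + i], which
    leaves terms of order [n / (n + i) ^ 2], summable uniformly in [n]. *)
Lemma abel_sublinear (A : nat -> R) : sublinear A -> forall e : R, 0 < e ->
  exists2 n0 : nat, (0 < n0)%N & forall (n : nat) (B : R) (G : nat -> R),
  (n0 <= n)%N -> 0 <= B ->
  (forall i, `|G i| <= B * (n%:R ^+ 2 / (n + i)%:R ^+ 3)) ->
  (forall i, `|G i.+1 - G i| <= B * (n%:R / (n + i)%:R ^+ 3)) ->
  forall k, `|\sum_(0 <= i < k) A i * G i| <= e * B.
Proof.
move=> sA e e0; have e60 : 0 < e / 6 by rewrite divr_gt0.
have [C C0 HC] := sA _ e60.
pose n0 := (Num.truncn (6 * C / e)).+1.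
exists n0 => // n B G nn0 B0 hG hdG k.
have n_gt0 : (0 < n)%N by apply: leq_trans nn0.
have Cn : C <= e / 6 * n%:R.
  have : 6 * C / e < n%:R.
    by apply: (lt_le_trans (truncnS_gt _)); rewrite ler_nat.
  by rewrite ltr_pdivrMr// => h; lra.
have n1 : 1 <= n%:R :> R by rewrite ler1n.
apply: (le_trans (abel_bound _ _ _)).
have sb i j : (i <= n + j)%N -> `|\sum_(0 <= i < i) A i| <= e / 3 * (n + j)%:R.
  move=> ij; apply: (le_trans (HC _)).
  have : i%:R <= (n + j)%:R :> R by rewrite ler_nat.
  have : n%:R <= (n + j)%:R :> R by rewrite ler_nat leq_addr.
  move=> h1 h2; have := ler_wpM2l (ltW e60) h1; have := ler_wpM2l (ltW e60) h2.
  lra.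
have pos j : 0 < (n + j)%:R :> R by rewrite ltr0n addn_gt0 n_gt0.
have T j i : (i <= n + j)%N -> `|\sum_(0 <= i < i) A i| * `|G j.+1 - G j| <=
    e / 3 * B * (n%:R / (n + j)%:R ^+ 2).
  move=> ij; apply: (le_trans (ler_pM _ _ (sb _ _ ij) (hdG j))) => //.
  rewrite le_eqVlt; apply/orP; left; apply/eqP; field.
  by rewrite -natrD gt_eqF.
have T0 : `|\sum_(0 <= i < k) A i| * `|G k| <= e / 3 * B.
  apply: (le_trans (ler_pM _ _ (sb _ _ (leq_addl n k)) (hG k))) => //.
  have -> : e / 3 * (n + k)%:R * (B * (n%:R ^+ 2 / (n + k)%:R ^+ 3)) =
     e / 3 * B * (n%:R / (n + k)%:R) ^+ 2 by field; rewrite -natrD gt_eqF.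
  rewrite ler_piMr ?mulr_ge0 ?(ltW e0)// exprn_ile1 ?divr_ge0//.
  by rewrite ler_pdivrMr// mul1r ler_nat leq_addr.
have : \sum_(0 <= i < k) `|\sum_(0 <= i < i.+1) A i| * `|G i.+1 - G i| <=
       \sum_(0 <= i < k) e / 3 * B * (n%:R / (n + i)%:R ^+ 2).
  by apply: ler_sum => i _; apply: T; lia.
rewrite -mulr_sumr => h.
have := ler_wpM2l (mulr_ge0 (ltW (divr_gt0 e0 (ltr0n R 3))) B0) (sum_inv_sq k n_gt0).
lra.
Qed.

End sublinear.

(** * The corrected function *)

Section harmonic.
Context {R : realType}.
Variables (c : int -> R) (alpha : R).
Hypotheses (c_gt0 : forall k, 0 < c k) (alpha_gt0 : 0 < alpha).

Definition resist k : R := (alpha * c k)^-1.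

(** The function with the same flux [c k * (F (k + 1) - F k)] as [F] has in the
    homogeneous medium of constant conductance [1 / alpha]. The generator of the
    disordered medium acts on it as the homogeneous one acts on [F]. *)
Definition corrected (F : int -> R) k : R :=
  F 0 + antidiff (fun k => resist k * (F (k + 1) - F k)) k.

Lemma corrected_flux F k :
  c k * (corrected F (k + 1) - corrected F k) = (F (k + 1) - F k) / alpha.
Proof.
have -> : corrected F (k + 1) - corrected F k = resist k * (F (k + 1) - F k).
  have /= <- := antidiff_succ (fun k => resist k * (F (k + 1) - F k)) k.
  by rewrite /corrected; ring.
by rewrite /resist; field; rewrite !gt_eqF.
Qed.

Lemma correctedE F k : corrected F k - F k =
  antidiff (fun k => (resist k - 1) * (F (k + 1) - F k)) k.
Proof.
have -> : (fun k => (resist k - 1) * (F (k + 1) - F k)) =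
  (fun k => resist k * (F (k + 1) - F k) - (F (k + 1) - F k)).
  by apply/funext => j; ring.
by rewrite antidiffB antidiffK /corrected; ring.
Qed.

Lemma correctedB F G k :
  corrected (fun k => F k - G k) k = corrected F k - corrected G k.
Proof.
rewrite /corrected.
have -> : (fun k => resist k * (F (k + 1) - G (k + 1) - (F k - G k))) =
  (fun k => resist k * (F (k + 1) - F k) - resist k * (G (k + 1) - G k)).
  by apply/funext => j; ring.
by rewrite antidiffB; ring.
Qed.

Hypothesis resist_right : sublinear (fun i => resist i%:Z - 1).
Hypothesis resist_left : sublinear (fun i => resist (Negz i) - 1).

(** The size of the increments of a lattice function [f (k / n)] when the first
    two derivatives of [f] decay like the inverse cube; see [sample_smooth]. *)
Definition smooth_scale (n : nat) (B : R) (F : int -> R) := forall k : int,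
  `|F (k + 1) - F k| <= B * (n%:R ^+ 2 / (n + `|k|)%:R ^+ 3) /\
  `|F (k + 2) - F (k + 1) - (F (k + 1) - F k)| <= B * (n%:R / (n + `|k|)%:R ^+ 3).

(** The correction only sees the fluctuations of the resistances around their
    mean, and these have sublinear partial sums on both half-lines. *)
Lemma corrected_close (e : R) : 0 < e -> exists2 n0 : nat, (0 < n0)%N &
  forall n B F, (n0 <= n)%N -> 0 <= B -> smooth_scale n B F ->
  forall k, `|corrected F k - F k| <= e * B.
Proof.
move=> e0.
have [n1 n1_gt0 H1] := abel_sublinear resist_right e0.
have [n2 n2_gt0 H2] := abel_sublinear resist_left e0.
exists (maxn n1 n2); first by rewrite leq_max n1_gt0.
move=> n B F; rewrite geq_max => /andP[nn1 nn2] B0 sF k.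
have n_gt0 : (0 < n)%N by apply: leq_trans nn1.
have mono i j p : (i <= j)%N -> B * (n%:R ^+ p / (n + j)%:R ^+ 3) <=
                  B * (n%:R ^+ p / (n + i)%:R ^+ 3).
  move=> ij; rewrite ler_wpM2l// ler_wpM2l ?exprn_ge0//.
  by rewrite lef_pV2 ?posrE ?exprn_gt0 ?ltr0n ?addn_gt0 ?n_gt0//
    lerXn2r ?nnegrE// ler_nat leq_add2l.
rewrite correctedE; case: k => k /=.
  apply: (H1 n B (fun i => F (i%:Z + 1) - F i%:Z)) => // i.
    by have [] := sF i%:Z.
  have [_ h] := sF i%:Z; apply: le_trans h; rewrite -[i.+1]addn1 PoszD.
  by rewrite -[i%:Z + 1 + 1]addrA.
rewrite normrN.
under eq_bigr do rewrite NegzD1.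
apply: (H2 n B (fun i => F (- i%:Z) - F (Negz i))) => // i.
  have [h _] := sF (Negz i); move: h; rewrite NegzD1 => /le_trans; apply.
  by rewrite mono// NegzE; lia.
have [_ h] := sF (Negz i.+1); move: h; rewrite Negz_succ.
have -> : Negz i.+1 + 2 = - i%:Z by rewrite NegzE; lia.
have -> : - (i.+1)%:Z = Negz i by rewrite NegzE.
rewrite -normrN => h.
have -> : F (Negz i) - F (Negz i.+1) - (F (- i%:Z) - F (Negz i)) =
  - (F (- i%:Z) - F (Negz i) - (F (Negz i) - F (Negz i.+1))) by ring.
apply: (le_trans h); rewrite -[n%:R in leLHS]expr1 -[n%:R in leRHS]expr1 mono//.
by rewrite NegzE; lia.
Qed.

Definition square (k : int) : R := (k ^+ 2)%:~R.

Lemma square_diff k : square (k + 1) - square k = 2 * k%:~R + 1.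
Proof. by rewrite /square !rmorphXn rmorphD /=; ring. Qed.

(** The increments of the square grow linearly, so that summation by parts
    against sublinear fluctuations costs an arbitrarily small multiple of
    [k ^ 2]; one half suffices to keep [corrected square] comparable to it. *)
Lemma corrected_square : exists2 C : R, 0 <= C &
  forall k, `|corrected square k - square k| <= square k / 2 + C.
Proof.
have e0 : 0 < 16^-1 :> R by [].
have [C1 C10 H1] := resist_right e0.
have [C2 C20 H2] := resist_left e0.
pose C := C1 + C2.
have aux (A G : nat -> R) k : (forall n, `|\sum_(0 <= i < n) A i| <= 16^-1 * n%:R + C) ->
   (forall i, `|G i| <= 2 * i%:R + 1) -> (forall i, `|G i.+1 - G i| <= 2) ->
   `|\sum_(0 <= i < k) A i * G i| <= k%:R ^+ 2 / 2 + (4 * C + 1) ^+ 2 + C.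
  move=> hA hG hdG; apply: (le_trans (abel_bound _ _ _)).
  have h1 : `|\sum_(0 <= i < k) A i| * `|G k| <= (16^-1 * k%:R + C) * (2 * k%:R + 1).
    by apply: ler_pM.
  have h2 : \sum_(0 <= i < k) `|\sum_(0 <= i < i.+1) A i| * `|G i.+1 - G i| <=
            \sum_(0 <= i < k) (16^-1 * k%:R + C) * 2.
    rewrite big_nat_cond [leRHS]big_nat_cond; apply: ler_sum => i.
    rewrite andbT => /andP[_ ik]; apply: ler_pM => //.
    apply: (le_trans (hA _)); rewrite lerD2r ler_pM2l// ler_nat//.
  move: h2; rewrite big_const_nat iter_addr_0 subn0 -mulr_natl => h2.
  have k0 : 0 <= k%:R :> R by [].
  have CC : 0 <= C by rewrite addr_ge0.
  have := sqr_ge0 (k%:R / 2 - (4 * C + 1)).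
  nra.
exists ((4 * C + 1) ^+ 2 + C); first by rewrite addr_ge0 ?sqr_ge0 ?addr_ge0.
move=> k; rewrite correctedE addrA.
under eq_fun do rewrite square_diff.
case: k => k /=.
  apply: (le_trans (aux _ (fun i => 2 * i%:R + 1) k _ _ _)).
  - by move=> n; apply: (le_trans (H1 n)); rewrite lerD2l lerDl.
  - by move=> i; rewrite ger0_norm// addr_ge0// mulr_ge0.
  - move=> i; have -> : 2 * i.+1%:R + 1 - (2 * i%:R + 1) = 2 :> R.
      by rewrite -natr1; ring.
    by rewrite normr_nat.
  - by rewrite /square rmorphXn.
rewrite normrN.
apply: (le_trans (aux _ (fun i => 2 * (Negz i)%:~R + 1) k.+1 _ _ _)).
- by move=> n; apply: (le_trans (H2 n)); rewrite lerD2l lerDr.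
- move=> i; rewrite NegzE mulrNz -[(i.+1%:Z)%:~R]/(i.+1%:R : R) -natr1.
  by rewrite -normrN ger0_norm; have : 0 <= i%:R :> R by []; lra.
- move=> i; rewrite !NegzE !mulrNz.
  rewrite -[(i.+2%:Z)%:~R]/(i.+2%:R : R) -[(i.+1%:Z)%:~R]/(i.+1%:R : R) -[i.+2%:R]natr1.
  have -> : 2 * - (i.+1%:R + 1) + 1 - (2 * - i.+1%:R + 1) = - 2 :> R by ring.
  by rewrite normrN normr_nat.
- by rewrite /square NegzE rmorphXn rmorphN /= sqrrN.
Qed.

End harmonic.

Lemma sublinearZ (R : realType) (x : R) (A : nat -> R) :
  sublinear A -> sublinear (fun i => x * A i).
Proof.
move=> sA e e0; have x0 : 0 < `|x| + 1 by rewrite ltr_wpDl.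
have [C C0 H] := sA (e / (`|x| + 1)) (divr_gt0 e0 x0).
exists (`|x| * C); first by rewrite mulr_ge0.
move=> n; rewrite -mulr_sumr normrM.
apply: (le_trans (ler_wpM2l (normr_ge0 _) (H n))).
rewrite mulrDr lerD2r.
have -> : `|x| * (e / (`|x| + 1) * n%:R) = e * n%:R * (`|x| / (`|x| + 1)) by ring.
by rewrite ler_piMr ?mulr_ge0 ?(ltW e0)// ler_pdivrMr// mul1r lerDl.
Qed.

Section cesaro_resist.
Context {R : realType}.
Variables (c : int -> R) (alpha : R).
Hypotheses (c_gt0 : forall k, 0 < c k) (alpha_gt0 : 0 < alpha).

Lemma resistB1 k : resist c alpha k - 1 = alpha^-1 * ((c k)^-1 - alpha).
Proof. by rewrite /resist; field; rewrite !gt_eqF. Qed.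

Lemma resist_right_sublinear :
  k%:R^-1 * \sum_(0 <= j < k) (c j%:Z)^-1 @[k --> \oo] --> alpha ->
  sublinear (fun i => resist c alpha i%:Z - 1).
Proof.
by move=> h; under eq_fun do rewrite resistB1; exact/sublinearZ/cesaro_sublinear.
Qed.

Lemma resist_left_sublinear :
  k%:R^-1 * \sum_(1 <= j < k.+1) (c (- j%:Z))^-1 @[k --> \oo] --> alpha ->
  sublinear (fun i => resist c alpha (Negz i) - 1).
Proof.
move=> h; under eq_fun do rewrite resistB1; apply/sublinearZ/cesaro_sublinear.
under eq_fun do (under eq_bigr do rewrite NegzE); move: h.
by under eq_fun do rewrite big_add1 /=.
Qed.

End cesaro_resist.

(** * Averaging sweeps over a box *)

Section box.

Definition sites (L : nat) : seq int := [seq i%:Z - L%:Z | i <- iota 0 (2 * L).+1].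
Definition bonds (L : nat) : seq int := [seq i%:Z - L%:Z | i <- iota 0 (2 * L)].

Lemma mem_sites L j : (j \in sites L) = (`|j| <= L)%N.
Proof.
apply/mapP/idP => [[i]|jL]; first by rewrite mem_iota => ? ->; lia.
by exists (absz (j + L%:Z)%R); rewrite ?mem_iota; lia.
Qed.

Lemma mem_bonds L k : (k \in bonds L) = (- L%:Z <= k < L%:Z).
Proof.
apply/mapP/idP => [[i]|jL]; first by rewrite mem_iota => ? ->; lia.
by exists (absz (k + L%:Z)%R); rewrite ?mem_iota; lia.
Qed.

Lemma uniq_sites L : uniq (sites L).
Proof. by rewrite map_inj_uniq ?iota_uniq// => i j /=; lia. Qed.

Lemma uniq_bonds L : uniq (bonds L).
Proof. by rewrite map_inj_uniq ?iota_uniq// => i j /=; lia. Qed.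

Lemma size_sites L : size (sites L) = (2 * L).+1.
Proof. by rewrite size_map size_iota. Qed.

Lemma bond_sites L k : k \in bonds L -> k \in sites L /\ k + 1 \in sites L.
Proof. by rewrite mem_bonds !mem_sites; lia. Qed.

Lemma sum_window (R : realType) (G : int -> R) (M : R) L K : 0 <= M ->
  (forall j, j \in sites L -> (`|j| <= K)%N -> G j <= M) ->
  \sum_(j <- sites L | (`|j| <= K)%N) G j <= M * (2 * K%:R + 1).
Proof.
move=> M0 GM; rewrite -big_filter.
apply: (@le_trans _ _ (\sum_(j <- [seq j <- sites L | (`|j| <= K)%N]) M)).
  rewrite big_seq [leRHS]big_seq; apply: ler_sum => j.
  by rewrite mem_filter => /andP[jK jL]; exact: GM.
have -> : 2 * K%:R + 1 = (2 * K).+1%:R :> R by rewrite -[in RHS]natr1 natrM.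
rewrite big_const_seq count_predT iter_addr_0 -[M *+ _]mulr_natr ler_wpM2l//.
rewrite ler_nat -size_sites; apply: uniq_leq_size; first by rewrite filter_uniq ?uniq_sites.
by move=> j; rewrite mem_filter !mem_sites => /andP[].
Qed.

End box.

Section sweep.
Context {R : realType}.
Variables (c : int -> R).
Hypothesis c_gt0 : forall k, 0 < c k.
Implicit Types (E : seq int) (u v : int -> R) (h M : R).

(** The probability that a Poisson process of rate [c k] jumps during a time [h]. *)
Definition ring_prob k h : R := 1 - expR (- (c k * h)).

Definition sweep E h u := evolve [seq (k, ring_prob k h) | k <- E] u.

Definition gen E v j : R :=
  \sum_(k <- E) c k * (v (k + 1) - v k) * dipole k j.

Lemma sweep_cons k E h u :
  sweep (k :: E) h u = bond_step (ring_prob k h) k (sweep E h u).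
Proof. by []. Qed.

Lemma ring_prob_bounds k h : 0 <= h ->
  [/\ 0 <= ring_prob k h, ring_prob k h <= 1 & ring_prob k h <= c k * h].
Proof.
move=> h0; have x0 : 0 <= c k * h by rewrite mulr_ge0// ltW.
rewrite /ring_prob; split; last by have := expR_ge1Dx (- (c k * h)); lra.
  by rewrite subr_ge0 -expR0 ler_expR oppr_le0.
by rewrite lerBlDr lerDl expR_ge0.
Qed.

Lemma one_sub_expR_lower (x : R) : 0 <= x -> x - x ^+ 2 <= 1 - expR (- x).
Proof.
move=> x0; have := expR_ge1Dx x => h.
rewrite expRN.
have : (expR x)^-1 <= (1 + x)^-1 by rewrite lef_pV2// ?posrE ?expR_gt0//; lra.
have : (1 + x)^-1 <= 1 - x + x ^+ 2.
  rewrite -[(1 + x)^-1]mul1r ler_pdivrMr; last lra.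
  have := exprn_ge0 3 x0; nra.
lra.
Qed.

Lemma ring_prob_near k h : 0 <= h ->
  `|ring_prob k h - h * c k| <= (c k * h) ^+ 2.
Proof.
move=> h0; have x0 : 0 <= c k * h by rewrite mulr_ge0// ltW.
have [_ _ h1] := ring_prob_bounds k h0.
have := one_sub_expR_lower x0; rewrite -/(ring_prob k h) => h2.
by rewrite ler_norml; apply/andP; split; have := sqr_ge0 (c k * h); lra.
Qed.

Lemma bond_step_bound (s : {pred int}) p k u M :
  0 <= p <= 1 -> k \in s -> k + 1 \in s -> {in s, forall j, `|u j| <= M} ->
  {in s, forall j, `|bond_step p k u j| <= M}.
Proof.
move=> /andP[p0 p1] ks k1s uM j js; have q0 : 0 <= 1 - p by lra.
have aux x y : `|x| <= M -> `|y| <= M -> `|(1 - p) * x + p * y| <= M.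
  move=> xM yM; apply: (le_trans (ler_normD _ _)).
  rewrite !normrM (ger0_norm p0) (ger0_norm q0).
  have := ler_wpM2l q0 xM; have := ler_wpM2l p0 yM; lra.
rewrite bond_stepE; case: eqP => _; first by apply: aux; apply: uM.
by case: eqP => _; [apply: aux; apply: uM|exact: uM].
Qed.

Lemma sweep_bound_in (s : {pred int}) E h u M : 0 <= h ->
  (forall k, k \in E -> k \in s /\ k + 1 \in s) ->
  {in s, forall j, `|u j| <= M} -> {in s, forall j, `|sweep E h u j| <= M}.
Proof.
move=> h0 Es uM; elim: E Es => [//|k E IH] Es.
have [ks k1s] := Es k (mem_head _ _).
have [p0 p1 _] := ring_prob_bounds k h0.
rewrite sweep_cons; apply: bond_step_bound => //; first by rewrite p0.
by apply: IH => i iE; apply: Es; rewrite inE iE orbT.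
Qed.

Lemma sweep_bound E h u M : 0 <= h -> (forall j, `|u j| <= M) ->
  forall j, `|sweep E h u j| <= M.
Proof.
move=> h0 uM j; exact: (@sweep_bound_in predT E h u M).
Qed.

Lemma bond_stepB p k u v j :
  bond_step p k (fun j => u j - v j) j = bond_step p k u j - bond_step p k v j.
Proof. by rewrite /bond_step; ring. Qed.

Lemma sweepB E h u v j :
  sweep E h (fun j => u j - v j) j = sweep E h u j - sweep E h v j.
Proof.
elim: E j => [//|k E IH] j; rewrite /sweep /= -bond_stepB.
by congr (bond_step _ _ _ j); apply/funext => i; exact: IH.
Qed.

Lemma gradient_bound u M k : (forall j, `|u j| <= M) ->
  `|u (k + 1) - u k| <= 2 * M.
Proof.
move=> uM; apply: (le_trans (ler_normB _ _)).
by have := uM k; have := uM (k + 1); lra.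
Qed.

Lemma dipole_scale_le (x : R) k j : `|x * dipole k j| <= `|x|.
Proof. by rewrite normrM ler_piMr// ler_dipole. Qed.

Lemma sweep_first_order E : exists2 C : R, 0 <= C &
  forall h v M, 0 <= h -> (forall j, `|v j| <= M) ->
  forall j, `|sweep E h v j - v j| <= C * h * M.
Proof.
elim: E => [|k E [C C0 IH]].
  by exists 0 => // h v M _ _ j; rewrite subrr normr0 !mul0r.
have ck := ltW (c_gt0 k).
exists (C + 2 * c k); first by rewrite addr_ge0// mulr_ge0.
move=> h v M h0 vM j; set w := sweep E h v.
have [p0 _ p1] := ring_prob_bounds k h0.
have wM : forall j, `|w j| <= M by exact: sweep_bound.
have -> : sweep (k :: E) h v j - v j =
   (w j - v j) + ring_prob k h * (w (k + 1) - w k) * dipole k j.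
  by rewrite sweep_cons /bond_step -/w; ring.
apply: (le_trans (ler_normD _ _)).
have h1 := IH h v M h0 vM j.
have h2 := dipole_scale_le (ring_prob k h * (w (k + 1) - w k)) k j.
move: h2; rewrite [leRHS]normrM (ger0_norm p0) => h2.
have := ler_pM p0 (normr_ge0 _) p1 (gradient_bound k wM).
rewrite -/w in h1; lra.
Qed.

(** The constant depends on [E], but not on the function: it disappears when the
    number of time cells tends to infinity for a fixed box. *)
Lemma sweep_second_order E : exists2 C : R, 0 <= C &
  forall h v M, 0 <= h -> (forall j, `|v j| <= M) ->
  forall j, `|sweep E h v j - v j - h * gen E v j| <= C * h ^+ 2 * M.
Proof.
elim: E => [|k E [C C0 IH]].
  by exists 0 => // h v M _ _ j; rewrite /gen big_nil subrr mulr0 subr0 normr0 !mul0r.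
have [D D0 HD] := sweep_first_order E.
have ck := ltW (c_gt0 k).
exists (C + 2 * c k ^+ 2 + 2 * c k * D).
  by rewrite addr_ge0 ?addr_ge0 ?mulr_ge0 ?sqr_ge0.
move=> h v M h0 vM j; set w := sweep E h v.
have [p0 _ p1] := ring_prob_bounds k h0.
have wM : forall j, `|w j| <= M by exact: sweep_bound.
have -> : sweep (k :: E) h v j - v j - h * gen (k :: E) v j =
   (w j - v j - h * gen E v j) +
   ((ring_prob k h - h * c k) * (w (k + 1) - w k) +
    h * c k * ((w (k + 1) - v (k + 1)) - (w k - v k))) * dipole k j.
  by rewrite /gen big_cons sweep_cons /bond_step -/w; ring.
apply: (le_trans (ler_normD _ _)).
have h1 := IH h v M h0 vM j.
have h2 := dipole_scale_le ((ring_prob k h - h * c k) * (w (k + 1) - w k) +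
    h * c k * ((w (k + 1) - v (k + 1)) - (w k - v k))) k j.
have h3 : `|(ring_prob k h - h * c k) * (w (k + 1) - w k)| <= (c k * h) ^+ 2 * (2 * M).
  by rewrite normrM; apply: ler_pM => //; [exact: ring_prob_near|exact: gradient_bound].
have h4 : `|h * c k * ((w (k + 1) - v (k + 1)) - (w k - v k))| <=
    h * c k * (2 * (D * h * M)).
  rewrite normrM (ger0_norm (mulr_ge0 h0 ck)); apply: ler_wpM2l.
    exact: mulr_ge0.
  apply: (le_trans (ler_normB _ _)).
  by have := HD h v M h0 vM (k + 1); have := HD h v M h0 vM k; rewrite -/w; lra.
have := ler_normD ((ring_prob k h - h * c k) * (w (k + 1) - w k))
  (h * c k * ((w (k + 1) - v (k + 1)) - (w k - v k))).
rewrite -/w in h1; lra.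
Qed.

(** At the two end sites of the box one of the two fluxes is absent. *)
Lemma gen_box L v j : j \in sites L -> gen (bonds L) v j =
  (if j < L%:Z then c j * (v (j + 1) - v j) else 0) -
  (if - L%:Z < j then c (j - 1) * (v j - v (j - 1)) else 0).
Proof.
rewrite mem_sites => jL.
have sumd (X : int -> R) i : \sum_(k <- bonds L) X k * (i == k)%:R =
    if i \in bonds L then X i else 0.
  case: ifP => iL.
    rewrite (bigD1_seq i) ?uniq_bonds//= eqxx mulr1 big1 ?addr0// => k ki.
    by rewrite eq_sym (negbTE ki) mulr0.
  rewrite big_seq big1// => k kL; case: eqP => [ik|_]; last by rewrite mulr0.
  by rewrite ik kL in iL.
rewrite /gen; under eq_bigr do rewrite /dipole mulrBr.
have shift k : (j == k + 1) = (j - 1 == k) by apply/eqP/eqP; lia.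
under [X in X = _]eq_bigr do rewrite shift.
rewrite sumrB !sumd !mem_bonds; congr (_ - _).
  by have -> : (- L%:Z <= j < L%:Z) = (j < L%:Z) by lia.
have -> : (- L%:Z <= j - 1 < L%:Z) = (- L%:Z < j) by lia.
by rewrite subrK.
Qed.

Lemma gen_sym L u v :
  pairing (sites L) (gen (bonds L) u) v = pairing (sites L) u (gen (bonds L) v).
Proof.
have aux x y : pairing (sites L) (gen (bonds L) x) y =
    - \sum_(k <- bonds L) c k * (x (k + 1) - x k) * (y (k + 1) - y k).
  rewrite /pairing /gen; under eq_bigr do rewrite mulr_suml.
  rewrite exchange_big /= -sumrN big_seq [RHS]big_seq; apply: eq_bigr => k kL.
  have [ks k1s] := bond_sites kL.
  under eq_bigr do rewrite -mulrA.
  by rewrite -mulr_sumr (sum_dipole y (uniq_sites L) ks k1s); ring.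
rewrite [RHS]pairingC !aux; congr (- _); apply: eq_bigr => k _; ring.
Qed.

End sweep.

(** * Finite differences of functions with cubic decay *)

Section mean_value.
Context {R : realType}.

Lemma mean_value (f df : R -> R) (a b : R) : a <= b ->
  (forall x : R, a <= x <= b -> is_derive x 1 f (df x)) ->
  exists2 x, a <= x <= b & f b - f a = df x * (b - a).
Proof.
move=> ab fd; have [||x xab ->] := @MVT_segment R f df a b ab.
- by move=> x /andP[xa xb]; apply: fd; move: xa xb; rewrite !bnd_simp => /ltW -> /ltW ->.
- apply: derivable_within_continuous => x; rewrite in_itv/= => xab.
  by have [] := fd x xab.
- by exists x => //; move: xab; rewrite in_itv.
Qed.

Lemma second_difference (f df ddf : R -> R) (a h : R) : 0 <= h ->
  (forall x : R, is_derive x 1 f (df x)) ->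
  (forall x : R, is_derive x 1 df (ddf x)) ->
  exists2 x, a <= x <= a + 2 * h &
    f (a + 2 * h) - f (a + h) - (f (a + h) - f a) = ddf x * h ^+ 2.
Proof.
move=> h0 fd dfd.
have shd (x : R) : is_derive x 1 (fun x : R => x + h) 1.
  by apply: is_derive_eq; rewrite addr0.
have gd (x : R) : a <= x <= a + h ->
    is_derive x 1 (fun x : R => f (x + h) - f x) (df (x + h) - df x).
  move=> _; apply: is_deriveB; rewrite -[df (x + h)]mulr1.
  exact: (@is_derive1_comp R f (fun x => x + h)).
have le_h (x : R) : x <= x + h by rewrite lerDl.
have [x /andP[ax xh] Ex] := mean_value (le_h a) gd.
have [y /andP[xy yh] Ey] := mean_value (le_h x) (fun y _ => dfd y).
exists y; first by apply/andP; split; lra.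
have -> : a + 2 * h = a + h + h by ring.
by rewrite Ex Ey; ring.
Qed.

End mean_value.

Section decay.
Context {R : realType}.
Implicit Types (x y : R).

(** The exponent is dictated by [abel_sublinear]; it also makes the weight
    summable over the lattice. *)
Definition decay x : R := ((1 + `|x|)^-1) ^+ 3.

Lemma decay_ge0 x : 0 <= decay x.
Proof. by rewrite exprn_ge0// invr_ge0 addr_ge0. Qed.

Lemma decay_le1 x : decay x <= 1.
Proof.
rewrite exprn_ile1 ?invr_ge0 ?addr_ge0// invf_le1 ?lerDl// ltr_wpDr//.
Qed.

(** Submultiplicativity of the weight; it controls translations. *)
Lemma decay_shift x y : decay (x + y) <= (1 + `|y|) ^+ 3 * decay x.
Proof.
rewrite /decay -exprMn; have p z : 0 < 1 + `|z| :> R by rewrite ltr_wpDr.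
rewrite lerXn2r ?nnegrE ?mulr_ge0 ?invr_ge0 ?(ltW (p _))//.
rewrite ler_pdivlMr// mulrC ler_pdivrMr//.
have := ler_normB (x + y) y; rewrite addrK => h.
have := mulr_ge0 (normr_ge0 y) (normr_ge0 (x + y)); lra.
Qed.

Lemma decay_near x y : `|y - x| <= 2 -> decay y <= 27 * decay x.
Proof.
move=> yx; rewrite -[y](subrK x) addrC.
apply: (le_trans (decay_shift _ _)); rewrite ler_wpM2r ?decay_ge0//.
have -> : 27 = 3 ^+ 3 :> R by rewrite -natrX.
by rewrite lerXn2r ?nnegrE ?addr_ge0//; lra.
Qed.

Lemma decay_lattice (n : nat) (k : int) : (0 < n)%N ->
  decay (k%:~R / n%:R) = n%:R ^+ 3 / (n + `|k|)%:R ^+ 3.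
Proof.
move=> n0; have n1 : 0 < n%:R :> R by rewrite ltr0n.
rewrite -expr_div_n /decay; congr (_ ^+ 3).
rewrite normrM normfV (gtr0_norm n1) -intr_norm natrD natr_absz.
have k0 : 0 <= `|k|%:~R :> R by rewrite ler0z.
by field; rewrite !gt_eqF// ltr_wpDr.
Qed.

Lemma div_nat_small (K e : R) : 0 < e -> exists2 N : nat, (0 < N)%N &
  forall n, (N <= n)%N -> K / n%:R <= e.
Proof.
move=> e0; exists (Num.truncn (`|K| / e)).+1 => // n Nn.
have n0 : 0 < n%:R :> R by rewrite ltr0n; apply: leq_trans Nn.
rewrite ler_pdivrMr// mulrC -ler_pdivrMr//; apply: ltW.
apply: (@le_lt_trans _ _ (`|K| / e)); first by rewrite ler_pM2r ?invr_gt0// ler_norm.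
by apply: (lt_le_trans (truncnS_gt _)); rewrite ler_nat.
Qed.

(** Increments are derivatives at points within distance [2], and such a
    displacement costs a factor [(1 + 2) ^ 3 = 27] in the weight. *)
Lemma sample_smooth (f f1 f2 : R -> R) (B : R) n :
  (0 < n)%N ->
  (forall x : R, is_derive x 1 f (f1 x)) ->
  (forall x : R, is_derive x 1 f1 (f2 x)) ->
  (forall x, `|f1 x| <= B * decay x) -> (forall x, `|f2 x| <= B * decay x) ->
  smooth_scale n (27 * B) (fun k => f (k%:~R / n%:R)).
Proof.
move=> n0 fd f1d b1 b2 k.
have n1 : 1 <= n%:R :> R by rewrite ler1n.
have ni : 0 < n%:R^-1 :> R by rewrite invr_gt0; lra.
have ni1 : n%:R^-1 <= 1 :> R by rewrite invf_le1//; lra.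
have B0 : 0 <= B.
  have := le_trans (normr_ge0 _) (b1 0); rewrite pmulr_lge0//.
  by rewrite /decay normr0 addr0 invr1 expr1n.
set x := k%:~R / n%:R.
have E1 : (k + 1)%:~R / n%:R = x + n%:R^-1 by rewrite intrD mulrDl mul1r.
have E2 : (k + 2)%:~R / n%:R = x + 2 * n%:R^-1 by rewrite intrD mulrDl.
have main (z y : R) : `|y - x| <= 2 -> `|z| <= B * decay y ->
    `|z| <= 27 * B * (n%:R ^+ 3 / (n + `|k|)%:R ^+ 3).
  move=> yx zy; apply: (le_trans zy); rewrite -decay_lattice// -/x.
  by have := ler_wpM2l B0 (decay_near yx); lra.
have kn : 0 < (n + `|k|)%:R :> R by rewrite ltr0n addn_gt0 n0.
split.
  have xn : x <= x + n%:R^-1 by rewrite lerDl ltW.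
  have [y /andP[y0 y1] Ey] := mean_value xn (fun y _ => fd y).
  rewrite E1 Ey [x + _]addrC addrK normrM [X in _ * X]gtr0_norm//.
  have yx2 : `|y - x| <= 2 by rewrite ger0_norm ?subr_ge0//; lra.
  have h := main _ y yx2 (b1 y).
  rewrite ler_pdivrMr; last lra.
  by apply: (le_trans h); rewrite le_eqVlt; apply/orP; left; apply/eqP; ring.
have [y /andP[y0 y1] Ey] := second_difference x (ltW ni) fd f1d.
rewrite E1 E2 Ey normrM [X in _ * X]gtr0_norm; last by rewrite exprn_gt0.
have yx2 : `|y - x| <= 2 by rewrite ger0_norm ?subr_ge0//; lra.
have h := main _ y yx2 (b2 y).
rewrite exprVn ler_pdivrMr; last by rewrite exprn_gt0; lra.
by apply: (le_trans h); rewrite le_eqVlt; apply/orP; left; apply/eqP; ring.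
Qed.

End decay.

(** * Homogenization of smooth solutions of the heat equation *)

Section caloric.
Context {R : realType}.

(** [w r] is the [r]-th space derivative of a solution [w 0] of the heat equation.
    Fourth derivatives are needed because the time variation of [w 2] enters, and
    one time derivative is worth two space derivatives. *)
Record caloric (alpha T : R) (w : nat -> R -> R -> R) (B : R) : Prop := {
  caloric_dx : forall r (s x : R), (r < 4)%N -> 0 <= s <= T ->
    is_derive x 1 (w r s) (w r.+1 s x) ;
  caloric_ds : forall r (s x : R), (r <= 2)%N -> 0 <= s <= T ->
    is_derive s 1 (fun s => w r s x) (w r.+2 s x / alpha) ;
  caloric_decay : forall r (s x : R), (r <= 4)%N -> 0 <= s <= T ->
    `|w r s x| <= B * decay x }.

Definition lattice (n : nat) (f : R -> R) : int -> R := fun k => f (k%:~R / n%:R).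

End caloric.

Section convergence.
Context {R : realType}.
Variables (c : int -> R) (alpha : R).
Hypotheses (c_gt0 : forall k, 0 < c k) (alpha_gt0 : 0 < alpha).
Hypothesis resist_right : sublinear (fun i => resist c alpha i%:Z - 1).
Hypothesis resist_left : sublinear (fun i => resist c alpha (Negz i) - 1).
Variables (T : R) (w : nat -> R -> R -> R) (B : R).
Hypotheses (T_gt0 : 0 < T) (w_caloric : caloric alpha T w B).

Let B_ge0 : 0 <= B.
Proof.
have T0 : (0 : R) <= 0 <= T by apply/andP; split=> //; exact: ltW.
have := le_trans (normr_ge0 _) (caloric_decay w_caloric 0 (leq0n 4) T0).
by rewrite pmulr_lge0// /decay normr0 addr0 invr1 expr1n.
Qed.

Let lattice_smooth n r s : (0 < n)%N -> (r <= 2)%N -> 0 <= s <= T ->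
  smooth_scale n (27 * B) (lattice n (w r s)).
Proof.
move=> n0 r2 sT; apply: (@sample_smooth _ _ (w r.+1 s) (w r.+2 s)) => // x.
- by apply: (caloric_dx w_caloric) => //; lia.
- by apply: (caloric_dx w_caloric) => //; lia.
- by apply: (caloric_decay w_caloric) => //; lia.
- by apply: (caloric_decay w_caloric) => //; lia.
Qed.

(** Time increments of a solution are, up to the factor [(s2 - s1) / alpha], as
    smooth as its second derivative; hence the correction varies slowly in time. *)
Let time_increment (s1 s2 : R) n : (0 < n)%N -> 0 <= s1 -> s1 <= s2 -> s2 <= T ->
  smooth_scale n (27 * B * ((s2 - s1) / alpha))
    (fun k => lattice n (w 0 s2) k - lattice n (w 0 s1) k).
Proof.
move=> n0 s10 s12 s2T k.
have dT r (x : R) (s : R) : (r <= 2)%N -> s1 <= s <= s2 ->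
    is_derive s 1 (fun s => w r s x) (w r.+2 s x / alpha).
  by move=> r2 /andP[h1 h2]; apply: (caloric_ds w_caloric) => //; lra.
have D0 : 0 <= (s2 - s1) / alpha by rewrite divr_ge0 ?subr_ge0// ltW.
pose x : R := k%:~R / n%:R; pose x1 : R := (k + 1)%:~R / n%:R.
pose x2 : R := (k + 2)%:~R / n%:R.
split.
  have fd (s : R) : s1 <= s <= s2 -> is_derive s 1 (fun s => w 0 s x1 - w 0 s x)
      (w 2 s x1 / alpha - w 2 s x / alpha).
    by move=> h; apply: is_deriveB; exact: dT.
  have [s /andP[ss1 ss2] Es] := mean_value s12 fd.
  rewrite /lattice -/x -/x1.
  have -> : w 0 s2 x1 - w 0 s1 x1 - (w 0 s2 x - w 0 s1 x) =
    (w 2 s x1 - w 2 s x) * ((s2 - s1) / alpha).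
    transitivity (w 0 s2 x1 - w 0 s2 x - (w 0 s1 x1 - w 0 s1 x)); first ring.
    by rewrite Es; ring.
  have sT : 0 <= s <= T by lra.
  rewrite normrM (ger0_norm D0) mulrAC ler_wpM2r//.
  by have [] := @lattice_smooth n 2 s n0 isT sT k.
have fd (s : R) : s1 <= s <= s2 -> is_derive s 1
    (fun s => w 0 s x2 - w 0 s x1 - (w 0 s x1 - w 0 s x))
    (w 2 s x2 / alpha - w 2 s x1 / alpha - (w 2 s x1 / alpha - w 2 s x / alpha)).
  by move=> h; apply: is_deriveB; apply: is_deriveB; exact: dT.
have [s /andP[ss1 ss2] Es] := mean_value s12 fd.
rewrite /lattice -/x -/x1 -/x2.
have -> : w 0 s2 x2 - w 0 s1 x2 - (w 0 s2 x1 - w 0 s1 x1) -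
  (w 0 s2 x1 - w 0 s1 x1 - (w 0 s2 x - w 0 s1 x)) =
  (w 2 s x2 - w 2 s x1 - (w 2 s x1 - w 2 s x)) * ((s2 - s1) / alpha).
  transitivity (w 0 s2 x2 - w 0 s2 x1 - (w 0 s2 x1 - w 0 s2 x) -
    (w 0 s1 x2 - w 0 s1 x1 - (w 0 s1 x1 - w 0 s1 x))); first ring.
  by rewrite Es; ring.
have sT : 0 <= s <= T by lra.
rewrite normrM (ger0_norm D0) mulrAC ler_wpM2r//.
by have [] := @lattice_smooth n 2 s n0 isT sT k.
Qed.

(** By [corrected_flux] the generator of the disordered medium acts on the
    corrected function like the discrete Laplacian on the lattice function. Only
    the two end sites of the box feel the missing bonds, and there the solution is
    small. *)
Let gen_consistent n L s j : (0 < n)%N -> (0 < L)%N -> 0 <= s <= T ->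
  j \in sites L ->
  `|n%:R ^+ 2 * alpha * gen c (bonds L) (corrected c alpha (lattice n (w 0 s))) j
    - lattice n (w 2 s) j| <= 2 * B / n%:R + 81 * B * n%:R ^+ 4 / L%:R.
Proof.
move=> n0 L0 sT jL; set F := lattice n (w 0 s).
have n1 : 1 <= n%:R :> R by rewrite ler1n.
have L1 : 1 <= L%:R :> R by rewrite ler1n.
have E : alpha * gen c (bonds L) (corrected c alpha F) j =
  (if j < L%:Z then F (j + 1) - F j else 0) -
  (if - L%:Z < j then F j - F (j - 1) else 0).
  rewrite gen_box// corrected_flux//.
  have := corrected_flux c_gt0 alpha_gt0 F (j - 1); rewrite subrK => ->.
  by case: ifP => _; case: ifP => _; field; rewrite ?gt_eqF.
rewrite -mulrA E {E}.
have t1 : 0 <= 2 * B / n%:R by rewrite divr_ge0// mulr_ge0.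
have t2 : 0 <= 81 * B * n%:R ^+ 4 / L%:R by rewrite divr_ge0// !mulr_ge0.
have [jin|jout] := boolP ((j < L%:Z) && (- L%:Z < j)).
  have /andP[-> ->] := jin.
  have ni : 0 <= n%:R^-1 :> R by rewrite invr_ge0; lra.
  have [y /andP[y0 y1] Ey] := second_difference ((j - 1)%:~R / n%:R) ni
    (fun x => caloric_dx w_caloric x (isT : (0 < 4)%N) sT)
    (fun x => caloric_dx w_caloric x (isT : (1 < 4)%N) sT).
  have e1 : (j - 1)%:~R / n%:R + n%:R^-1 = j%:~R / n%:R :> R.
    by rewrite intrB mulrBl mul1r subrK.
  have e2 : (j - 1)%:~R / n%:R + 2 * n%:R^-1 = (j + 1)%:~R / n%:R :> R.
    by rewrite intrB intrD; ring.
  have -> : n%:R ^+ 2 * (F (j + 1) - F j - (F j - F (j - 1))) = w 2 s y.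
    rewrite /F /lattice -e1 -e2 Ey; field; rewrite gt_eqF//; lra.
  apply: (@le_trans _ _ (2 * B / n%:R)); last by rewrite lerDl.
  rewrite /lattice; set x := j%:~R / n%:R in e1 *.
  have yx : `|y - x| <= n%:R^-1 by rewrite ler_norml; lra.
  have lip (a b : R) : a <= b -> `|w 2 s b - w 2 s a| <= B * `|b - a|.
    move=> ab; have [z _ ->] := mean_value ab
       (fun z _ => caloric_dx w_caloric z (isT : (2 < 4)%N) sT).
    rewrite normrM ler_wpM2r//.
    apply: (le_trans (caloric_decay w_caloric z (isT : (3 <= 4)%N) sT)).
    by rewrite ler_piMr ?decay_le1.
  have h : `|w 2 s y - w 2 s x| <= B * `|y - x|.
    have [xy|/ltW xy] := leP x y; first exact: lip.
    by rewrite distrC (distrC y x); exact: lip.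
  by apply: (le_trans h); have := ler_wpM2l B_ge0 yx; have := mulr_ge0 B_ge0 ni; lra.
have jabs : (`|j| = L)%N.
  by move: jL jout; rewrite mem_sites; lia.
have dF k : (L <= n + `|k|)%N -> `|n%:R ^+ 2 * (F (k + 1) - F k)| <=
   27 * B * n%:R ^+ 4 / L%:R.
  move=> kL; rewrite normrM ger0_norm ?exprn_ge0//.
  have [h _] := @lattice_smooth n 0 s n0 isT sT k.
  have kn : L%:R <= (n + `|k|)%:R :> R by rewrite ler_nat.
  have h1 : n%:R ^+ 2 / (n + `|k|)%:R ^+ 3 <= n%:R ^+ 2 / L%:R :> R.
    rewrite ler_pM2l ?exprn_gt0//; last lra.
    rewrite lef_pV2 ?posrE ?exprn_gt0//; try lra.
    apply: (le_trans kn); rewrite -[leLHS]expr1 ler_weXn2l//; lra.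
  apply: (le_trans (ler_wpM2l (exprn_ge0 2 (ler0n R n)) h)).
  have := ler_wpM2l (mulr_ge0 (ler0n R 27) B_ge0) h1.
  move=> /(ler_wpM2l (exprn_ge0 2 (ler0n R n))) /le_trans; apply.
  by rewrite le_eqVlt; apply/orP; left; apply/eqP; ring.
have h3 : `|lattice n (w 2 s) j| <= 27 * B * n%:R ^+ 4 / L%:R.
  apply: (le_trans (caloric_decay w_caloric _ (isT : (2 <= 4)%N) sT)).
  rewrite decay_lattice// jabs.
  have h1 : n%:R ^+ 3 / (n + L)%:R ^+ 3 <= n%:R ^+ 4 / L%:R :> R.
    apply: ler_pM; rewrite ?invr_ge0 ?exprn_ge0// ?ler_weXn2l//.
    rewrite lef_pV2 ?posrE ?exprn_gt0 ?ltr0n ?addn_gt0 ?n0//; try lra.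
    have : L%:R <= (n + L)%:R :> R by rewrite ler_nat leq_addl.
    move=> h; apply: (le_trans h); rewrite -[leLHS]expr1 ler_weXn2l//; lra.
  have := ler_wpM2l B_ge0 h1.
  have := mulr_ge0 B_ge0 (divr_ge0 (exprn_ge0 4 (ler0n R n)) (ler0n R L)).
  lra.
apply: (le_trans (ler_normB _ _)); rewrite mulrBr.
apply: (le_trans (lerD (ler_normB _ _) h3)).
have q0 : 0 <= 27 * B * n%:R ^+ 4 / L%:R by rewrite divr_ge0// !mulr_ge0.
have hl : `|n%:R ^+ 2 * (if j < L%:Z then F (j + 1) - F j else 0)| <=
   27 * B * n%:R ^+ 4 / L%:R.
  by case: ifP => _; [apply: dF; rewrite jabs leq_addl|rewrite mulr0 normr0].
have hr : `|n%:R ^+ 2 * (if - L%:Z < j then F j - F (j - 1) else 0)| <=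
   27 * B * n%:R ^+ 4 / L%:R.
  case: ifP => _; last by rewrite mulr0 normr0.
  by have := @dF (j - 1); rewrite subrK; apply; move: n0 jabs; clear; lia.
lra.
Qed.

Let v n s := corrected c alpha (lattice n (w 0 s)).

(** The error committed during a time cell of length [d] is [d] times something
    small, up to a term of order [d ^ 2]; hence the errors of all the cells add up
    to something small. *)
Let one_step n L C e s d j : (0 < n)%N -> (0 < L)%N -> 0 <= e ->
  (forall (B' : R) F, 0 <= B' -> smooth_scale n B' F ->
     forall k, `|corrected c alpha F k - F k| <= e * B') ->
  (forall (h : R) u (M : R), 0 <= h -> (forall j, `|u j| <= M) ->
     forall j, `|sweep c (bonds L) h u j - u j - h * gen c (bonds L) u j|
               <= C * h ^+ 2 * M) ->
  0 <= s -> 0 <= d -> s + d <= T -> j \in sites L ->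
  `|sweep c (bonds L) (n%:R ^+ 2 * d) (v n s) j - v n (s + d) j| <=
  C * (n%:R ^+ 2 * d) ^+ 2 * (B + e * (27 * B)) +
  d / alpha * (e * (27 * B) + (2 * B / n%:R + 81 * B * n%:R ^+ 4 / L%:R) +
               B * (d / alpha)).
Proof.
move=> n0 L0 e0 close second s0 d0 sdT jL.
have sT : 0 <= s <= T by lra.
have ssd : s <= s + d by lra.
have B27 : 0 <= 27 * B by rewrite mulr_ge0.
have dA : 0 <= d / alpha by rewrite divr_ge0// ltW.
have vM k : `|v n s k| <= B + e * (27 * B).
  have h1 := close _ _ B27 (@lattice_smooth n 0 s n0 isT sT) k.
  have h2 : `|lattice n (w 0 s) k| <= B.
    apply: (le_trans (caloric_decay w_caloric _ (leq0n 4) sT)).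
    by rewrite ler_piMr ?decay_le1.
  rewrite -[v n s k](subrK (lattice n (w 0 s) k)).
  by apply: (le_trans (ler_normD _ _)); rewrite addrC lerD.
have h1 := second _ _ _ (mulr_ge0 (exprn_ge0 2 (ler0n R n)) d0) vM j.
have D : `|v n (s + d) j - v n s j -
    (lattice n (w 0 (s + d)) j - lattice n (w 0 s) j)| <= e * (27 * B) * (d / alpha).
  rewrite /v -correctedB -mulrA.
  have B' : 0 <= 27 * B * (d / alpha) by exact: mulr_ge0.
  apply: (close _ _ B' _ j).
  have := @time_increment s (s + d) n n0 s0 ssd sdT.
  by have -> : s + d - s = d by ring.
pose x : R := j%:~R / n%:R.
have dT r (y : R) : (r <= 2)%N -> s <= y <= s + d ->
    is_derive y 1 (fun y => w r y x) (w r.+2 y x / alpha).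
  by move=> r2 /andP[z1 z2]; apply: (caloric_ds w_caloric) => //; lra.
have [z /andP[sz zs] Ez] := mean_value ssd (fun y h => dT 0%N y isT h).
have zd : `|w 2 z x - w 2 s x| <= B * (d / alpha).
  have dTz (y : R) : s <= y <= z -> is_derive y 1 (fun y => w 2 y x) (w 4 y x / alpha).
    by move=> h; apply: dT => //; lra.
  have [y /andP[sy yz] ->] := mean_value sz dTz.
  have yT : 0 <= y <= T by lra.
  have -> : w 4 y x / alpha * (z - s) = w 4 y x * ((z - s) / alpha) by ring.
  have q : 0 <= (z - s) / alpha by rewrite divr_ge0 ?subr_ge0// ltW.
  rewrite normrM (ger0_norm q); apply: ler_pM => //.
    apply: (le_trans (caloric_decay w_caloric _ (leqnn 4) yT)).
    by rewrite ler_piMr ?decay_le1.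
  by rewrite ler_pM2r ?invr_gt0//; lra.
have G := gen_consistent n0 L0 sT jL.
rewrite -/(v n s) /lattice -/x in G.
have E : sweep c (bonds L) (n%:R ^+ 2 * d) (v n s) j - v n (s + d) j =
  (sweep c (bonds L) (n%:R ^+ 2 * d) (v n s) j - v n s j -
     n%:R ^+ 2 * d * gen c (bonds L) (v n s) j)
  - (v n (s + d) j - v n s j - (lattice n (w 0 (s + d)) j - lattice n (w 0 s) j))
  + d / alpha * ((n%:R ^+ 2 * alpha * gen c (bonds L) (v n s) j - w 2 s x)
     - (w 2 z x - w 2 s x)).
  have Ez' : lattice n (w 0 (s + d)) j - lattice n (w 0 s) j = d / alpha * w 2 z x.
    by rewrite /lattice -/x Ez; ring.
  by rewrite Ez'; field; rewrite gt_eqF.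
rewrite E; apply: (le_trans (ler_normD _ _)).
apply: (le_trans (lerD (ler_normB _ _) (lexx _))).
apply: (le_trans (lerD (lerD h1 D) (lexx _))).
rewrite -addrA lerD2l [X in _ + X <= _]normrM (ger0_norm dA).
have := le_trans (ler_normB _ _) (lerD G zd).
move=> /(ler_wpM2l dA); lra.
Qed.

(** Consistency on the corrected function and stability: a sweep is a contraction
    for the sup norm, so the errors made in the successive time cells add up
    without being amplified. The number [m] of cells tends to infinity first,
    then the box, then the scale [n]. *)
Lemma caloric_converges (e : R) : 0 < e ->
  exists2 n0, (0 < n0)%N & forall n, (n0 <= n)%N ->
  exists2 L0, (0 < L0)%N & forall L, (L0 <= L)%N ->
  exists2 m0, (0 < m0)%N & forall m, (m0 <= m)%N ->
  {in sites L, forall j,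
    `|iter m (sweep c (bonds L) (n%:R ^+ 2 * (T / m%:R))) (lattice n (w 0 0)) j
      - lattice n (w 0 T) j| <= e}.
Proof.
move=> e0; have e4 : 0 < e / 4 by rewrite divr_gt0.
have TA : 0 < T / alpha by rewrite divr_gt0.
pose K := 27 * B * (2 + T / alpha) + 1.
have K0 : 0 < K by rewrite /K ltr_wpDl// !mulr_ge0// addr_ge0// ltW.
have e'0 : 0 < e / 4 / K by rewrite divr_gt0.
have [n1 n1_gt0 close] := corrected_close alpha_gt0 resist_right resist_left e'0.
have [n2 n2_gt0 small_n] := div_nat_small (T / alpha * (2 * B)) e4.
exists (maxn n1 n2) => [|n]; first by rewrite leq_max n1_gt0.
rewrite geq_max => /andP[nn1 nn2].
have n_gt0 : (0 < n)%N by apply: leq_trans nn1.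
have [L1 L1_gt0 small_L] := div_nat_small (T / alpha * (81 * B * n%:R ^+ 4)) e4.
exists L1 => // L LL1; have L_gt0 : (0 < L)%N by apply: leq_trans LL1.
have [C C0 second] := sweep_second_order c_gt0 (bonds L).
set e' := e / 4 / K in e'0 close.
pose Q := C * (n%:R ^+ 2 * T) ^+ 2 * (B + e' * (27 * B)) + B * (T / alpha) ^+ 2.
have [m1 m1_gt0 small_m] := div_nat_small Q e4.
exists m1 => // m mm1; have m_gt0 : (0 < m)%N by apply: leq_trans mm1.
have m0 : 0 < m%:R :> R by rewrite ltr0n.
set d := T / m%:R.
have d0 : 0 <= d by rewrite divr_ge0// ltW.
have close' B' F : 0 <= B' -> smooth_scale n B' F ->
    forall k, `|corrected c alpha F k - F k| <= e' * B' by exact: close.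
set u := fun i => iter i (sweep c (bonds L) (n%:R ^+ 2 * d)) (lattice n (w 0 0)).
set r := C * (n%:R ^+ 2 * d) ^+ 2 * (B + e' * (27 * B)) +
  d / alpha * (e' * (27 * B) + (2 * B / n%:R + 81 * B * n%:R ^+ 4 / L%:R) +
               B * (d / alpha)).
have init s : 0 <= s <= T -> forall k, `|v n s k - lattice n (w 0 s) k| <= e' * (27 * B).
  by move=> sT; apply: close'; [exact: mulr_ge0|exact: lattice_smooth].
have ind i : (i <= m)%N -> {in sites L, forall j,
    `|u i j - v n (i%:R * d) j| <= e' * (27 * B) + i%:R * r}.
  elim: i => [_ j jL|i IH im j jL].
    rewrite !mul0r addr0 distrC; apply: init.
    by apply/andP; split=> //; exact: ltW.
  have iT : (i%:R + 1) * d <= T.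
    rewrite /d mulrCA -[leRHS]mulr1 ler_wpM2l ?(ltW T_gt0)//.
    by rewrite natr1 ler_pdivrMr// mul1r ler_nat.
  have id0 : 0 <= i%:R * d by rewrite mulr_ge0.
  have iE : i.+1%:R * d = i%:R * d + d by rewrite -natr1 mulrDl mul1r.
  have h1 : `|u i.+1 j - sweep c (bonds L) (n%:R ^+ 2 * d) (v n (i%:R * d)) j| <=
      e' * (27 * B) + i%:R * r.
    rewrite /u iterS -/(u i) -sweepB.
    apply: (@sweep_bound_in _ _ c_gt0 (mem (sites L))) => //.
    - by rewrite mulr_ge0 ?exprn_ge0.
    - by move=> k /bond_sites[].
    - by move=> k kL; apply: IH => //; exact: ltnW.
  have h2 := @one_step n L C e' (i%:R * d) d j n_gt0 L_gt0 (ltW e'0) close' second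
    id0 d0.
  have iT' : i%:R * d + d <= T by rewrite -iE -natr1.
  move: h2 => /(_ iT' jL); rewrite -/r => h2.
  rewrite -[u i.+1 j](subrK (sweep c (bonds L) (n%:R ^+ 2 * d) (v n (i%:R * d)) j)).
  rewrite -addrA iE; apply: (le_trans (ler_normD _ _)).
  have ir : i.+1%:R * r = i%:R * r + r by rewrite -natr1 mulrDl mul1r.
  by apply: (le_trans (lerD h1 h2)); rewrite ir; lra.
move=> j jL; have := ind m (leqnn m) j jL.
have -> : m%:R * d = T by rewrite /d mulrC divfK// gt_eqF.
have hT : 0 <= T <= T by rewrite lexx ltW.
move=> h; rewrite -/(u m j) -[u m j](subrK (v n T j)) -addrA.
apply: (le_trans (ler_normD _ _)); apply: (le_trans (lerD h (init _ hT j))).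
have -> : e' * (27 * B) + m%:R * r + e' * (27 * B) =
  e' * (27 * B * (2 + T / alpha)) + T / alpha * (2 * B) / n%:R +
  T / alpha * (81 * B * n%:R ^+ 4) / L%:R + Q / m%:R.
  rewrite /r /d /Q; set t1 := B / n%:R; field.
  by rewrite !gt_eqF// ltr0n.
have h1 : e' * (27 * B * (2 + T / alpha)) <= e / 4.
  rewrite /e' -mulrA ler_piMr ?(ltW e4)// mulrC ler_pdivrMr// mul1r /K lerDl//.
have h2 := small_n n nn2; have h3 := small_L L LL1; have h4 := small_m m mm1.
lra.
Qed.

End convergence.

(** * Tightness of the averaged test function *)

Section tightness.
Context {R : realType}.
Variables (c : int -> R) (alpha : R).
Hypotheses (c_gt0 : forall k, 0 < c k) (alpha_gt0 : 0 < alpha).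
Hypothesis resist_right : sublinear (fun i => resist c alpha i%:Z - 1).
Hypothesis resist_left : sublinear (fun i => resist c alpha (Negz i) - 1).

Lemma bond_step_norm p k (u : int -> R) j : 0 <= p <= 1 ->
  `|bond_step p k u j| <= bond_step p k (fun i => `|u i|) j.
Proof.
move=> /andP[p0 p1]; have q0 : 0 <= 1 - p by lra.
have aux x y : `|(1 - p) * x + p * y| <= (1 - p) * `|x| + p * `|y|.
  by apply: (le_trans (ler_normD _ _)); rewrite !normrM (ger0_norm p0) (ger0_norm q0).
by rewrite !bond_stepE; case: eqP => // _; case: eqP.
Qed.

Lemma bond_step_mono p k (u v : int -> R) j : 0 <= p <= 1 ->
  (forall i, u i <= v i) -> bond_step p k u j <= bond_step p k v j.
Proof.
move=> /andP[p0 p1] uv; have q0 : 0 <= 1 - p by lra.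
rewrite !bond_stepE; case: eqP => _; first by rewrite lerD ?ler_wpM2l.
by case: eqP => _ //; rewrite lerD ?ler_wpM2l.
Qed.

Lemma sweep_mono E h (u v : int -> R) j : 0 <= h ->
  (forall i, u i <= v i) -> sweep c E h u j <= sweep c E h v j.
Proof.
move=> h0 uv; elim: E j => [//|k E IH] j; rewrite !sweep_cons.
by apply: bond_step_mono => //; have [-> -> _] := ring_prob_bounds c_gt0 k h0.
Qed.

Lemma sweep_norm E h (u : int -> R) j : 0 <= h ->
  `|sweep c E h u j| <= sweep c E h (fun i => `|u i|) j.
Proof.
move=> h0; elim: E j => [//|k E IH] j; rewrite !sweep_cons.
have p01 : 0 <= ring_prob c k h <= 1.
  by have [-> -> _] := ring_prob_bounds c_gt0 k h0.
by apply: (le_trans (bond_step_norm _ _ _ p01)); exact: bond_step_mono.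
Qed.

Lemma iter_sweep_norm E h m (u : int -> R) j : 0 <= h ->
  `|iter m (sweep c E h) u j| <= iter m (sweep c E h) (fun i => `|u i|) j.
Proof.
move=> h0; elim: m j => [//|m IH] j; rewrite !iterS.
by apply: (le_trans (sweep_norm _ _ _ h0)); exact: sweep_mono.
Qed.

Lemma iter_sweep_bound E h m (u : int -> R) M : 0 <= h ->
  (forall j, `|u j| <= M) -> forall j, `|iter m (sweep c E h) u j| <= M.
Proof.
by move=> h0 uM; elim: m => [//|m IH] j; rewrite iterS; exact: sweep_bound.
Qed.

Lemma sweep_mass L h (u : int -> R) :
  pairing (sites L) (sweep c (bonds L) h u) (cst 1) = pairing (sites L) u (cst 1).
Proof.
have : forall k, k \in bonds L -> k \in bonds L by [].
elim: {1 3}(bonds L) => [//|k E IH] EL; rewrite sweep_cons.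
have [k0 k1] := bond_sites (EL k (mem_head _ _)).
rewrite pairing_step ?uniq_sites//= subrr mulr0 subr0 IH// => i iE.
by apply: EL; rewrite inE iE orbT.
Qed.

(** In the bulk the value is the constant [2 / alpha]; at an end of the box the
    missing flux would push outwards, so its absence lowers the value. *)
Lemma gen_corrected_square L j : j \in sites L ->
  gen c (bonds L) (corrected c alpha square) j <= 2 / alpha.
Proof.
move=> jL; rewrite gen_box// corrected_flux//.
have := corrected_flux c_gt0 alpha_gt0 square (j - 1); rewrite subrK => ->.
have := @square_diff R (j - 1); rewrite subrK => ->.
rewrite square_diff; have := jL; rewrite mem_sites => jL'.
have ia : 0 < alpha^-1 by rewrite invr_gt0.
have E : (j - 1)%:~R = j%:~R - 1 :> R by rewrite intrB.
have hi : ~~ (j < L%:Z) -> 0 <= j%:~R :> R by move=> ?; rewrite ler0z; lia.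
have lo : ~~ (- L%:Z < j) -> j%:~R <= 0 :> R by move=> ?; rewrite lerz0; lia.
rewrite E; case: ifPn => [_|/hi h1]; case: ifPn => [_|/lo h2]; nra.
Qed.

(** The second moment of [`|a|], measured by [corrected square], grows at most
    linearly in time because the generator is symmetric and sends
    [corrected square] to at most a constant, while the total mass is preserved.
    The tail is then bounded by Chebyshev's inequality. *)
Lemma second_moment_tail (T M : R) (r : nat) : 0 < T -> 0 <= M ->
  exists2 A : R, 0 <= A & forall n L, (0 < n)%N ->
  exists2 m0, (0 < m0)%N & forall m, (m0 <= m)%N ->
  forall a : int -> R, (forall k, `|a k| <= M) ->
    (forall k : int, (r * n < `|k|)%N -> a k = 0) ->
  forall K : nat, (0 < K)%N ->
  n%:R^-1 * \sum_(j <- sites L | (K * n < `|j|)%N)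
     `|iter m (sweep c (bonds L) (n%:R ^+ 2 * (T / m%:R))) a j|
  <= A / K%:R ^+ 2.
Proof.
move=> T0 M0.
have [Cq Cq0 Hq] := corrected_square resist_right resist_left.
set q := corrected c alpha square in Hq.
have TA : 0 < T / alpha by rewrite divr_gt0.
have r0 : 0 <= r%:R :> R by [].
pose A := 2 * (M * (2 * r%:R + 1) * (3 / 2 * r%:R ^+ 2 + 2 * Cq + 2 * (T / alpha)) + 1).
exists A.
  by rewrite /A; have := sqr_ge0 (r%:R : R) => ?; rewrite !mulr_ge0 ?addr_ge0 ?mulr_ge0 ?addr_ge0 //; lra.
move=> n L n0.
have [C C0 second] := sweep_second_order c_gt0 (bonds L).
have n1 : 1 <= n%:R :> R by rewrite ler1n.
pose S := \sum_(j <- sites L) `|q j|.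
have S0 : 0 <= S by exact: sumr_ge0.
have [m0 m0_gt0 small_m] := div_nat_small (C * (n%:R ^+ 2 * T) ^+ 2 * M * S) (ltr01 : 0 < 1 :> R).
exists m0 => // m mm0 a aM a0 K K0.
have m_gt0 : (0 < m)%N by apply: leq_trans mm0.
have mR : 0 < m%:R :> R by rewrite ltr0n.
set h := n%:R ^+ 2 * (T / m%:R).
have h0 : 0 <= h by rewrite mulr_ge0 ?exprn_ge0// divr_ge0// ltW.
pose b i := `|a i|.
pose u i := iter i (sweep c (bonds L) h) b.
have bM j : `|b j| <= M by rewrite normr_id.
have uM i j : `|u i j| <= M by exact: iter_sweep_bound.
have u0 i j : 0 <= u i j.
  by apply: le_trans (normr_ge0 _) (iter_sweep_norm _ _ _ _ h0).
have mass i : pairing (sites L) (u i) (cst 1) = pairing (sites L) b (cst 1).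
  by elim: i => [//|i IH]; rewrite /u iterS sweep_mass.
set m1 := pairing (sites L) b (cst 1) in mass.
have step i : pairing (sites L) (u i.+1) q <=
    pairing (sites L) (u i) q + h * (2 / alpha * m1) + C * h ^+ 2 * M * S.
  have E : pairing (sites L) (u i.+1) q = pairing (sites L) (u i) q
     + h * pairing (sites L) (gen c (bonds L) (u i)) q
     + \sum_(j <- sites L) (u i.+1 j - u i j - h * gen c (bonds L) (u i) j) * q j.
    rewrite /pairing mulr_sumr -!big_split /=; apply: eq_bigr => j _; ring.
  rewrite E {E}; apply: lerD; first apply: lerD => //.
    rewrite ler_wpM2l// gen_sym.
    rewrite -(mass i) /pairing mulr_sumr big_seq [leRHS]big_seq.
    apply: ler_sum => j jL; rewrite /= mulr1 mulrC ler_wpM2r//.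
    exact: gen_corrected_square.
  rewrite /S mulr_sumr; apply: ler_sum => j _.
  apply: (le_trans (ler_norm _)); rewrite normrM ler_wpM2r//.
  exact: (second h (u i) M h0 (uM i) j).
have iterated i : pairing (sites L) (u i) q <= pairing (sites L) b q +
    i%:R * (h * (2 / alpha * m1) + C * h ^+ 2 * M * S).
  elim: i => [|i IH]; first by rewrite mul0r addr0.
  by apply: (le_trans (step i)); rewrite -natr1; lra.
have q_low j : `|j|%:R ^+ 2 / 2 <= q j + Cq.
  have -> : `|j|%:R ^+ 2 = square j :> R.
    by rewrite /square rmorphXn /= natr_absz intr_norm real_normK// num_real.
  by have := Hq j; rewrite ler_norml => /andP[+ _]; lra.
have q_up j : q j <= 3 / 2 * `|j|%:R ^+ 2 + Cq.
  have -> : `|j|%:R ^+ 2 = square j :> R.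
    by rewrite /square rmorphXn /= natr_absz intr_norm real_normK// num_real.
  by have := Hq j; rewrite ler_norml => /andP[_]; lra.
have m1_ub : m1 <= M * (2 * r%:R + 1) * n%:R.
  rewrite /m1 /pairing.
  have -> : \sum_(j <- sites L) b j * cst 1 j =
     \sum_(j <- sites L | (`|j| <= r * n)%N) b j.
    rewrite [RHS]big_mkcond /=; apply: eq_bigr => j _; rewrite mulr1.
    by case: leqP => // /a0; rewrite /b => ->; rewrite normr0.
  apply: (le_trans (@sum_window _ b M L (r * n) M0 (fun j _ _ => aM j))); rewrite natrM.
  by have h1 := ler_wpM2l M0 n1; lra.
have bq : pairing (sites L) b (fun j => q j + Cq) <=
    m1 * (3 / 2 * (r%:R * n%:R) ^+ 2 + 2 * Cq).
  rewrite /m1 /pairing mulr_suml; apply: ler_sum => j _; rewrite mulr1.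
  have [jr|/a0] := leqP `|j| (r * n); last by rewrite /b => ->; rewrite normr0 !mul0r.
  rewrite ler_wpM2l ?normr_ge0//.
  have : `|j|%:R ^+ 2 <= (r%:R * n%:R) ^+ 2 :> R.
    by rewrite -natrM lerXn2r ?nnegrE// ler_nat.
  by have := q_up j; lra.
have m10 : 0 <= m1 by apply: sumr_ge0 => j _; rewrite mulr1 normr_ge0.
have total : pairing (sites L) (u m) (fun j => q j + Cq) <=
   m1 * (3 / 2 * (r%:R * n%:R) ^+ 2 + 2 * Cq + 2 * (n%:R ^+ 2 * (T / alpha))) + 1.
  have split (x : int -> R) : pairing (sites L) x (fun j => q j + Cq) =
      pairing (sites L) x q + Cq * pairing (sites L) x (cst 1).
    by rewrite /pairing mulr_sumr -big_split /=; apply: eq_bigr => j _; ring.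
  have := iterated m; have := bq; rewrite !split mass -/m1.
  have := small_m m mm0.
  have -> : m%:R * (h * (2 / alpha * m1) + C * h ^+ 2 * M * S) =
    m1 * (2 * (n%:R ^+ 2 * (T / alpha))) + C * (n%:R ^+ 2 * T) ^+ 2 * M * S / m%:R.
    by rewrite /h; field; rewrite !gt_eqF.
  lra.
have Kn : 0 < K%:R * n%:R :> R by rewrite mulr_gt0 ?ltr0n.
apply: (@le_trans _ _ (n%:R^-1 * (2 / (K%:R * n%:R) ^+ 2 *
   pairing (sites L) (u m) (fun j => q j + Cq)))).
  rewrite ler_wpM2l ?invr_ge0// /pairing mulr_sumr [leLHS]big_mkcond /=.
  apply: ler_sum => j _.
  have qj0 : 0 <= q j + Cq by apply: le_trans (q_low j); rewrite divr_ge0 ?exprn_ge0.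
  case: ifP => [Kj|_]; last first.
    by rewrite mulr_ge0 ?divr_ge0 ?exprn_ge0 ?mulr_ge0 ?u0.
  apply: (le_trans (iter_sweep_norm _ _ _ _ h0)); rewrite -/(u m j) mulrCA.
  rewrite -[leLHS]mulr1 ler_wpM2l ?u0// mulrAC -mulrA.
  have Kj2 : (K%:R * n%:R) ^+ 2 <= `|j|%:R ^+ 2 :> R.
    by rewrite -natrM lerXn2r ?nnegrE// ler_nat ltnW.
  rewrite mulrA ler_pdivlMr ?exprn_gt0// mul1r.
  by have := q_low j; lra.
have n2 : 1 <= n%:R ^+ 2 :> R by rewrite exprn_ege1.
have fin : pairing (sites L) (u m) (fun j => q j + Cq) <= n%:R ^+ 3 * (A / 2).
  apply: (le_trans total); rewrite /A.
  set P := 3 / 2 * r%:R ^+ 2 + 2 * Cq + 2 * (T / alpha).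
  have P0 : 0 <= P by rewrite /P; have := sqr_ge0 (r%:R : R); lra.
  have h1 : 3 / 2 * (r%:R * n%:R) ^+ 2 + 2 * Cq + 2 * (n%:R ^+ 2 * (T / alpha)) <=
      n%:R ^+ 2 * P by rewrite /P; nra.
  have h2 := ler_wpM2l m10 h1.
  have h3 := ler_wpM2r (mulr_ge0 (sqr_ge0 (n%:R : R)) P0) m1_ub.
  have h4 : 1 <= n%:R ^+ 3 :> R by rewrite exprn_ege1.
  lra.
apply: (@le_trans _ _ (n%:R^-1 * (2 / (K%:R * n%:R) ^+ 2 * (n%:R ^+ 3 * (A / 2))))).
  rewrite ler_wpM2l ?invr_ge0// ler_wpM2l// divr_ge0// exprn_ge0// ltW//.
rewrite le_eqVlt; apply/orP; left; apply/eqP; field.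
by rewrite !gt_eqF ?ltr0n.
Qed.

End tightness.

(** * Gaussian solutions of the heat equation *)

Section gaussian.
Context {R : realType}.
Variable (alpha : R).
Hypothesis alpha_gt0 : 0 < alpha.
Implicit Types (th z s : R) (r : nat).

(** [hermite r th z] is the factor that multiplies [expR (- th * z ^+ 2 / 2)] in
    its [r]-th derivative. *)
Definition hermite r th z : R :=
  match r with
  | 0%N => 1
  | 1%N => - (th * z)
  | 2 => th ^+ 2 * z ^+ 2 - th
  | 3 => 3 * th ^+ 2 * z - th ^+ 3 * z ^+ 3
  | _ => th ^+ 4 * z ^+ 4 - 6 * th ^+ 3 * z ^+ 2 + 3 * th ^+ 2
  end.

(** The prefactor [1 / sqrt s] of the Gaussian density is kept inside the
    exponential, so that a single rule differentiates it with respect to [s]. *)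
Definition gauss_exponent s z : R :=
  - (2^-1 * ln s) - alpha / 4 * (s^-1 * z ^+ 2).

Definition gauss_peak : R := (Num.sqrt (4 * pi / alpha))^-1.

Definition gauss_deriv r s z : R :=
  gauss_peak * (hermite r (alpha / 2 * s^-1) z * expR (gauss_exponent s z)).

Lemma expR_half_ln s : 0 < s -> expR (- (2^-1 * ln s)) = (Num.sqrt s)^-1.
Proof.
move=> s0; rewrite expRN; congr (_^-1).
by rewrite -powR12_sqrt ?ltW// /powR gt_eqF.
Qed.

Lemma heat_kernelE s z : 0 < s -> heat_kernel alpha s z = gauss_deriv 0 s z.
Proof.
move=> s0; have sA : 0 < 2 * s / alpha by rewrite divr_gt0// mulr_gt0.
rewrite /heat_kernel normal_pdfE ?gt_eqF ?sqrtr_gt0//.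
rewrite /gauss_deriv /hermite mul1r /gauss_exponent expRD expR_half_ln// mulrA.
rewrite /normal_peak /normal_fun sqr_sqrtr ?ltW// subr0; congr (_ * expR _).
  rewrite /gauss_peak -invfM -sqrtrM ?divr_ge0 ?mulr_ge0 ?pi_ge0 ?ltW//.
  by congr ((Num.sqrt _)^-1); rewrite -mulr_natr; ring.
by rewrite -mulr_natr; field; rewrite !gt_eqF.
Qed.

Lemma gauss_deriv_dx r s z : (r < 4)%N -> 0 < s ->
  is_derive z 1 (gauss_deriv r s) (gauss_deriv r.+1 s z).
Proof.
move=> r4 s0; rewrite /gauss_deriv /gauss_exponent.
case: r r4 => [|[|[|[|//]]]] _ /=; apply: is_derive_eq => /=;
  set E := expR _; rewrite /GRing.scale /=; by field; rewrite gt_eqF.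
Qed.

Lemma gauss_deriv_ds r s z : (r <= 2)%N -> 0 < s ->
  is_derive s 1 (gauss_deriv r ^~ z) (gauss_deriv r.+2 s z / alpha).
Proof.
move=> r2 s0; have sn0 : s != 0 by rewrite gt_eqF.
have dV : is_derive s 1 (fun s : R => s^-1) (- s ^- 2).
  have := @is_deriveV R id s 1 1 sn0 (is_derive_id s 1).
  by rewrite /GRing.scale /= mulr1.
have dl := is_derive1_ln s0.
rewrite /gauss_deriv /gauss_exponent.
case: r r2 => [|[|[|//]]] _ /=; apply: is_derive_eq => /=;
  set E := expR _; rewrite /GRing.scale /=; by field; rewrite !gt_eqF.
Qed.

Lemma hermite_bound r th z (Th : R) : (r <= 4)%N -> 0 <= th -> th <= Th -> 1 <= Th ->
  `|hermite r th z| <= 10 * (Th ^+ 4 * (1 + `|z|) ^+ 4).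
Proof.
move=> r4 th0 thT T1; set X := 1 + `|z|.
have X1 : 1 <= X by rewrite lerDl.
have mono a b : (a <= 4)%N -> (b <= 4)%N -> `|th ^+ a * z ^+ b| <= Th ^+ 4 * X ^+ 4.
  move=> a4 b4; rewrite normrM !normrX (ger0_norm th0).
  apply: ler_pM; rewrite ?exprn_ge0//.
    apply: (@le_trans _ _ (Th ^+ a)); first by rewrite lerXn2r ?nnegrE//; lra.
    by rewrite ler_weXn2l.
  apply: (@le_trans _ _ (X ^+ b)); last by rewrite ler_weXn2l.
  by rewrite lerXn2r ?nnegrE ?addr_ge0// lerDr.
have W0 : 0 <= Th ^+ 4 * X ^+ 4 by rewrite mulr_ge0 ?exprn_ge0//; lra.
case: r r4 => [|[|[|[|[|//]]]]] _ /=.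
- by have := mono 0%N 0%N isT isT; rewrite !expr0 mul1r; lra.
- by have := mono 1%N 1%N isT isT; rewrite !expr1 normrN; lra.
- apply: (le_trans (ler_normB _ _)).
  by have := mono 2 2 isT isT; have := mono 1%N 0%N isT isT; rewrite !expr1 expr0 mulr1; lra.
- apply: (le_trans (ler_normB _ _)); rewrite -mulrA normrM normr_nat.
  by have := mono 2 1%N isT isT; have := mono 3 3 isT isT; rewrite !expr1; lra.
- apply: (le_trans (ler_normD _ _)); rewrite [X in _ + X]normrM normr_nat.
  apply: (le_trans (lerD (ler_normB _ _) (lexx _))); rewrite -mulrA [X in _ + X + _]normrM normr_nat.
  have := mono 4 4 isT isT; have := mono 3 2 isT isT; have := mono 2 0%N isT isT.
  by rewrite expr0 mulr1; lra.
Qed.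

(** [(1 + |z|) ^ 2] is at most [2 * (1 + z ^ 2)], which is bounded by a multiple of
    [expR (la * z ^ 2)]; then take fourth powers. The exponent [7] is the degree of
    the largest Hermite polynomial plus the exponent of the weight. *)
Lemma weighted_gauss_bound (la z : R) : 0 < la ->
  (1 + `|z|) ^+ 7 * expR (- (4 * la * z ^+ 2)) <= 16 * (1 + la^-1) ^+ 4.
Proof.
move=> la0; have z2 : z ^+ 2 = `|z| ^+ 2 by rewrite real_normK// num_real.
set X := 1 + `|z|; have X1 : 1 <= X by rewrite lerDl.
have X2 : X ^+ 2 <= 2 * (1 + z ^+ 2) by rewrite z2 /X; have := sqr_ge0 (`|z| - 1); lra.
have il : 0 < la^-1 by rewrite invr_gt0.
have h1 : 1 + z ^+ 2 <= (1 + la^-1) * expR (la * z ^+ 2).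
  apply: (@le_trans _ _ ((1 + la^-1) * (1 + la * z ^+ 2))); last first.
    by rewrite ler_wpM2l ?expR_ge1Dx//; lra.
  have -> : (1 + la^-1) * (1 + la * z ^+ 2) = 1 + z ^+ 2 + la * z ^+ 2 + la^-1.
    by field; rewrite gt_eqF.
  have := mulr_ge0 (ltW la0) (sqr_ge0 z); lra.
have h2 : (1 + z ^+ 2) ^+ 4 <= (1 + la^-1) ^+ 4 * expR (4 * la * z ^+ 2).
  have -> : 4 * la * z ^+ 2 = 4%:R * (la * z ^+ 2) by ring.
  rewrite expRM_natl -exprMn lerXn2r ?nnegrE ?mulr_ge0 ?expR_ge0 ?addr_ge0 ?sqr_ge0//.
  exact: ltW.
have h3 : X ^+ 7 <= 16 * (1 + z ^+ 2) ^+ 4.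
  apply: (@le_trans _ _ (X ^+ 8)); first by rewrite ler_weXn2l.
  have -> : X ^+ 8 = (X ^+ 2) ^+ 4 by rewrite -exprM.
  have -> : 16 * (1 + z ^+ 2) ^+ 4 = (2 * (1 + z ^+ 2)) ^+ 4.
    by rewrite exprMn -natrX.
  by rewrite lerXn2r ?nnegrE ?sqr_ge0// mulr_ge0// addr_ge0 ?sqr_ge0.
rewrite expRN ler_pdivrMr ?expR_gt0// -[leRHS]mulrA.
by apply: (le_trans h3); rewrite ler_wpM2l.
Qed.

Lemma gauss_deriv_decay s0 s1 : 0 < s0 -> exists2 C : R, 0 <= C &
  forall r s z, (r <= 4)%N -> s0 <= s <= s1 -> `|gauss_deriv r s z| <= C * decay z.
Proof.
move=> s00; have [s10|s10] := leP s1 0.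
  by exists 0 => // r s z _ /andP[h1 h2]; exfalso; lra.
pose Th := 1 + alpha / 2 * s0^-1.
pose la := alpha / 16 * s1^-1.
have la0 : 0 < la by rewrite mulr_gt0 ?invr_gt0// divr_gt0.
have T1 : 1 <= Th by rewrite lerDl mulr_ge0 ?invr_ge0 ?divr_ge0 ?ltW.
have Th0 : 0 <= Th by lra.
have il0 : 0 <= 1 + la^-1 by rewrite addr_ge0// invr_ge0 ltW.
have sq0 : 0 < Num.sqrt s0 by rewrite sqrtr_gt0.
have pk0 : 0 <= gauss_peak by rewrite invr_ge0 sqrtr_ge0.
exists (gauss_peak * (10 * Th ^+ 4 * (Num.sqrt s0)^-1 * (16 * (1 + la^-1) ^+ 4))).
  by do !apply: mulr_ge0 => //; rewrite ?exprn_ge0 ?invr_ge0 ?sqrtr_ge0.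
move=> r s z r4 /andP[s0s ss1].
have sp : 0 < s by lra.
have th0 : 0 <= alpha / 2 * s^-1 by rewrite mulr_ge0 ?divr_ge0 ?invr_ge0 ?ltW.
have thT : alpha / 2 * s^-1 <= Th.
  apply: (@le_trans _ _ (alpha / 2 * s0^-1)); last by rewrite lerDr.
  by rewrite ler_pM2l ?divr_gt0// lef_pV2.
have hH := hermite_bound z r4 th0 thT T1.
have hE : expR (gauss_exponent s z) <= (Num.sqrt s0)^-1 * expR (- (4 * la * z ^+ 2)).
  rewrite /gauss_exponent expRD expR_half_ln//; apply: ler_pM; rewrite ?expR_ge0 ?invr_ge0 ?sqrtr_ge0//.
    by rewrite lef_pV2 ?posrE ?sqrtr_gt0// ler_wsqrtr.
  rewrite ler_expR lerN2 /la.
  have -> : 4 * (alpha / 16 / s1) * z ^+ 2 = alpha / 4 * (s1^-1 * z ^+ 2).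
    by field; rewrite gt_eqF.
  by rewrite ler_pM2l ?divr_gt0// ler_wpM2r ?sqr_ge0// lef_pV2.
have hW := weighted_gauss_bound z la0.
rewrite /gauss_deriv normrM (ger0_norm pk0) -[leRHS]mulrA ler_wpM2l//.
rewrite normrM (ger0_norm (expR_ge0 _)).
apply: (le_trans (ler_pM _ _ hH hE)); rewrite ?expR_ge0//.
set X := 1 + `|z| in hW *; have X0 : 0 < X by rewrite ltr_wpDr.
rewrite /decay -/X.
set Y := expR _ in hW *.
have -> : 10 * (Th ^+ 4 * X ^+ 4) * ((Num.sqrt s0)^-1 * Y) =
  10 * Th ^+ 4 / Num.sqrt s0 * (X ^+ 7 * Y) * X^-1 ^+ 3.
  by field; rewrite !gt_eqF.
rewrite ler_wpM2r ?exprn_ge0 ?invr_ge0 ?(ltW X0)// ler_wpM2l//.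
by do !apply: mulr_ge0 => //; rewrite ?exprn_ge0 ?invr_ge0 ?sqrtr_ge0.
Qed.

End gaussian.

Section gaussian_mixture.
Context {R : realType}.
Variable (alpha : R).
Hypothesis alpha_gt0 : 0 < alpha.

(** Heat released at time [- eps] by sources at the points [i.2] with weights
    [i.1]: it is a smooth solution up to the initial time included. *)
Definition mixture (eps : R) (l : seq (R * R)) r (s x : R) : R :=
  \sum_(i <- l) i.1 * gauss_deriv alpha r (s + eps) (x - i.2).

Lemma mixture_caloric (T eps : R) l : 0 < eps ->
  exists B, caloric alpha T (mixture eps l) B.
Proof.
move=> e0; have [C C0 HC] := gauss_deriv_decay alpha_gt0 (T + eps) e0.
have cons i l' r s x : mixture eps (i :: l') r s x =
    i.1 * gauss_deriv alpha r (s + eps) (x - i.2) + mixture eps l' r s x.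
  by rewrite /mixture big_cons.
elim: l => [|i l [B [dx ds bd]]].
  exists 0; rewrite /mixture; split=> r s x.
  - by under eq_fun do rewrite big_nil; rewrite big_nil => *; exact: is_derive_cst.
  - by under eq_fun do rewrite big_nil; rewrite big_nil mul0r => *; exact: is_derive_cst.
  - by rewrite big_nil normr0 mul0r.
exists (`|i.1| * (C * (1 + `|i.2|) ^+ 3) + B); split=> r s x r4 sT.
- have -> : mixture eps (i :: l) r s = fun x => i.1 *
      gauss_deriv alpha r (s + eps) (x - i.2) + mixture eps l r s x.
    by apply/funext => y; exact: cons.
  rewrite cons.
  have se : 0 < s + eps by lra.
  have d1 := gauss_deriv_dx alpha (x - i.2) r4 se.
  have d2 := dx r s x r4 sT.
  have sh : is_derive x 1 (fun x : R => x - i.2) 1.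
    by apply: is_derive_eq; rewrite subr0.
  have := @is_derive1_comp R _ (fun x => x - i.2) x _ _ d1 sh; rewrite mulr1 => d3.
  by apply: is_deriveD; apply: is_deriveZ.
- have -> : (fun s => mixture eps (i :: l) r s x) = fun s => i.1 *
      gauss_deriv alpha r (s + eps) (x - i.2) + mixture eps l r s x.
    by apply/funext => y; exact: cons.
  rewrite cons mulrDl.
  have se : 0 < s + eps by lra.
  have d1 := gauss_deriv_ds alpha_gt0 (x - i.2) r4 se.
  have d2 := ds r s x r4 sT.
  have sh : is_derive s 1 (fun s : R => s + eps) 1.
    by apply: is_derive_eq; rewrite addr0.
  have := @is_derive1_comp R (gauss_deriv alpha r ^~ (x - i.2)) (fun s => s + eps) s _ _ d1 sh.
  rewrite mulr1 => d3; rewrite -[i.1 * _ / _]mulrA.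
  by apply: is_deriveD; apply: is_deriveZ.
- rewrite cons mulrDl; apply: (le_trans (ler_normD _ _)); apply: lerD; last exact: bd.
  rewrite normrM -[leRHS]mulrA ler_wpM2l// -[leRHS]mulrA.
  have se : eps <= s + eps <= T + eps by lra.
  apply: (le_trans (HC r (s + eps) (x - i.2) r4 se)); rewrite ler_wpM2l//.
  by have := decay_shift x (- i.2); rewrite normrN.
Qed.

End gaussian_mixture.

(** * Functions with compact support and their Riemann sums *)

Section compact_support.
Context {R : realType}.
Implicit Types (phi : R -> R) (x y : R).

Definition supported_in (r : R) phi := forall x, r <= `|x| -> phi x = 0.

Lemma Cc_supported phi : Cc phi -> exists2 r : nat, (0 < r)%N & supported_in r%:R phi.
Proof.
move=> [_ /compact_bounded/pinfty_ex_gt0[M M0 HM]].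
exists (Num.truncn `|M|).+1 => // x rx; apply/eqP/negPn/negP => fx.
have /HM : closure [set x | phi x != 0] x by exact: subset_closure.
apply/negP; rewrite -ltNge; apply: lt_le_trans rx.
by apply: (le_lt_trans (ler_norm M)); exact: truncnS_gt.
Qed.

Lemma continuous_seg_bound phi (a b : R) : continuous phi ->
  exists2 M, 0 <= M & forall x, a <= x <= b -> `|phi x| <= M.
Proof.
move=> cphi.
have /compact_bounded/pinfty_ex_gt0[M M0 HM] : compact (phi @` `[a, b]).
  apply: continuous_compact; last exact: segment_compact.
  by apply: continuous_subspaceT.
exists `|M| => // x xab; apply: le_trans (ler_norm M); apply: HM.
by exists x => //=; rewrite in_itv.
Qed.

Lemma supported_bounded phi r : continuous phi -> supported_in r phi ->
  exists2 M, 0 <= M & forall x, `|phi x| <= M.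
Proof.
move=> cphi sphi; have [M M0 HM] := continuous_seg_bound (- r) r cphi.
exists M => // x; have [rx|xr] := leP r `|x|; first by rewrite sphi// normr0.
by apply: HM; move: xr; rewrite ltr_norml => /andP[/ltW -> /ltW ->].
Qed.

Lemma supported_unif_continuous phi r : continuous phi -> supported_in r phi ->
  forall e, 0 < e -> exists2 d, 0 < d &
    forall x y, `|x - y| <= d -> `|phi x - phi y| <= e.
Proof.
move=> cphi sphi e e0.
have := @segment_compact R (- r - 1) (r + 1).
move=> /compact_near_coveringP /(_ R (0^'+)
  (fun d x => forall y, `|x - y| < d -> `|phi x - phi y| <= e) _) H.
have {H}: \forall d \near 0^'+, `[(- r - 1), r + 1] `<=`
    (fun x => forall y, `|x - y| < d -> `|phi x - phi y| <= e).
  apply: H => x _.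
  have /cvgrPdist_lt/(_ _ (divr_gt0 e0 (ltr0n R 2))) := cphi x.
  move=> /nbhs_ballP[d0 /= d00 Hd].
  exists (ball x (d0 / 2), [set d | d < d0 / 2]) => /=.
    split; first by apply: nbhsx_ballx; rewrite divr_gt0.
    by apply: nbhs_right_lt; rewrite divr_gt0.
  move=> [x' d] /= [xx' dd] y x'y.
  have h1 : `|phi x - phi x'| < e / 2.
    by apply: Hd; rewrite /ball /= in xx' *; lra.
  have h2 : `|phi x - phi y| < e / 2.
    apply: Hd; rewrite /ball /= in xx' *.
    rewrite -(subrK x' x) -addrA; apply: (le_lt_trans (ler_normD _ _)); lra.
  rewrite -(subrK (phi x) (phi x')) -addrA; apply: (le_trans (ler_normD _ _)).
  by rewrite distrC; lra.
move=> [d1 /= d10 Hd1].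
pose d := Num.min (d1 / 2) 2^-1.
have d0 : 0 < d by rewrite lt_min divr_gt0// invr_gt0 ltr0n.
have dd1 : d < d1 by rewrite /d gt_min; apply/orP; left; lra.
have d2 : d <= 2^-1 by rewrite /d ge_min lexx orbT.
exists (d / 2) => [|x y xy]; first by rewrite divr_gt0.
have [xin|xout] := leP `|x| (r + 1).
  have Hd : ball 0 d1 d by rewrite /ball /= sub0r normrN gtr0_norm.
  apply: (Hd1 d Hd d0 x _ y); last lra.
  by move: xin; rewrite /= in_itv /= ler_norml opprD.
have [yx] : r <= `|y| /\ r <= `|x|.
  have := ler_normD (x - y) y; rewrite subrK; lra.
by move=> xr; rewrite !sphi// subrr normr0 ltW.
Qed.

End compact_support.

Section bounded_integrals.
Context {R : realType}.
Local Notation leb := (@lebesgue_measure R).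
Implicit Types (g : R -> R) (a b M : R).

Lemma bounded_integrable_itv g M a b : measurable_fun setT g ->
  (forall x, `|g x| <= M) -> leb.-integrable `[a, b[ (EFin \o g).
Proof.
move=> mg gM; apply: measurable_bounded_integrable => //.
- by rewrite /= lebesgue_measure_itv /=; case: ifP => _; rewrite ?ltry.
- exact: measurable_funTS.
- exists M; split=> [|x Mx y _ /=]; first exact: num_real.
  by apply: (le_trans (gM y)); exact: ltW.
Qed.

Lemma fine_leb_itv a b : a <= b -> fine (leb `[a, b[) = b - a.
Proof.
rewrite lebesgue_measure_itv /= lte_fin.
by case: ltgtP => //= -> _; rewrite subrr.
Qed.

Lemma Rintegral_cell g M a b w : a <= b -> measurable_fun setT g ->
  (forall x, `|g x| <= M) -> (forall x, a <= x -> x <= b -> `|g x - g a| <= w) ->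
  `|\int[leb]_(x in `[a, b[) g x - g a * (b - a)| <= w * (b - a).
Proof.
move=> ab mg gM gw.
have i1 := bounded_integrable_itv a b mg gM.
have icst k : leb.-integrable `[a, b[ (EFin \o cst k).
  exact: (@bounded_integrable_itv (cst k) `|k|).
rewrite -(fine_leb_itv ab) -!Rintegral_cst// -RintegralB//; last exact: icst.
have i2 : leb.-integrable `[a, b[ (EFin \o (fun x => g x - g a)).
  apply: (@bounded_integrable_itv _ (M + M)).
    by apply: measurable_funB.
  by move=> x; apply: (le_trans (ler_normB _ _)); rewrite lerD.
apply: (le_trans (le_normr_Rintegral _ i2)) => //.
apply: le_Rintegral => //; [exact: (@integrable_norm _ _ _ _ _ _ i2)|exact: icst|].
by move=> x /=; rewrite in_itv /= => /andP[ax xb]; apply: gw => //; exact: ltW.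
Qed.

Lemma Rintegral_supported g r : supported_in r g ->
  \int[leb]_x g x = \int[leb]_(x in `[- r, r[) g x.
Proof.
move=> sg; rewrite [RHS]Rintegral_mkcond; congr Rintegral; apply/funext => x.
rewrite patchE; case: ifPn => // /negP xr; apply: sg.
rewrite leNgt; apply/negP; rewrite ltr_norml => /andP[x1 x2]; apply: xr.
by rewrite inE /= in_itv /= x2 ltW.
Qed.

Lemma Rintegral_supported_bound g M r : 0 <= r -> measurable_fun setT g ->
  (forall x, `|g x| <= M) -> supported_in r g ->
  `|\int[leb]_x g x| <= 2 * r * M.
Proof.
move=> r0 mg gM sg; rewrite (Rintegral_supported sg).
have rr : - r <= r by lra.
have i1 := bounded_integrable_itv (- r) r mg gM.
apply: (le_trans (le_normr_Rintegral _ i1)) => //.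
apply: (@le_trans _ _ (\int[leb]_(x in `[- r, r[) M)).
  apply: le_Rintegral => //; first exact: (@integrable_norm _ _ _ _ _ _ i1).
  exact: (@bounded_integrable_itv (cst M) `|M|).
by rewrite Rintegral_cst// fine_leb_itv//; lra.
Qed.

Lemma riemann_sum g M a (D w : R) N : 0 <= D -> measurable_fun setT g ->
  (forall x, `|g x| <= M) ->
  (forall x y, x <= y -> y <= x + D -> `|g y - g x| <= w) ->
  `|\int[leb]_(x in `[a, a + N%:R * D[) g x -
    \sum_(0 <= i < N) g (a + i%:R * D) * D| <= N%:R * D * w.
Proof.
move=> D0 mg gM gw; elim: N => [|N IH].
  by rewrite !mul0r addr0 set_itvco0 Rintegral_set0 big_nil subrr normr0.
have cut : `[a, a + N.+1%:R * D[%classic =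
    `[a, a + N%:R * D[%classic `|` `[a + N%:R * D, a + N.+1%:R * D[%classic.
  have ND0 : 0 <= N%:R * D by rewrite mulr_ge0.
  have E : N.+1%:R * D = N%:R * D + D by rewrite -natr1 mulrDl mul1r.
  rewrite E; apply/seteqP; split=> x /=; rewrite !in_itv /=.
    by move=> /andP[ax xb]; case: (ltP x (a + N%:R * D)) => h; [left; rewrite ax|right].
  by case=> /andP[h1 h2]; apply/andP; split; lra.
rewrite cut Rintegral_setU//; last first.
- apply/disj_set2P/seteqP; split=> x //= -[]; rewrite !in_itv /= => /andP[_ h1] /andP[h2 _].
  by move: (lt_le_trans h1 h2); rewrite ltxx.
- by rewrite -cut; exact: bounded_integrable_itv mg gM.
rewrite big_nat_recr//=.
have ED : a + N.+1%:R * D - (a + N%:R * D) = D by rewrite -natr1; ring.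
have ab : a + N%:R * D <= a + N.+1%:R * D by rewrite -subr_ge0 ED.
have C := @Rintegral_cell g M _ _ w ab mg gM.
rewrite ED in C.
have {}C : `|\int[leb]_(x in `[a + N%:R * D, a + N.+1%:R * D[) g x -
     g (a + N%:R * D) * D| <= w * D.
  by apply: C => x h1 h2; apply: gw => //; lra.
have -> : forall x y z t : R, x + y - (z + t) = (x - z) + (y - t) by move=> *; ring.
apply: (le_trans (ler_normD _ _)); apply: (le_trans (lerD IH C)).
by rewrite -[N.+1%:R]natr1; lra.
Qed.

End bounded_integrals.

(** * Estimates on the heat kernel *)

Section heat_kernel_bounds.
Context {R : realType}.
Variable alpha : R.
Hypothesis alpha_gt0 : 0 < alpha.
Local Notation leb := (@lebesgue_measure R).
Local Notation hk := (heat_kernel alpha).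
Implicit Types (s t x y z e : R).

Let sd_neq0 s : 0 < s -> Num.sqrt (2 * s / alpha) != 0.
Proof. by move=> s0; rewrite gt_eqF// sqrtr_gt0 divr_gt0// mulr_gt0. Qed.

Lemma heat_kernel_ge0 s z : 0 <= hk s z.
Proof. exact: normal_pdf_ge0. Qed.

Lemma heat_kernel_center s x y : 0 < s ->
  hk s (x - y) = normal_pdf x (Num.sqrt (2 * s / alpha)) y.
Proof.
move=> s0; rewrite /heat_kernel !normal_pdfE ?sd_neq0// /normal_fun.
have -> : (y - x) ^+ 2 = (x - y - 0) ^+ 2 by ring.
by [].
Qed.

Lemma heat_kernel_sym s z : 0 < s -> hk s (- z) = hk s z.
Proof.
by move=> s0; rewrite /heat_kernel !normal_pdfE ?sd_neq0// /normal_fun !subr0 sqrrN.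
Qed.

Lemma measurable_heat_kernel s x : 0 < s ->
  measurable_fun setT (fun y => hk s (x - y)).
Proof.
move=> s0; under eq_fun do rewrite heat_kernel_center//.
exact: measurable_normal_pdf.
Qed.

Lemma integral_heat_kernel s x : 0 < s -> \int[leb]_y hk s (x - y) = 1.
Proof.
move=> s0; under eq_Rintegral do rewrite heat_kernel_center//.
by rewrite /Rintegral integral_normal_pdf.
Qed.

Lemma integrable_heat_kernel s x : 0 < s ->
  leb.-integrable setT (EFin \o (fun y => hk s (x - y))).
Proof.
move=> s0; under eq_fun do rewrite heat_kernel_center//.
exact: integrable_normal_pdf.
Qed.

Lemma heat_kernel_lipschitz s : 0 < s -> exists2 C, 0 < C &
  (forall z, hk s z <= C) /\ forall z z', `|hk s z - hk s z'| <= C * `|z - z'|.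
Proof.
move=> s0; have [C C0 HC] := gauss_deriv_decay alpha_gt0 s s0.
exists (C + 1); first by rewrite ltr_wpDl.
have bd r z : (r <= 4)%N -> `|gauss_deriv alpha r s z| <= C + 1.
  move=> r4; apply: (le_trans (HC r s z r4 _)); first by rewrite !lexx.
  by have := ler_wpM2l C0 (decay_le1 z); lra.
split=> [z|]; first by rewrite heat_kernelE//; exact: le_trans (ler_norm _) (bd _ _ _).
have main z z' : z' <= z -> `|hk s z - hk s z'| <= (C + 1) * `|z - z'|.
  move=> zz; rewrite !heat_kernelE//.
  have [y _ ->] := mean_value zz (fun y _ => gauss_deriv_dx alpha y (isT : (0 < 4)%N) s0).
  by rewrite normrM ler_wpM2r// bd.
move=> z z'; have [|/ltW] := leP z' z; first exact: main.
by rewrite distrC (distrC z); exact: main.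
Qed.

Lemma heat_kernel_time t : 0 < t -> exists2 C, 0 <= C &
  forall e z, 0 <= e -> e <= 1 -> `|hk (t + e) z - hk t z| <= C * e.
Proof.
move=> t0; have [C C0 HC] := gauss_deriv_decay alpha_gt0 (t + 1) t0.
exists (C / alpha); first by rewrite divr_ge0// ltW.
move=> e z e0 e1; have te : t <= t + e by lra.
have te0 : 0 < t + e by lra.
rewrite !heat_kernelE//.
have dt (s : R) : t <= s <= t + e ->
    is_derive s 1 (gauss_deriv alpha 0 ^~ z) (gauss_deriv alpha 2 s z / alpha).
  by move=> h; apply: gauss_deriv_ds => //; lra.
have [s /andP[s1 s2] ->] := mean_value te dt.
have -> : t + e - t = e by ring.
have ia : 0 <= alpha^-1 by rewrite invr_ge0 ltW.
rewrite 2!normrM (ger0_norm e0) (ger0_norm ia) ler_wpM2r// ler_wpM2r//.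
have ss : t <= s <= t + 1 by lra.
apply: (le_trans (HC 2%N s z isT ss)); rewrite ler_piMr ?decay_le1//.
Qed.

(** Comparing the kernels at times [s] and [2 * s] leaves a Gaussian factor, which
    absorbs any power of [z]. *)
Let kernel_ratio s z : 0 < s ->
  hk s z = Num.sqrt 2 * (hk (2 * s) z * expR (- (alpha / (8 * s) * z ^+ 2))).
Proof.
move=> s0; have s20 : 0 < 2 * s by rewrite mulr_gt0.
rewrite !heat_kernelE// /gauss_deriv /hermite !mul1r /gauss_exponent !expRD.
rewrite !expR_half_ln// sqrtrM//.
have -> : expR (- (alpha / 4 * (s^-1 * z ^+ 2))) =
  expR (- (alpha / 4 * ((2 * s)^-1 * z ^+ 2))) * expR (- (alpha / (8 * s) * z ^+ 2)).
  by rewrite -expRD; congr expR; field; rewrite gt_eqF.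
by field; rewrite !gt_eqF ?sqrtr_gt0.
Qed.

(** In terms of [u = alpha / (8 * s) * z ^ 2], this is [u * expR (- u) <= 1]. Doubling
    the time replaces the computation of the variance of the kernel. *)
Lemma heat_kernel_variance s z : 0 < s ->
  z ^+ 2 * hk s z <= 16 / alpha * s * hk (2 * s) z.
Proof.
move=> s0; rewrite kernel_ratio//.
set u := alpha / (8 * s) * z ^+ 2; set K := hk (2 * s) z.
have K0 : 0 <= K by exact: heat_kernel_ge0.
have u0 : 0 <= u by rewrite mulr_ge0 ?sqr_ge0 ?divr_ge0 ?mulr_ge0 ?ltW.
have uE : u * expR (- u) <= 1.
  rewrite expRN ler_pdivrMr ?expR_gt0// mul1r.
  by have := expR_ge1Dx u; lra.
have q2 : Num.sqrt 2 <= 2 :> R.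
  by rewrite -(@ler_pXn2r _ 2) ?nnegrE ?sqrtr_ge0// sqr_sqrtr//; lra.
have -> : z ^+ 2 = 8 * s / alpha * u by rewrite /u; field; rewrite !gt_eqF.
have c0 : 0 <= 8 * s / alpha * K by rewrite mulr_ge0// divr_ge0 ?mulr_ge0 ?ltW.
have h1 := ler_wpM2l c0 uE.
have w0 : 0 <= 8 * s / alpha * K * (u * expR (- u)).
  by rewrite mulr_ge0// mulr_ge0// expR_ge0.
have := ler_wpM2r w0 q2; lra.
Qed.

(** The translation by [y] is absorbed by doubling the time:
    [(x - y) ^ 2 >= x ^ 2 / 2 - y ^ 2]. *)
Lemma heat_kernel_dominated t r : 0 < t -> exists2 C, 0 <= C &
  forall x y, `|y| <= r -> hk t (x - y) <= C * hk (2 * t) x.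
Proof.
move=> t0; exists (Num.sqrt 2 * expR (alpha / (4 * t) * r ^+ 2)).
  by rewrite mulr_ge0 ?sqrtr_ge0 ?expR_ge0.
move=> x y yr; have t20 : 0 < 2 * t by rewrite mulr_gt0.
rewrite !heat_kernelE// /gauss_deriv /hermite !mul1r /gauss_exponent !expRD.
rewrite !expR_half_ln// sqrtrM//.
have y2 : y ^+ 2 <= r ^+ 2.
  by rewrite -(real_normK (num_real y)) lerXn2r ?nnegrE//; apply: le_trans yr.
have h : expR (- (alpha / 4 * (t^-1 * (x - y) ^+ 2))) <=
   expR (alpha / (4 * t) * r ^+ 2) * expR (- (alpha / 4 * ((2 * t)^-1 * x ^+ 2))).
  rewrite -expRD ler_expR.
  have a0 : 0 < alpha / (4 * t) by rewrite divr_gt0// mulr_gt0.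
  have -> : alpha / 4 * (t^-1 * (x - y) ^+ 2) = alpha / (4 * t) * (x - y) ^+ 2.
    by field; rewrite gt_eqF.
  have -> : alpha / 4 * ((2 * t)^-1 * x ^+ 2) = alpha / (4 * t) * (x ^+ 2 / 2).
    by field; rewrite gt_eqF.
  rewrite -mulrN -mulrBr ler_pM2l//.
  by have := sqr_ge0 (x - 2 * y); lra.
have p0 : 0 <= gauss_peak alpha * (Num.sqrt t)^-1.
  by rewrite mulr_ge0 ?invr_ge0 ?sqrtr_ge0.
have := ler_wpM2l p0 h; rewrite mulrA => /le_trans; apply.
rewrite le_eqVlt; apply/orP; left; apply/eqP.
by field; rewrite !gt_eqF ?sqrtr_gt0.
Qed.

End heat_kernel_bounds.

(** * The heat flow of a test function *)

Section heat_flow.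
Context {R : realType}.
Variable alpha : R.
Hypothesis alpha_gt0 : 0 < alpha.
Local Notation leb := (@lebesgue_measure R).
Local Notation hk := (heat_kernel alpha).
Variables (phi : R -> R) (M : R) (r : nat).
Hypotheses (phi_cont : continuous phi) (phi_supp : supported_in r%:R phi).
Hypotheses (phi_bound : forall x, `|phi x| <= M).
Implicit Types (s t x y z e : R).

Let M_ge0 : 0 <= M. Proof. exact: le_trans (normr_ge0 _) (phi_bound 0). Qed.

Let phi_meas : measurable_fun setT phi.
Proof. exact: continuous_measurable_fun. Qed.

Let integrable_scale (k : R) (f : R -> R) : leb.-integrable setT (EFin \o f) ->
  leb.-integrable setT (EFin \o (fun y => k * f y)).
Proof. by move=> h; exact: (integrableZl measurableT k h). Qed.

Let integrand_meas s x : 0 < s -> measurable_fun setT (fun y => hk s (x - y) * phi y).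
Proof. by move=> s0; apply: measurable_funM => //; exact: measurable_heat_kernel. Qed.

Let integrand_supp s x : supported_in r%:R (fun y => hk s (x - y) * phi y).
Proof. by move=> y ry; rewrite phi_supp// mulr0. Qed.

Let integrand_integrable s x : 0 < s ->
  leb.-integrable setT (EFin \o (fun y => hk s (x - y) * phi y)).
Proof.
move=> s0; apply: (@le_integrable _ _ _ leb setT measurableT _
  (EFin \o (fun y => M * hk s (x - y)))).
- by apply/measurable_EFinP; exact: integrand_meas.
- move=> y _ /=; rewrite lee_fin normrM ger0_norm ?heat_kernel_ge0//.
  rewrite [leRHS]ger0_norm ?mulr_ge0 ?heat_kernel_ge0//.
  by rewrite mulrC ler_wpM2r ?heat_kernel_ge0.
- exact/integrable_scale/integrable_heat_kernel.
Qed.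

Let cont_integral_bound (g : R -> R) C : measurable_fun setT g -> 0 <= C ->
  (forall y, `|g y| <= C) -> supported_in r%:R g -> `|\int[leb]_y g y| <= 2 * r%:R * C.
Proof. by move=> mg C0 gC sg; apply: Rintegral_supported_bound. Qed.

Lemma heat_solution_riemann s e : 0 < s -> 0 < e -> (0 < r)%N ->
  exists2 N0, (0 < N0)%N & forall N, (N0 <= N)%N ->
  forall x, `|heat_solution alpha phi x s -
    \sum_(0 <= i < N) phi (- r%:R + i%:R * (2 * r%:R / N%:R)) * (2 * r%:R / N%:R)
      * hk s (x - (- r%:R + i%:R * (2 * r%:R / N%:R)))| <= e.
Proof.
move=> s0 e0 r0; have rR : 0 < r%:R :> R by rewrite ltr0n.
have [C C0 [CK CL]] := heat_kernel_lipschitz alpha_gt0 s0.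
set w := e / (2 * r%:R).
have w0 : 0 < w by rewrite divr_gt0// mulr_gt0.
have [d d0 Hd] := supported_unif_continuous phi_cont phi_supp (divr_gt0 (divr_gt0 w0 (ltr0n R 2)) C0).
have [N1 N10 HN1] := div_nat_small (2 * r%:R) d0.
have [N2 N20 HN2] := div_nat_small (M * C * (2 * r%:R)) (divr_gt0 w0 (ltr0n R 2)).
exists (maxn N1 N2); first by rewrite leq_max N10.
move=> N; rewrite geq_max => /andP[NN1 NN2] x.
have Nn0 : (0 < N)%N by apply: leq_trans NN1.
have NR : 0 < N%:R :> R by rewrite ltr0n.
set D := 2 * r%:R / N%:R; have D0 : 0 <= D by rewrite divr_ge0// mulr_ge0.
have ND : N%:R * D = 2 * r%:R by rewrite /D mulrC divfK// gt_eqF.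
have Dd : D <= d by exact: HN1.
have MCD : M * C * D <= w / 2 by rewrite /D mulrA; exact: HN2.
have gB y : `|hk s (x - y) * phi y| <= C * M.
  by rewrite normrM ler_pM// ger0_norm ?heat_kernel_ge0.
have gW y y' : y <= y' -> y' <= y + D ->
    `|hk s (x - y') * phi y' - hk s (x - y) * phi y| <= w.
  move=> yy' y'D.
  have -> : hk s (x - y') * phi y' - hk s (x - y) * phi y =
     hk s (x - y') * (phi y' - phi y) + (hk s (x - y') - hk s (x - y)) * phi y by ring.
  apply: (le_trans (ler_normD _ _)); rewrite !normrM.
  have yD : `|y' - y| <= D by rewrite ger0_norm ?subr_ge0//; lra.
  have h1 : `|phi y' - phi y| <= w / 2 / C by apply: Hd; exact: le_trans Dd.
  have h2 : `|hk s (x - y')| <= C by rewrite ger0_norm ?heat_kernel_ge0.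
  have h3 : `|hk s (x - y') - hk s (x - y)| <= C * D.
    apply: (le_trans (CL _ _)); rewrite ler_wpM2l ?(ltW C0)//.
    by rewrite distrC; have -> : x - y - (x - y') = y' - y by ring.
  have := ler_pM (normr_ge0 _) (normr_ge0 _) h2 h1.
  have := ler_pM (normr_ge0 _) (normr_ge0 _) h3 (phi_bound y).
  have -> : C * (w / 2 / C) = w / 2 by field; rewrite gt_eqF.
  lra.
have := @riemann_sum R _ (C * M) (- r%:R) D w N D0 (integrand_meas x s0) gB gW.
rewrite ND; have -> : - r%:R + 2 * r%:R = r%:R :> R by ring.
rewrite -(Rintegral_supported (integrand_supp _ _)) -/(heat_solution alpha phi x s).
move=> h; apply: le_trans (_ : 2 * r%:R * w <= e); last first.
  by rewrite /w mulrC divfK// gt_eqF// mulr_gt0.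
apply: le_trans h; rewrite le_eqVlt; apply/orP; left; apply/eqP; congr `|_ - _|.
by apply: eq_bigr => i _; ring.
Qed.

(** [phi] varies by at most [e / 2] at distances below [d], and by at most
    [2 * M * (x - y) ^ 2 / d ^ 2] beyond; the second moment of the kernel at time [s]
    is of order [s]. *)
Lemma heat_solution_initial e : 0 < e -> exists2 s0, 0 < s0 &
  forall s, 0 < s -> s <= s0 -> forall x, `|phi x - heat_solution alpha phi x s| <= e.
Proof.
move=> e0; have e20 : 0 < e / 2 by rewrite divr_gt0.
have [d d0 Hd] := supported_unif_continuous phi_cont phi_supp e20.
pose K := 2 * M / d ^+ 2 * (16 / alpha).
have d2 : 0 < d ^+ 2 by rewrite exprn_gt0.
have K0 : 0 <= K by rewrite !mulr_ge0 ?invr_ge0 ?(ltW alpha_gt0) ?(ltW d2).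
exists (e / 2 / (K + 1)); first by rewrite divr_gt0// ltr_wpDl.
move=> s s0 sK x.
have Ks : K * s <= e / 2.
  have : (K + 1) * s <= e / 2 by rewrite mulrC -ler_pdivlMr// ltr_wpDl.
  by rewrite mulrDl mul1r; lra.
have s20 : 0 < 2 * s by rewrite mulr_gt0.
have i1 := integrable_heat_kernel alpha_gt0 x s0.
have i3 := integrable_heat_kernel alpha_gt0 x s20.
have i2 := integrand_integrable x s0.
have iphi : leb.-integrable setT (EFin \o (fun y => phi x * hk s (x - y))).
  exact: integrable_scale.
have -> : phi x = \int[leb]_y (phi x * hk s (x - y)).
  by rewrite RintegralZl// integral_heat_kernel// mulr1.
rewrite /heat_solution -RintegralB//.
have i4 : leb.-integrable setT
    (EFin \o (fun y => phi x * hk s (x - y) - hk s (x - y) * phi y)).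
  by have := integrableB measurableT iphi i2.
apply: (le_trans (le_normr_Rintegral _ i4)) => //.
pose G y := e / 2 * hk s (x - y) + K * s * hk (2 * s) (x - y).
have j1 : leb.-integrable setT (EFin \o (fun y => e / 2 * hk s (x - y))).
  exact: integrable_scale.
have j2 : leb.-integrable setT (EFin \o (fun y => K * s * hk (2 * s) (x - y))).
  exact: integrable_scale.
apply: (@le_trans _ _ (\int[leb]_y G y)).
  apply: le_Rintegral => //; first exact: (@integrable_norm _ _ _ _ _ _ i4).
    by have := integrableD measurableT j1 j2.
  move=> y _; rewrite [_ * phi y]mulrC -mulrBl normrM (ger0_norm (heat_kernel_ge0 _ _ _)).
  have k0 := heat_kernel_ge0 alpha s (x - y).
  have k20 := heat_kernel_ge0 alpha (2 * s) (x - y).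
  have q : 0 <= 2 * M / d ^+ 2 by rewrite divr_ge0 ?(ltW d2)// mulr_ge0.
  have h0 : `|phi x - phi y| <= e / 2 + 2 * M / d ^+ 2 * (x - y) ^+ 2.
    have [xy|xy] := leP `|x - y| d.
      by apply: (le_trans (Hd _ _ xy)); rewrite lerDl mulr_ge0// sqr_ge0.
    apply: (@le_trans _ _ (2 * M)).
      by apply: (le_trans (ler_normB _ _)); have := phi_bound x; have := phi_bound y; lra.
    have : d ^+ 2 <= (x - y) ^+ 2.
      by rewrite -(real_normK (num_real (x - y))) lerXn2r ?nnegrE ?(ltW d0) ?(ltW xy).
    move=> h; have := ler_wpM2l q h; rewrite divfK ?gt_eqF//; lra.
  have h1 := ler_wpM2r k0 h0.
  have h2 := ler_wpM2l q (heat_kernel_variance alpha_gt0 (x - y) s0).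
  rewrite /G /K; lra.
rewrite /G RintegralD// !RintegralZl// !integral_heat_kernel// !mulr1.
lra.
Qed.

Lemma heat_solution_time t e : 0 < t -> 0 < e -> exists2 s0, 0 < s0 &
  forall s, 0 < s -> s <= s0 -> forall x,
    `|heat_solution alpha phi x (t + s) - heat_solution alpha phi x t| <= e.
Proof.
move=> t0 e0; have [C C0 HC] := heat_kernel_time alpha_gt0 t0.
pose K := 2 * r%:R * (C * M).
have K0 : 0 <= K by rewrite !mulr_ge0.
exists (Num.min 1 (e / (K + 1))); first by rewrite lt_min ltr01 divr_gt0// ltr_wpDl.
move=> s s0; rewrite le_min => /andP[s1 sK] x.
have ts : 0 < t + s by rewrite addr_gt0.
have i1 := integrand_integrable x ts; have i2 := integrand_integrable x t0.
rewrite /heat_solution -RintegralB//.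
apply: (@le_trans _ _ (2 * r%:R * (C * s * M))); last first.
  have : (K + 1) * s <= e by rewrite mulrC -ler_pdivlMr// ltr_wpDl.
  by rewrite mulrDl mul1r /K; lra.
apply: cont_integral_bound.
- by apply: measurable_funB; exact: integrand_meas.
- by rewrite !mulr_ge0// ltW.
- move=> y; rewrite -mulrBl normrM ler_pM//.
  exact: HC (ltW s0) s1.
- by move=> y ry; rewrite phi_supp// !mulr0 subrr.
Qed.

(** Riemann sums for the heat flow are Gaussian mixtures, and the same sources and
    weights serve at every time: a mixture close to [phi] at time [0] stays close to
    the heat flow of [phi]. *)
Lemma gaussian_approximation t e : 0 < t -> 0 < e -> (0 < r)%N ->
  exists2 eps, 0 < eps & exists l : seq (R * R), forall x,
    `|phi x - mixture alpha eps l 0 0 x| <= e /\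
    `|heat_solution alpha phi x t - mixture alpha eps l 0 t x| <= e.
Proof.
move=> t0 e0 r0; have e20 : 0 < e / 2 by rewrite divr_gt0.
have [s1 s10 H1] := heat_solution_initial e20.
have [s2 s20 H2] := heat_solution_time t0 e20.
pose eps := Num.min s1 s2.
have eps0 : 0 < eps by rewrite lt_min s10.
have es1 : eps <= s1 by rewrite ge_min lexx.
have es2 : eps <= s2 by rewrite ge_min lexx orbT.
have te : 0 < t + eps by rewrite addr_gt0.
have [N1 N10 HN1] := heat_solution_riemann eps0 e20 r0.
have [N2 N20 HN2] := heat_solution_riemann te e20 r0.
pose N := maxn N1 N2; exists eps => //.
pose D : R := 2 * r%:R / N%:R.
pose y (i : nat) : R := - r%:R + i%:R * D.
exists [seq (phi (y i) * D, y i) | i <- index_iota 0 N] => x.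
have E (s : R) : 0 < s + eps -> mixture alpha eps [seq (phi (y i) * D, y i) | i <- index_iota 0 N] 0 s x =
    \sum_(0 <= i < N) phi (y i) * D * hk (s + eps) (x - y i).
  move=> se; rewrite /mixture big_map; apply: eq_bigr => i _ /=.
  by rewrite heat_kernelE.
split.
  rewrite E ?add0r//.
  have h1 := H1 eps eps0 es1 x.
  have h2 := HN1 N (leq_maxl _ _) x.
  rewrite -[phi x](subrK (heat_solution alpha phi x eps)) -addrA.
  by apply: (le_trans (ler_normD _ _)); rewrite /y /D; lra.
rewrite E//.
have h1 := H2 eps eps0 es2 x.
have h2 := HN2 N (leq_maxr _ _) x.
rewrite -[heat_solution alpha phi x t](subrK (heat_solution alpha phi x (t + eps))) -addrA.
by apply: (le_trans (ler_normD _ _)); rewrite distrC /y /D; lra.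
Qed.

Lemma heat_solution_dominated t : 0 < t -> exists2 C, 0 <= C &
  forall x, `|heat_solution alpha phi x t| <= C * hk (2 * t) x.
Proof.
move=> t0; have [C C0 HC] := heat_kernel_dominated alpha_gt0 r%:R t0.
exists (2 * r%:R * (C * M)); first by rewrite !mulr_ge0.
move=> x; rewrite /heat_solution.
have -> : 2 * r%:R * (C * M) * hk (2 * t) x = 2 * r%:R * (C * hk (2 * t) x * M) by ring.
apply: cont_integral_bound; first exact: integrand_meas.
- by rewrite !mulr_ge0 ?heat_kernel_ge0.
- move=> y; have [ry|yr] := leP r%:R `|y|.
    by rewrite phi_supp// mulr0 normr0 !mulr_ge0 ?heat_kernel_ge0.
  rewrite normrM (ger0_norm (heat_kernel_ge0 _ _ _)).
  by apply: ler_pM => //; rewrite ?heat_kernel_ge0// HC// ltW.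
- exact: integrand_supp.
Qed.

Lemma heat_solution_continuous t : 0 < t ->
  continuous (fun x => heat_solution alpha phi x t).
Proof.
move=> t0; have [C C0 [_ CL]] := heat_kernel_lipschitz alpha_gt0 t0.
pose K := 2 * r%:R * (C * M).
have K0 : 0 <= K by rewrite !mulr_ge0// ltW.
have lip x z : `|heat_solution alpha phi x t - heat_solution alpha phi z t| <= K * `|x - z|.
  have i1 := integrand_integrable x t0; have i2 := integrand_integrable z t0.
  rewrite /heat_solution -RintegralB//.
  have -> : K * `|x - z| = 2 * r%:R * (C * `|x - z| * M) by rewrite /K; ring.
  apply: cont_integral_bound.
  - by apply: measurable_funB; exact: integrand_meas.
  - by rewrite !mulr_ge0// ltW.
  - move=> y; rewrite -mulrBl normrM ler_pM//; apply: (le_trans (CL _ _)).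
    by have -> : x - y - (z - y) = x - z by ring.
  - by move=> y ry; rewrite phi_supp// !mulr0 subrr.
move=> x; apply/cvgrPdist_le => e e0.
have K1 : 0 < K + 1 by rewrite ltr_wpDl.
near=> z.
apply: (le_trans (lip x z)).
have : `|x - z| <= e / (K + 1).
  by near: z; apply: cvgr_dist_le; [exact: cvg_id|rewrite divr_gt0].
rewrite ler_pdivlMr// => h; have := normr_ge0 (x - z); lra.
Unshelve. all: by end_near.
Qed.

End heat_flow.

(** * Convergence of the averaged test function *)

Section lattice_sums.
Context {R : realType}.

Lemma ler_sum_sub (I : eqType) (s1 s2 : seq I) (G : I -> R) :
  uniq s1 -> {subset s1 <= s2} -> (forall i, 0 <= G i) ->
  \sum_(i <- s1) G i <= \sum_(i <- s2) G i.
Proof.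
move=> + + G0; elim: s1 s2 => [|x s1 IH] s2 /=.
  by move=> _ _; rewrite big_nil sumr_ge0.
move=> /andP[xs1 us1] s12; rewrite big_cons [leRHS](big_rem x) ?s12 ?mem_head//= lerD2l.
apply: IH => // y ys1; apply: rem_mem; last by rewrite s12// inE ys1 orbT.
by apply: contraNneq xs1 => <-.
Qed.

(** A natural number is the absolute value of at most two integers. *)
Lemma sum_abs_le (s : seq int) (G : nat -> R) N : uniq s ->
  (forall i, 0 <= G i) -> (forall j, j \in s -> (`|j| < N)%N) ->
  \sum_(j <- s) G `|j|%N <= 2 * \sum_(0 <= i < N) G i.
Proof.
move=> us G0 sN; rewrite (bigID (fun j : int => 0 <= j)) /= mulr2n mulrDl !mul1r.
have side (P : pred int) : {in P &, injective absz} ->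
    \sum_(j <- s | P j) G `|j|%N <= \sum_(0 <= i < N) G i.
  move=> Pinj; rewrite -big_filter -(big_map absz predT G).
  apply: ler_sum_sub => //.
    rewrite map_inj_in_uniq ?filter_uniq// => x y.
    by rewrite !mem_filter => /andP[Px _] /andP[Py _]; exact: Pinj.
  move=> i /mapP[j]; rewrite mem_filter => /andP[_ js] ->.
  by rewrite mem_index_iota sN.
by apply: lerD; apply: side => x y; rewrite !unfold_in /=; case: x => x; case: y => y //=; lia.
Qed.

(** One factor of the weight gives the decay in [K]; the square of the weight is
    summable uniformly in [n]. *)
Lemma decay_sum_tail (s : seq int) n K : (0 < n)%N -> uniq s ->
  n%:R^-1 * \sum_(j <- s | (K * n < `|j|)%N) decay (j%:~R / n%:R : R) <= 4 / (K.+1)%:R.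
Proof.
move=> n0 us; have nR : 0 < n%:R :> R by rewrite ltr0n.
pose N := (\max_(j <- s) `|j|).+1.
have sN j : j \in s -> (`|j| < N)%N by move=> js; rewrite ltnS leq_bigmax_seq.
apply: (@le_trans _ _ ((K.+1)%:R^-1 *
   \sum_(j <- [seq j <- s | (K * n < `|j|)%N]) n%:R / (n + `|j|)%:R ^+ 2)).
  rewrite big_filter !mulr_sumr; apply: ler_sum => j Kj.
  rewrite decay_lattice//; set q : R := (n + `|j|)%:R.
  have q0 : 0 < q by rewrite ltr0n addn_gt0 n0.
  have Kq : (K.+1)%:R * n%:R <= q by rewrite -natrM ler_nat; lia.
  have K0 : 0 < (K.+1)%:R :> R by rewrite ltr0n.
  have -> : n%:R^-1 * (n%:R ^+ 3 / q ^+ 3) = n%:R / q ^+ 2 * (n%:R / q).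
    by move: q0; clearbody q => q0; field; rewrite !gt_eqF.
  rewrite [leRHS]mulrC ler_wpM2l ?divr_ge0 ?exprn_ge0 ?(ltW q0)//.
  by rewrite ler_pdivrMr// [leRHS]mulrC ler_pdivlMr// mulrC.
rewrite mulrC ler_wpM2r ?invr_ge0//.
apply: (le_trans (@sum_abs_le _ (fun i => n%:R / (n + i)%:R ^+ 2) N _ _ _)).
- by rewrite filter_uniq.
- by move=> i; rewrite divr_ge0 ?exprn_ge0.
- by move=> j; rewrite mem_filter => /andP[_ /sN].
by have := @sum_inv_sq R n N n0; lra.
Qed.

End lattice_sums.

Section evolution.
Context {R : realType}.
Variables (c : int -> R) (alpha : R).
Hypotheses (c_gt0 : forall k, 0 < c k) (alpha_gt0 : 0 < alpha).
Hypothesis resist_right : sublinear (fun i => resist c alpha i%:Z - 1).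
Hypothesis resist_left : sublinear (fun i => resist c alpha (Negz i) - 1).
Variables (phi : R -> R) (M : R) (r : nat).
Hypotheses (phi_cont : continuous phi) (phi_supp : supported_in r%:R phi).
Hypotheses (phi_bound : forall x, `|phi x| <= M) (r_gt0 : (0 < r)%N).
Variable t : R.
Hypothesis t_gt0 : 0 < t.
Local Notation f := (fun x => heat_solution alpha phi x t).

Lemma heat_solution_decay : exists2 C, 0 <= C & forall x, `|f x| <= C * decay x.
Proof.
have [C1 C10 H1] := heat_solution_dominated alpha_gt0 phi_cont phi_supp phi_bound t_gt0.
have t20 : 0 < 2 * t by rewrite mulr_gt0.
have [C2 C20 H2] := gauss_deriv_decay alpha_gt0 (2 * t) t20.
exists (C1 * C2); first exact: mulr_ge0.
move=> x; apply: (le_trans (H1 x)); rewrite -mulrA ler_wpM2l// heat_kernelE//.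
by apply: (le_trans (ler_norm _)); apply: H2; rewrite // !lexx.
Qed.

Lemma iter_sweepB E h m (u v : int -> R) j :
  iter m (sweep c E h) (fun j => u j - v j) j =
  iter m (sweep c E h) u j - iter m (sweep c E h) v j.
Proof.
elim: m j => [//|m IH] j; rewrite !iterS -sweepB.
by congr (sweep c E h _ j); apply/funext => i; exact: IH.
Qed.

(** Sweeps contract the sup norm, so the convergence for Gaussian mixtures passes
    to their uniform limits. *)
Lemma evolution_uniform (e : R) : 0 < e ->
  exists2 n0, (0 < n0)%N & forall n, (n0 <= n)%N ->
  exists2 L0, (0 < L0)%N & forall L, (L0 <= L)%N ->
  exists2 m0, (0 < m0)%N & forall m, (m0 <= m)%N ->
  {in sites L, forall j,
    `|iter m (sweep c (bonds L) (n%:R ^+ 2 * (t / m%:R))) (lattice n phi) j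
      - lattice n f j| <= e}.
Proof.
move=> e0; have e30 : 0 < e / 3 by rewrite divr_gt0.
have [eps eps0 [l Hl]] :=
  gaussian_approximation alpha_gt0 phi_cont phi_supp phi_bound t_gt0 e30 r_gt0.
have [B wB] := mixture_caloric alpha_gt0 t l eps0.
have [n0 n00 Hn] :=
  caloric_converges c_gt0 alpha_gt0 resist_right resist_left t_gt0 wB e30.
exists n0 => // n nn; have [L0 L00 HL] := Hn n nn.
exists L0 => // L LL; have [m0 m00 Hm] := HL L LL.
exists m0 => // m mm j jL; have := Hm m mm j jL.
set h := n%:R ^+ 2 * _; set w := mixture alpha eps l.
have h0 : 0 <= h by rewrite mulr_ge0 ?exprn_ge0// divr_ge0// ltW.
have d1 : `|iter m (sweep c (bonds L) h) (lattice n phi) j -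
            iter m (sweep c (bonds L) h) (lattice n (w 0 0)) j| <= e / 3.
  rewrite -iter_sweepB; apply: iter_sweep_bound => // i.
  by have [] := Hl (i%:~R / n%:R).
have d2 : `|lattice n f j - lattice n (w 0 t) j| <= e / 3.
  by have [] := Hl (j%:~R / n%:R).
move: d1 d2; rewrite !ler_norml; lra.
Qed.

(** Uniform convergence controls the sum over a window of [K * n] sites; outside of
    it both terms are small by tightness. *)
Lemma evolution_converges (e : R) : 0 < e ->
  exists2 n0, (0 < n0)%N & forall n, (n0 <= n)%N ->
  exists2 L0, (0 < L0)%N & forall L, (L0 <= L)%N ->
  exists2 m0, (0 < m0)%N & forall m, (m0 <= m)%N ->
  n%:R^-1 * \sum_(j <- sites L)
    `|iter m (sweep c (bonds L) (n%:R ^+ 2 * (t / m%:R))) (lattice n phi) j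
      - lattice n f j| <= e.
Proof.
move=> e0; have e30 : 0 < e / 3 by rewrite divr_gt0.
have M0 : 0 <= M by exact: le_trans (normr_ge0 _) (phi_bound 0).
have [A A0 HA] := second_moment_tail c_gt0 alpha_gt0 resist_right resist_left r t_gt0 M0.
have [C C0 HC] := heat_solution_decay.
have [K1 K10 HK1] := div_nat_small A e30.
have [K2 K20 HK2] := div_nat_small (4 * C) e30.
pose K := maxn K1 K2.
have K0 : (0 < K)%N by rewrite leq_max K10.
have KR : 1 <= K%:R :> R by rewrite ler1n.
pose e' := e / 3 / (2 * K%:R + 1).
have e'0 : 0 < e' by rewrite divr_gt0// ltr_wpDl// mulr_ge0.
have [n0 n00 Hn] := evolution_uniform e'0.
exists n0 => // n nn; have [L0 L00 HL] := Hn n nn.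
have n_gt0 : (0 < n)%N by apply: leq_trans nn.
have nR : 0 < n%:R :> R by rewrite ltr0n.
exists L0 => // L LL; have [m1 m10 Hm1] := HL L LL.
have [m2 m20 Hm2] := HA n L n_gt0.
exists (maxn m1 m2) => [|m]; first by rewrite leq_max m10.
rewrite geq_max => /andP[mm1 mm2].
set u := iter m _ _.
have tail_u : n%:R^-1 * \sum_(j <- sites L | (K * n < `|j|)%N) `|u j| <= e / 3.
  apply: (le_trans (Hm2 m mm2 (lattice n phi) _ _ K K0)).
  - by move=> k; exact: phi_bound.
  - move=> k kr; apply: phi_supp; rewrite normrM normfV (gtr0_norm nR).
    rewrite ler_pdivlMr// -natrM -intr_norm -natr_absz ler_nat; exact: ltnW.
  - apply: le_trans (HK1 K (leq_maxl _ _)).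
    rewrite ler_wpM2l// lef_pV2 ?posrE ?exprn_gt0//; try lra.
    by rewrite -[leLHS]expr1 ler_weXn2l.
have tail_f : n%:R^-1 * \sum_(j <- sites L | (K * n < `|j|)%N) `|lattice n f j| <= e / 3.
  apply: (@le_trans _ _ (C * (n%:R^-1 *
      \sum_(j <- sites L | (K * n < `|j|)%N) decay (j%:~R / n%:R : R)))).
    rewrite mulrCA ler_wpM2l ?invr_ge0 ?(ltW nR)// mulr_sumr.
    by apply: ler_sum => j _; exact: HC.
  apply: (le_trans (ler_wpM2l C0 (decay_sum_tail K n_gt0 (uniq_sites L)))).
  by rewrite mulrA [C * 4]mulrC; apply: HK2; rewrite ltnW// ltnS leq_maxr.
have inner : n%:R^-1 * \sum_(j <- sites L | ~~ (K * n < `|j|)%N)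
     `|u j - lattice n f j| <= e / 3.
  rewrite (eq_bigl (fun j : int => (`|j| <= K * n)%N)); last by move=> j; rewrite -leqNgt.
  apply: (@le_trans _ _ (n%:R^-1 * (e' * (2 * (K * n)%:R + 1)))).
    rewrite ler_wpM2l ?invr_ge0 ?(ltW nR)//; apply: sum_window => [|j jL _].
      exact: ltW.
    exact: Hm1.
  rewrite natrM mulrC ler_pdivrMr// /e'.
  have n1 : 1 <= n%:R :> R by rewrite ler1n.
  have q0 : 0 < 2 * K%:R + 1 :> R by rewrite ltr_wpDl// mulr_ge0.
  rewrite mulrAC ler_pdivrMr// -mulrA ler_wpM2l ?(ltW e30)//; nra.
rewrite (bigID (fun j : int => (K * n < `|j|)%N)) /= mulrDr.
have outer : n%:R^-1 * \sum_(j <- sites L | (K * n < `|j|)%N) `|u j - lattice n f j| <=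
   e / 3 + e / 3.
  apply: (le_trans _ (lerD tail_u tail_f)); rewrite -mulrDr -big_split /=.
  rewrite ler_wpM2l ?invr_ge0 ?(ltW nR)//; apply: ler_sum => j _; exact: ler_normB.
lra.
Qed.

End evolution.

(** * Discretization of one sample path *)

Section one_path.
Context {R : realType}.
Variable N : R -> nat.

Definition counting_path : Prop :=
  [/\ N 0 = 0%N, forall s t, 0 <= s -> s <= t -> (N s <= N t)%N
    & forall t, 0 <= t -> \forall s \near t^'+, N s = N t].

Hypothesis N_path : counting_path.

Definition jump s := forall r, 0 <= r < s -> (N r < N s)%N.

(** The jump is at the infimum of the times at which the count exceeds [N a];
    right continuity shows that the count exceeds [N a] there already. *)
Lemma increment_jump a b : 0 <= a -> a <= b -> (N a < N b)%N ->
  exists2 s, a < s <= b & jump s.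
Proof.
move=> a0 ab Nab; have [_ mono rc] := N_path.
pose A := [set r | [/\ a <= r, r <= b & (N a < N r)%N]].
have Ab : A b by [].
have lbA : has_lbound A by exists a => r [].
have iA : has_inf A by split=> //; exists b.
pose s := inf A.
have as_ : a <= s by apply: lb_le_inf; [exists b|move=> r []].
have sb : s <= b by exact: ge_inf.
have Ns : (N a < N s)%N.
  have s0 : 0 <= s by exact: le_trans as_.
  have [d /= d0 Hd] := rc s s0.
  have [r [ar rb Nr] rs] := inf_adherent d0 iA.
  have sr : s <= r by apply: ge_inf.
  move: sr; rewrite le_eqVlt => /predU1P[->//|sr].
  rewrite -(Hd r)//= /ball /= distrC ger0_norm ?subr_ge0 ?(ltW sr)//.
  by rewrite ltrBlDl.
exists s.
  rewrite sb andbT lt_neqAle as_ andbT; apply/eqP => E.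
  by move: Ns; rewrite -E ltnn.
move=> r /andP[r0 rs]; have [ra|ar] := leP r a.
  by apply: leq_ltn_trans Ns; exact: mono.
rewrite ltnNge; apply/negP => Nsr.
have : s <= r.
  apply: ge_inf => //; split; [exact: ltW|exact: (le_trans (ltW rs))|].
  exact: leq_trans Nsr.
by rewrite leNgt rs.
Qed.

(** The count is injective on jump times and bounded by its final value. *)
Lemma finite_jumps t : finite_set [set s | 0 < s <= t /\ jump s].
Proof.
have [_ mono _] := N_path.
set J := [set s | _].
have inj : {in J &, injective N}.
  move=> x y; rewrite !inE => -[/andP[x0 xt] jx] [/andP[y0 yt] jy] Nxy.
  case: (ltgtP x y) => // [xy|yx].
    by have := jy x; rewrite (ltW x0) xy Nxy ltnn => /(_ isT).
  by have := jx y; rewrite (ltW y0) yx Nxy ltnn => /(_ isT).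
rewrite -(eq_finite_set (inj_card_eq inj)).
apply: (@sub_finite_set _ _ `I_(N t).+1); last exact: finite_II.
by move=> _ [s [/andP[s0 st] _] <-] /=; rewrite ltnS mono// ltW.
Qed.

End one_path.

Section cells.
Context {R : realType}.
Implicit Types (h s : R).

(** Cells are closed on the right, [i * h < s <= (i + 1) * h], so that a jump at a
    grid point belongs to the increment that ends there. *)
Definition cell h s : nat := (`|Num.ceil (s / h)|%N).-1.

Lemma cell_unique h s (i : nat) : 0 < h -> i%:R * h < s <= i.+1%:R * h -> cell h s = i.
Proof.
move=> h0 /andP[s1 s2]; rewrite /cell.
have -> : Num.ceil (s / h) = i.+1%:Z; last by [].
apply: ceil_def; rewrite ltr_pdivlMr// ler_pdivrMr//.
have -> : i.+1%:Z - 1 = i%:Z by rewrite -[i.+1]addn1 PoszD addrK.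
by apply/andP; split.
Qed.

Lemma cell_itv h s : 0 < h -> 0 < s -> (cell h s)%:R * h < s <= (cell h s).+1%:R * h.
Proof.
move=> h0 s0; have q0 : 0 < s / h by rewrite divr_gt0.
have /andP[c1 c2] := real_ceil_itv (num_real (s / h)).
have : 0 < Num.ceil (s / h) by rewrite -(ltr_int R); exact: lt_le_trans c2.
rewrite /cell; case: (Num.ceil (s / h)) c1 c2 => [[//|i]|i] //= c1 c2 _.
move: c1 c2; rewrite ltr_pdivlMr// ler_pdivrMr//.
have -> : i.+1%:Z - 1 = i%:Z by rewrite -[i.+1]addn1 PoszD addrK.
by move=> c1 c2; apply/andP; split.
Qed.

Lemma cell_mono h s s' : 0 < h -> 0 < s -> s <= s' -> (cell h s <= cell h s')%N.
Proof.
move=> h0 s0 ss'; have s'0 : 0 < s' by exact: lt_le_trans ss'.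
have /andP[a1 _] := cell_itv h0 s0; have /andP[_ b2] := cell_itv h0 s'0.
rewrite leqNgt; apply/negP => lt.
have := lt_le_trans a1 (le_trans ss' b2); rewrite ltr_pM2r// ltr_nat.
by lia.
Qed.

End cells.

Section paths.
Context {R : realType}.
Variable N : int -> R -> nat.
Hypothesis N_path : forall k, counting_path (N k).
Implicit Types (h t : R) (m : nat) (E : seq int) (x k : int).

Definition rings h (i : nat) k : bool := (N k (i%:R * h)%R < N k (i.+1%:R * h)%R)%N.

Definition slots m E : seq (nat * int) := [seq (i, k) | i <- iota 0 m, k <- E].

Definition ring_slots h m E := [seq p <- slots m E | rings h p.1 p.2].

Definition ring_list h m E : seq int := [seq p.2 | p <- ring_slots h m E].

Lemma mem_ring_slots h m E i k :
  ((i, k) \in ring_slots h m E) = [&& (i < m)%N, k \in E & rings h i k].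
Proof.
rewrite mem_filter /= [LHS]andbC andbA; congr (_ && _).
apply/allpairsP/andP => [[[i' k'] /= [im kE [-> ->]]]|[im kE]].
  by move: im; rewrite mem_iota.
by exists (i, k); rewrite mem_iota.
Qed.

(** The order in which the discretized process performs its exchanges. *)
Definition slot_lt E (p q : nat * int) :=
  (p.1 < q.1)%N || (p.1 == q.1) && (index p.2 E < index q.2 E)%N.

Lemma slot_lt_trans E : transitive (slot_lt E).
Proof.
move=> [j l] [i k] [j' l'] /orP[/= a|/= /andP[/eqP a1 a2]] /orP[/= b|/= /andP[/eqP b1 b2]];
  rewrite /slot_lt /=; lia.
Qed.

Lemma slot_lt_irr E : irreflexive (slot_lt E).
Proof. by move=> [i k]; rewrite /slot_lt /= !ltnn andbF. Qed.

Lemma pairwise_index (E : seq int) : uniq E ->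
  pairwise (fun k k' => (index k E < index k' E)%N) E.
Proof.
move=> uE; apply/(pairwiseP 0) => i j; rewrite !inE => iE jE ij.
by rewrite !index_uniq.
Qed.

Lemma slots_sorted m E : uniq E -> pairwise (slot_lt E) (slots m E).
Proof.
move=> uE; rewrite /slots; have : pairwise ltn (iota 0 m).
  by rewrite -sorted_pairwise ?iota_ltn_sorted//; exact: ltn_trans.
elim: (iota 0 m) => [//|i s IH] /= /andP[is_ ps].
rewrite pairwise_cat IH// andbT; apply/andP; split.
  apply/allrelP => _ _ /mapP[k _ ->] /allpairsP[[i' k'] /= [i's _ ->]].
  by have /= ii' := allP is_ _ i's; rewrite /slot_lt /= ii'.
rewrite pairwise_map; apply: sub_pairwise (pairwise_index uE) => k k' /= kk'.
by rewrite /slot_lt /= eqxx kk' orbT.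
Qed.

Lemma ring_slots_sorted h m E : uniq E -> sorted (slot_lt E) (ring_slots h m E).
Proof. by move=> uE; apply/pairwise_sorted/pairwise_filter/slots_sorted. Qed.

Lemma rings_jump h i k : 0 < h -> rings h i k <->
  exists2 s, i%:R * h < s <= i.+1%:R * h & jump (N k) s.
Proof.
move=> h0; have ih0 : 0 <= i%:R * h by rewrite mulr_ge0// ltW.
have ii : i%:R * h <= i.+1%:R * h by rewrite ler_wpM2r ?(ltW h0)// ler_nat.
split=> [|[s /andP[s1 s2] js]]; first exact: increment_jump (N_path k) _ _ ih0 ii.
have [_ mono _] := N_path k.
apply: leq_trans (mono s _ _ s2); last by apply: ltW; exact: le_lt_trans s1.
by apply: js; rewrite ih0.
Qed.

(** Two edges may jump at the same time on exceptional paths; [jumps] then follows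
    the enumeration of the edges, and so does the discretization. Only distinct
    jump times have to lie in distinct cells, and on a fixed path a fine grid
    always achieves this. *)
Definition separated h t E := forall k k' s s', k \in E -> k' \in E ->
  jump_times N k t s -> jump_times N k' t s' -> cell h s = cell h s' -> s = s'.

Lemma pairwise_allpairs_dep (r : rel int) (s : seq int) (J : int -> seq R) :
  pairwise r s -> pairwise (fun a b : R * int => (a.2 == b.2) || r a.2 b.2)
    [seq (v, k) | k <- s, v <- J k].
Proof.
elim: s => [//|k s IH] /= /andP[ks ps].
rewrite pairwise_cat IH// andbT; apply/andP; split.
  apply/allrelP => _ _ /mapP[u _ ->] /allpairsPdep[k' [v [k's _ ->]]] /=.
  by rewrite (allP ks)// orbT.
rewrite pairwise_map; elim: (J k) => [//|v vs IHv] /=.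
by rewrite IHv andbT; apply/allP => z _ /=; rewrite eqxx.
Qed.

(** Both sides list the same slots in the order [slot_lt]: sorting is stable, so
    that simultaneous jumps remain in the order of the enumeration of edges. *)
Lemma jumps_ring_list h m t x (K := fset_set (component_edges N t x)) :
  0 < h -> t = m%:R * h -> separated h t K ->
  [seq a.2 | a <- jumps N t x] = ring_list h m K.
Proof.
move=> h0 tE sep; have fJ k : finite_set (jump_times N k t).
  exact: finite_jumps.
have inJ k s : s \in fset_set (jump_times N k t) -> jump_times N k t s.
  by rewrite in_fset_set// inE.
pose g (a : R * int) := (cell h a.1, a.2).
suff H : [seq g a | a <- jumps N t x] = ring_slots h m K.
  by rewrite /ring_list -H -map_comp.
have uK : uniq K by exact: fset_uniq.
pose Q := [seq (s, k) | k <- K, s <- fset_set (jump_times N k t)].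
have memQ a : a \in Q -> a.2 \in K /\ jump_times N a.2 t a.1.
  by move=> /allpairsPdep[k [s [kK sJ ->]]] /=; split=> //; exact: inJ.
have tot : total (fun a b : R * int => a.1 <= b.1).
  by move=> a b; exact: le_total.
have uQ : uniq Q.
  apply: allpairs_uniq_dep => //.
by move=> [k1 s1] [k2 s2] _ _ /= [-> ->].
have sQ : sorted (fun a b : R * int => index a.2 K <= index b.2 K)%N Q.
  apply/pairwise_sorted.
  apply: sub_pairwise (pairwise_allpairs_dep _ (pairwise_index uK)).
  by move=> a b /= /orP[/eqP ->|/ltnW].
have tr : transitive (fun a b : R * int => index a.2 K <= index b.2 K)%N.
  by move=> b a c' /=; exact: leq_trans.
have := sort_stable tot tr sQ; rewrite -/(jumps N t x) => stab.
apply: (irr_sorted_eq (slot_lt_trans (E := K)) (slot_lt_irr K)).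
- apply: pairwise_sorted; rewrite pairwise_map.
  have uJ : uniq (jumps N t x) by rewrite sort_uniq.
  move: stab; rewrite sorted_pairwise; last first.
    move=> b a c' /= /andP[ab /implyP ba] /andP[bc /implyP cb].
    rewrite (le_trans ab bc) /=; apply/implyP => ca.
    by apply: leq_trans (ba _) (cb _); [exact: le_trans ca|exact: le_trans ab].
  rewrite uniq_pairwise in uJ => stab.
  have both := conj stab uJ; move/andP: both; rewrite -pairwise_relI.
  apply: (@sub_in_pairwise _ (mem Q)); last first.
    by apply/allP => a; rewrite mem_sort.
  move=> [s k] [s' k'] /memQ[/= kK jk] /memQ[/= k'K jk'] /andP[/= /andP[ss' /implyP st] ne].
  have [[/andP[s0 _] _] [/andP[s'0 _] _]] := (jk, jk').
  have := cell_mono h0 s0 ss'; rewrite leq_eqVlt => /orP[/eqP ce|lt]; last first.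
    by rewrite /slot_lt /= lt.
  have es := sep _ _ _ _ kK k'K jk jk' ce.
  rewrite /slot_lt /= ce eqxx ltnn /= ltn_neqAle st ?es// andbT.
  apply: contraNneq ne => ie; rewrite es xpair_eqE eqxx /=.
  by apply/eqP; rewrite -(nth_index 0 kK) -(nth_index 0 k'K) ie.
- exact: ring_slots_sorted.
- move=> [i k]; rewrite mem_ring_slots; apply/mapP/and3P => [[[s k']]|[im kK /(rings_jump _ _ h0)]].
    rewrite mem_sort => /memQ[/= kK [/andP[s0 st] js]] [-> ->].
    have ci := cell_itv h0 s0.
    split=> //; last by apply/rings_jump => //; exists s.
    have /andP[c1 _] := ci; have := lt_le_trans c1 st.
    by rewrite tE ltr_pM2r// ltr_nat.
  move=> [s si js]; exists (s, k); last by rewrite /g /= (cell_unique h0 si).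
  rewrite mem_sort; apply/allpairsPdep; exists k, s; split=> //.
  rewrite in_fset_set// inE; split=> //; have /andP[s1 s2] := si.
  rewrite (le_lt_trans _ s1) ?mulr_ge0 ?(ltW h0)//= tE; apply: (le_trans s2).
  by rewrite ler_wpM2r ?(ltW h0)// ler_nat.
Qed.

Lemma exclusion_ring_list h m t x eta (K := fset_set (component_edges N t x)) :
  0 < h -> t = m%:R * h -> separated h t K ->
  exclusion N eta t x = foldl exchange eta (ring_list h m K) x.
Proof.
move=> h0 tE sep; rewrite -(jumps_ring_list h0 tE sep) /exclusion.
by elim: (jumps N t x) eta => //= a s IH eta; exact: IH.
Qed.

Lemma pair_gap (P : seq (R * R)) : exists2 d : R, 0 < d &
  forall p, p \in P -> p.1 < p.2 -> d <= p.2 - p.1.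
Proof.
elim: P => [|p P [d d0 IH]]; first by exists 1.
have [lt|ge] := ltP p.1 p.2; last first.
  exists d => // q; rewrite inE => /orP[/eqP -> lt|]; last exact: IH.
  by move: (lt_le_trans lt ge); rewrite ltxx.
exists (Num.min d (p.2 - p.1)); first by rewrite lt_min d0 subr_gt0.
move=> q; rewrite inE ge_min => /orP[/eqP -> _|qP qlt]; first by rewrite lexx orbT.
by rewrite IH.
Qed.

Lemma cell_close h (s s' : R) : 0 < h -> 0 < s -> 0 < s' -> cell h s = cell h s' ->
  s' - s < h.
Proof.
move=> h0 s0 s'0 E; have /andP[a1 _] := cell_itv h0 s0.
have /andP[_ b2] := cell_itv h0 s'0.
have : (cell h s').+1%:R * h = (cell h s)%:R * h + h by rewrite -E -natr1 mulrDl mul1r.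
lra.
Qed.

Lemma separated_eventually t E : 0 < t -> exists2 m0, (0 < m0)%N &
  forall m, (m0 <= m)%N -> separated (t / m%:R) t E.
Proof.
move=> t0; have fJ k : finite_set (jump_times N k t) by exact: finite_jumps.
pose J := [seq s | k <- E, s <- enum_fset (fset_set (jump_times N k t))].
have memJ k s : k \in E -> jump_times N k t s -> s \in J.
  move=> kE js; apply/allpairsPdep; exists k, s; split=> //.
  by rewrite in_fset_set// inE.
have [d d0 Hd] := pair_gap [seq (s, s') | s <- J, s' <- J].
have [m0 m00 Hm] := div_nat_small t (divr_gt0 d0 (ltr0n R 2)).
exists m0 => // m mm; have m_gt0 : (0 < m)%N by apply: leq_trans mm.
have h0 : 0 < t / m%:R by rewrite divr_gt0// ltr0n.
move=> k k' s s' kE k'E js js' ce.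
have [[/andP[s0 _] _] [/andP[s'0 _] _]] := (js, js').
have c1 := cell_close h0 s0 s'0 ce; have c2 := cell_close h0 s'0 s0 (esym ce).
have hm := Hm m mm.
have pJ u u' : u \in J -> u' \in J -> (u, u') \in [seq (s, s') | s <- J, s' <- J].
  by move=> uJ u'J; apply/allpairsP; exists (u, u').
have jJ := memJ _ _ kE js; have jJ' := memJ _ _ k'E js'.
case: (ltgtP s s') => // [lt|lt].
  by have := Hd _ (pJ _ _ jJ jJ') lt; rewrite /=; lra.
by have := Hd _ (pJ _ _ jJ' jJ) lt; rewrite /=; lra.
Qed.

Lemma component_edge t x y z : component N t x y -> edge N t y z -> component N t x z.
Proof.
move=> [p pp ->] yz; exists (rcons p z); last by rewrite last_rcons.
by rewrite rcons_path pp.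
Qed.

Lemma edge_succ t k : (1 <= N k t)%N -> edge N t k (k + 1) /\ edge N t (k + 1) k.
Proof. by move=> Nk; rewrite /edge !eqxx Nk orbT. Qed.

(** A path in the graph cannot step over a silent edge. *)
Lemma component_walls t x k1 k2 : N k1 t = 0%N -> N k2 t = 0%N -> k1 < x <= k2 ->
  forall y, component N t x y -> k1 < y <= k2.
Proof.
move=> w1 w2 + y [p + ->]; elim: p x => [//|z p IH] x /= xk /andP[xz].
apply: IH; move: xz; rewrite /edge => /orP[/andP[/eqP -> Nx]|/andP[/eqP xE Nz]].
  have : x != k2 by apply: contraTneq Nx => ->; rewrite w2.
  by lia.
have : z != k1 by apply: contraTneq Nz => ->; rewrite w1.
by lia.
Qed.

(** Exchanges across edges that avoid the component leave it untouched. *)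
Lemma foldl_exchange_filter (C : set int) (K : pred int) (l : seq int) eta x :
  (forall k, k \in l -> K k -> C k /\ C (k + 1)) ->
  (forall k, k \in l -> ~~ K k -> ~ C k /\ ~ C (k + 1)) ->
  C x -> foldl exchange eta l x = foldl exchange eta [seq k <- l | K k] x.
Proof.
move=> inC outC.
suff H e1 e2 : (forall y, C y -> e1 y = e2 y) -> C x ->
    foldl exchange e1 l x = foldl exchange e2 [seq k <- l | K k] x by exact: H.
elim: l e1 e2 inC outC => [|k l IH] e1 e2 inC outC /= e12 Cx; first exact: e12.
have inC' k' : k' \in l -> K k' -> C k' /\ C (k' + 1).
  by move=> kl; apply: inC; rewrite inE kl orbT.
have outC' k' : k' \in l -> ~~ K k' -> ~ C k' /\ ~ C (k' + 1).
  by move=> kl; apply: outC; rewrite inE kl orbT.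
have [Kk|nKk] := boolP (K k).
  have [Ck Ck1] := inC k (mem_head _ _) Kk.
  apply: (IH (exchange e1 k) (exchange e2 k)) => // y Cy; rewrite /exchange.
  by case: eqP => // _; [exact: e12|case: eqP => // _; exact: e12].
have [nCk nCk1] := outC k (mem_head _ _) nKk.
apply: (IH (exchange e1 k) e2) => // y Cy; rewrite /exchange.
case: eqP => [yk|_]; first by rewrite yk in Cy.
by case: eqP => [yk|_]; [rewrite yk in Cy|exact: e12].
Qed.

Lemma uniq_singleton_eq (T : eqType) (s1 s2 : seq T) : uniq s1 -> uniq s2 ->
  s1 =i s2 -> {in s1 &, forall x y : T, x = y} -> s1 = s2.
Proof.
move=> u1 u2 e12 s1E; have p12 := uniq_perm u1 u2 e12.
apply: perm_small_eq => //; rewrite -(perm_size p12).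
case: s1 u1 s1E {e12 p12} => [|x [|y s]] //= /andP[+ _] s1E.
have -> : x = y by apply: s1E; rewrite !inE eqxx ?orbT.
by rewrite mem_head.
Qed.

Lemma ring_list_flatten h m E : ring_list h m E =
  flatten [seq [seq k <- E | rings h i k] | i <- iota 0 m].
Proof.
rewrite /ring_list /ring_slots /slots.
elim: (iota 0 m) => [//|i s IH] /=; rewrite filter_cat map_cat IH; congr (_ ++ _).
by elim: E {IH} => [//|k E IHE] /=; case: ifP => _ /=; rewrite IHE.
Qed.

(** Within a cell there is no order of exchanges to remember: at most one edge of
    the box rings, and it does so only once. *)
Definition calm h m L := forall i, (i < m)%N ->
  (forall k k', k \in bonds L -> k' \in bonds L -> rings h i k -> rings h i k' -> k = k')
  /\ forall k, k \in bonds L -> (N k (i.+1%:R * h)%R <= (N k (i%:R * h)%R).+1)%N.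

(** Between two silent edges the component of [x] stays in the box, and its edges are
    the only ones that matter. In a calm cell at most one exchange takes place,
    so the enumerations of the edges of the component and of the box agree. *)
Lemma exclusion_box h m t L x eta k1 k2 : 0 < h -> t = m%:R * h ->
  N k1 t = 0%N -> N k2 t = 0%N -> - L%:Z <= k1 -> k1 < x <= k2 -> k2 <= L%:Z ->
  calm h m L ->
  exclusion N eta t x = foldl exchange eta (ring_list h m (bonds L)) x.
Proof.
move=> h0 tE w1 w2 Lk1 k1xk2 k2L quiet.
have inbox := component_walls w1 w2 k1xk2.
have CEbonds k : component_edges N t x k -> k \in bonds L.
  move=> [Ck Nk]; have := inbox _ Ck; rewrite mem_bonds.
  have : k != k2 by apply: contraTneq Nk => ->; rewrite w2.
  by lia.
have fCE : finite_set (component_edges N t x).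
  by apply: (@sub_finite_set _ _ [set` bonds L]) => // k; exact: CEbonds.
pose K := fset_set (component_edges N t x).
have memK k : (k \in K) = (k \in component_edges N t x) by rewrite in_fset_set.
have KL k : k \in K -> k \in bonds L by rewrite memK inE; exact: CEbonds.
have tm i : (i < m)%N -> 0 <= i.+1%:R * h <= t.
  by move=> im; rewrite tE mulr_ge0 ?(ltW h0)//= ler_wpM2r ?(ltW h0)// ler_nat.
have ring_pos i k : (i < m)%N -> rings h i k -> (1 <= N k t)%N.
  move=> im rk; have [_ mono _] := N_path k; have /andP[t1 t2] := tm i im.
  by apply: leq_trans (mono _ _ t1 t2); exact: leq_ltn_trans rk.
have sep : separated h t K.
  move=> k k' s s' kK k'K [/andP[s0 st] js] [/andP[s'0 s't] js'] ce.
  have ci := cell_itv h0 s0; have ci' := cell_itv h0 s'0; rewrite -ce in ci'.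
  set i := cell h s in ci ci' ce.
  have im : (i < m)%N.
    have /andP[c1 _] := ci; have := lt_le_trans c1 st.
    by rewrite tE ltr_pM2r// ltr_nat.
  have [single incr] := quiet i im.
  have rk : rings h i k by apply/rings_jump => //; exists s.
  have rk' : rings h i k' by apply/rings_jump => //; exists s'.
  have kk' := single _ _ (KL _ kK) (KL _ k'K) rk rk'.
  rewrite -kk' in js'; have [_ mono _] := N_path k.
  have ih0 : 0 <= i%:R * h by rewrite mulr_ge0// ltW.
  have no u v : i%:R * h < u <= i.+1%:R * h -> i%:R * h < v <= i.+1%:R * h ->
      jump (N k) u -> jump (N k) v -> ~~ (u < v).
    move=> /andP[u1 u2] /andP[v1 v2] ju jv; apply/negP => uv.
    have u0 : 0 <= u by apply: ltW; exact: le_lt_trans u1.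
    have v0 : 0 <= v by apply: ltW; exact: le_lt_trans v1.
    have a1 := ju (i%:R * h); rewrite ih0 u1 in a1.
    have a2 := jv u; rewrite u0 uv in a2.
    have a3 := mono _ _ v0 v2; have a4 := incr k (KL _ kK).
    by have := leq_ltn_trans (a1 isT) (leq_trans (a2 isT) (leq_trans a3 a4)); rewrite ltnn.
  have := no _ _ ci ci' js js'; have := no _ _ ci' ci js' js.
  by case: (ltgtP s s').
rewrite (exclusion_ring_list eta h0 tE sep).
rewrite -/K (@foldl_exchange_filter (component N t x) (mem K) (ring_list h m (bonds L))).
- congr (foldl exchange eta _ x); rewrite !ring_list_flatten filter_flatten -map_comp.
  congr flatten; apply/eq_in_map => i; rewrite mem_iota add0n /= => im.
  apply: uniq_singleton_eq.
  + by rewrite filter_uniq// fset_uniq.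
  + by rewrite !filter_uniq// uniq_bonds.
  + move=> k; rewrite !mem_filter /=.
    by case kK: (k \in K); rewrite ?andbF//= (KL _ kK) andbT.
  + move=> k k'; rewrite !mem_filter => /andP[rk kK] /andP[rk' k'K].
    have [single _] := quiet i im.
    by apply: single => //; exact: KL.
- move=> k _; rewrite /= memK inE => -[Ck Nk]; split=> //.
  by have [e1 _] := edge_succ Nk; exact: component_edge e1.
- move=> k /mapP[[i k'] /=]; rewrite mem_ring_slots => /and3P[im kL rk] ->.
  rewrite memK => /negP; rewrite inE => nCE; have Nk := ring_pos _ _ im rk.
  split=> [Ck|Ck]; apply: nCE; split=> //.
  by have [_ e2] := edge_succ Nk; exact: component_edge Ck e2.
- by exists [::].
Qed.

End paths.

(** * Independence of the rings *)

Section probability_real.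
Context {R : realType} {d : measure_display} {T : measurableType d}.
Variable P : probability T R.
Implicit Types A B : set T.

Definition pr A : R := fine (P A).

Lemma prE A : measurable A -> P A = (pr A)%:E.
Proof. by move=> mA; rewrite fineK// fin_num_measure. Qed.

Lemma pr_ge0 A : 0 <= pr A.
Proof. by rewrite fine_ge0. Qed.

Lemma pr_setU_le A B : measurable A -> measurable B -> pr (A `|` B) <= pr A + pr B.
Proof.
move=> mA mB; rewrite -lee_fin EFinD -!prE//; last exact: measurableU.
exact: measureU2.
Qed.

Lemma pr_setU A B : measurable A -> measurable B -> A `&` B = set0 ->
  pr (A `|` B) = pr A + pr B.
Proof.
move=> mA mB AB; apply: EFin_inj; rewrite EFinD -!prE//; last exact: measurableU.
exact: measureU.
Qed.

Lemma pr_setC A : measurable A -> pr (~` A) = 1 - pr A.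
Proof.
move=> mA; apply: EFin_inj; rewrite EFinB -!prE//; last exact: measurableC.
exact: probability_setC.
Qed.

Lemma pr_setT : pr setT = 1.
Proof. by rewrite /pr probability_setT. Qed.

Lemma pr_set0 : pr set0 = 0.
Proof. by rewrite /pr measure0. Qed.

Lemma measurable_bigU (I : Type) (s : seq I) (F : I -> set T) :
  (forall i, measurable (F i)) -> measurable (\big[setU/set0]_(i <- s) F i).
Proof. by move=> mF; apply: bigsetU_measurable. Qed.

Lemma pr_bigU_le (I : Type) (s : seq I) (F : I -> set T) :
  (forall i, measurable (F i)) ->
  pr (\big[setU/set0]_(i <- s) F i) <= \sum_(i <- s) pr (F i).
Proof.
move=> mF; elim: s => [|i s IH]; first by rewrite !big_nil pr_set0.
rewrite !big_cons; apply: (le_trans (pr_setU_le _ _)) => //.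
  exact: measurable_bigU.
by rewrite lerD2l.
Qed.

Lemma independent_seq (I : choiceType) (F : I -> set_system T) (s : seq I)
    (A : I -> set T) : mutually_independent P F -> uniq s ->
  (forall i, i \in s -> F i (A i)) -> (forall i, i \in s -> measurable (A i)) ->
  pr (\big[setI/setT]_(i <- s) A i) = \prod_(i <- s) pr (A i).
Proof.
move=> ind us FA mA; pose J := [fset i in s]%fset.
have Js : perm_eq (enum_fset J) s.
  by apply: uniq_perm => // i; rewrite /J inE.
have := ind J A; rewrite (perm_big _ Js) /= => H.
have mbig : measurable (\big[setI/setT]_(i <- s) A i).
  rewrite big_seq; apply: big_ind => //; first exact: measurableI.
apply: EFin_inj; rewrite -prE// -bigcap_seq.
have -> : [set` s] = [set` J].
  by apply/seteqP; split=> i /=; rewrite /J inE.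
rewrite H; last by move=> i; rewrite /J inE; exact: FA.
rewrite big_seq [in RHS]big_seq.
elim/big_ind2 : _ => // [x y z w -> ->|i is_]; first by rewrite EFinM.
by rewrite prE//; exact: mA.
Qed.

End probability_real.

Section poisson_bits.
Context {R : realType} {d : measure_display} {Omega : measurableType d}.
Variables (P : probability Omega R) (c : int -> R) (N : int -> R -> Omega -> nat).
Hypotheses (c_gt0 : forall k, 0 < c k).
Hypothesis N_poisson : independent_poisson_processes P c N.
Implicit Types (h t s : R) (i m : nat) (k : int) (E : seq int).

Definition path_of (w : Omega) : int -> R -> nat := fun k s => N k s w.

Lemma poisson_path w k : counting_path (path_of w k).
Proof.
have [Np _] := N_poisson; have [_ N0 Nm Nr _ _] := Np k.
by split=> [|s t|t t0]; [exact: N0|exact: Nm|exact: Nr].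
Qed.

Lemma measurable_count k t : 0 <= t -> measurable_fun setT (N k t).
Proof. by move=> t0; have [Np _] := N_poisson; have [+ _ _ _ _ _] := Np k; apply. Qed.

Definition ring_set h i k := [set w | rings (path_of w) h i k].

Lemma measurable_increase k s t : 0 <= s -> 0 <= t ->
  measurable [set w | (N k s w < N k t w)%N].
Proof.
move=> s0 t0; rewrite -[X in measurable X]setTI.
by have := measurable_fun_ltn (measurable_count k s0) (measurable_count k t0) measurableT; apply.
Qed.

Lemma measurable_ring h i k : 0 <= h -> measurable (ring_set h i k).
Proof. by move=> h0; apply: measurable_increase; rewrite mulr_ge0. Qed.

Lemma sigma_process_increase k s t : 0 <= s -> 0 <= t ->
  sigma_process (N k) [set w | (N k s w < N k t w)%N].
Proof.
move=> s0 t0; pose G := \bigcup_(t in [set t : R | 0 <= t]) sigma_rv (N k t).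
pose T := g_sigma_algebraType G.
have mN u : 0 <= u -> measurable_fun [set: T] (N k u : T -> nat).
  move=> u0 _ B mB; apply: sub_sigma_algebra; exists u => //.
  by exists B.
have := measurable_fun_ltn (mN s s0) (mN t t0) measurableT.
by move=> /(_ [set true] I); rewrite setTI; apply.
Qed.

Lemma sigma_process_setC k A : sigma_process (N k) A -> sigma_process (N k) (~` A).
Proof.
pose G := \bigcup_(t in [set t : R | 0 <= t]) sigma_rv (N k t).
exact: (@measurableC _ (g_sigma_algebraType G)).
Qed.

Lemma sigma_process_setT k : sigma_process (N k) setT.
Proof.
pose G := \bigcup_(t in [set t : R | 0 <= t]) sigma_rv (N k t).
exact: (@measurableT _ (g_sigma_algebraType G)).
Qed.

Lemma sigma_process_big k (I : Type) (l : seq I) (F : I -> set Omega) :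
  (forall q : I, sigma_process (N k) (F q)) ->
  sigma_process (N k) (\big[setI/setT]_(q <- l) F q).
Proof.
pose G := \bigcup_(t in [set t : R | 0 <= t]) sigma_rv (N k t).
move=> mF; apply: big_ind => //.
- exact: (@measurableT _ (g_sigma_algebraType G)).
- exact: (@measurableI _ (g_sigma_algebraType G)).
Qed.

Lemma pr_increase k s t : 0 <= s -> s < t ->
  pr P [set w | (N k s w < N k t w)%N] = ring_prob c k (t - s).
Proof.
move=> s0 st; have t0 : 0 <= t by apply: ltW; exact: le_lt_trans st.
have [Np _] := N_poisson; have [_ _ _ _ pmf _] := Np k.
have -> : [set w | (N k s w < N k t w)%N] = ~` [set w | (N k t w - N k s w)%N = 0%N].
  apply/seteqP; split=> w /=; first by move=> lt /eqP; rewrite subn_eq0 leqNgt lt.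
  by move=> /eqP; rewrite subn_eq0 -ltnNge.
have mE : measurable [set w | (N k t w - N k s w)%N = 0%N].
  rewrite -[X in measurable X]setCK; apply: measurableC.
  have -> : ~` [set w | (N k t w - N k s w)%N = 0%N] = [set w | (N k s w < N k t w)%N].
    apply/seteqP; split=> w /=; first by move=> /eqP; rewrite subn_eq0 -ltnNge.
    by move=> lt /eqP; rewrite subn_eq0 leqNgt lt.
  exact: measurable_increase.
rewrite pr_setC// /pr pmf//= /poisson_pmf mulr_gt0 ?subr_gt0//.
by rewrite expr0 fact0 invr1 !mul1r.
Qed.

Lemma pr_ring h i k : 0 < h -> pr P (ring_set h i k) = ring_prob c k h.
Proof.
move=> h0; rewrite pr_increase ?mulr_ge0 ?(ltW h0)//.
  by congr (ring_prob c k _); rewrite -natr1; ring.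
by rewrite ltr_pM2r// ltr_nat.
Qed.

(** Independence of the processes of the various edges is used first, then, for
    each of them, independence of its increments along the grid. *)
Lemma independent_cells h m E (A : nat -> int -> set Omega) : 0 < h -> uniq E ->
  (forall i k, [\/ A i k = setT, A i k = ring_set h i k | A i k = ~` ring_set h i k]) ->
  pr P (\big[setI/setT]_(k <- E) \big[setI/setT]_(i <- iota 0 m) A i k) =
  \prod_(k <- E) \prod_(i <- iota 0 m) pr P (A i k).
Proof.
move=> h0 uE HA; have [Np ind] := N_poisson.
have gE i : 0 <= i%:R * h by rewrite mulr_ge0// ltW.
have mA i k : measurable (A i k).
  by have [->|->|->] := HA i k => //; [|apply: measurableC]; apply: measurable_ring; exact: ltW.
have mbig k : measurable (\big[setI/setT]_(i <- iota 0 m) A i k).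
  by apply: big_ind => //; exact: measurableI.
rewrite (independent_seq ind uE) => [|k _|k _]; last exact: mbig; last first.
  apply: sigma_process_big => i.
  have s1 : sigma_process (N k) (ring_set h i k) by exact: sigma_process_increase.
  have [->|->|->] := HA i k; [exact: sigma_process_setT|by []|exact: sigma_process_setC].
apply: eq_bigr => k _; have [_ _ _ _ _ indep] := Np k.
pose u (i : nat) : R := i%:R * h.
have u0 : 0 <= u 0%N by rewrite /u mul0r.
have um : {homo u : i j / (i <= j)%N >-> i <= j}.
  by move=> i j ij; rewrite /u ler_wpM2r ?(ltW h0)// ler_nat.
rewrite (independent_seq (indep u u0 um) (iota_uniq 0 m))// => i _.
have rE : ring_set h i k =
    (fun w => (N k (u i.+1) w - N k (u i) w)%N) @^-1` [set n | (0 < n)%N].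
  by apply/seteqP; split=> w /=; rewrite subn_gt0.
have [->|->|->] := HA i k.
- by exists setT => //; rewrite setTI preimage_setT.
- by exists [set n | (0 < n)%N] => //; rewrite setTI rE.
- by exists (~` [set n | (0 < n)%N]) => //; rewrite setTI rE preimage_setC.
Qed.

End poisson_bits.

(** * The law of the discretized process *)

Section ring_law.
Context {R : realType} {d : measure_display} {Omega : measurableType d}.
Variables (P : probability Omega R) (c : int -> R) (N : int -> R -> Omega -> nat).
Hypotheses (c_gt0 : forall k, 0 < c k).
Hypothesis N_poisson : independent_poisson_processes P c N.
Variables (h : R) (m : nat) (E : seq int).
Hypotheses (h_gt0 : 0 < h) (uniq_E : uniq E).
Implicit Types (a : nat * int -> option bool) (p : nat * int) (l : seq (nat * int)).

(** A partial assignment [a] prescribes some of the ring indicators; the events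
    [cylinder a] are those on which the recursion defining [expect] is run. *)
Let cond_set (o : option bool) i k : set Omega :=
  if o is Some b then if b then ring_set N h i k else ~` ring_set N h i k else setT.

Let cond_weight (o : option bool) k : R :=
  if o is Some b then if b then ring_prob c k h else 1 - ring_prob c k h else 1.

Let cylinder a : set Omega :=
  \big[setI/setT]_(k <- E) \big[setI/setT]_(i <- iota 0 m) cond_set (a (i, k)) i k.

Let weight a : R := \prod_(k <- E) \prod_(i <- iota 0 m) cond_weight (a (i, k)) k.

Let ring_meas i k : measurable (ring_set N h i k).
Proof. by apply: (measurable_ring N_poisson); exact: ltW. Qed.

Let cond_meas o i k : measurable (cond_set o i k).
Proof. by case: o => [[]|] //=; exact: measurableC. Qed.

Let cylinder_meas a : measurable (cylinder a).
Proof.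
apply: big_ind => // [|k _]; first exact: measurableI.
by apply: big_ind => //; exact: measurableI.
Qed.

Let pr_cylinder a : pr P (cylinder a) = weight a.
Proof.
rewrite /cylinder (independent_cells N_poisson m h_gt0 uniq_E); last first.
  by move=> i k; case: (a (i, k)) => [[]|]; [constructor 2|constructor 3|constructor 1].
apply: eq_bigr => k _; apply: eq_bigr => i _.
case: (a (i, k)) => [[]|] /=; rewrite ?pr_setT//.
  exact: (pr_ring c_gt0 N_poisson).
by rewrite pr_setC// (pr_ring c_gt0 N_poisson).
Qed.

Let mem_cylinder a w : cylinder a w <->
  forall p, p \in slots m E -> cond_set (a p) p.1 p.2 w.
Proof.
rewrite /cylinder -bigcap_seq; split=> H.
  move=> p /allpairsP[[i k] /= [im kE ->]] /=.
  by have := H k kE; rewrite -bigcap_seq => /(_ i im).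
move=> k kE; rewrite -bigcap_seq => i im.
by apply: (H (i, k)); apply/allpairsP; exists (i, k).
Qed.

Let update a p b : nat * int -> option bool := fun q => if q == p then Some b else a q.

Let weight_update a p b : p \in slots m E -> a p = None ->
  weight (update a p b) = weight a * cond_weight (Some b) p.2.
Proof.
move=> /allpairsP[[i0 k0] /= [im kE ->]] ap; rewrite /weight.
pose q := cond_weight (Some b) k0.
transitivity (\prod_(k <- E) (\prod_(i <- iota 0 m) cond_weight (a (i, k)) k *
    (if k == k0 then q else 1))); last first.
  rewrite big_split /=; congr (_ * _).
  by rewrite (bigD1_seq k0)//= eqxx big1 ?mulr1// => k /negbTE ->.
apply: eq_bigr => k _; case: eqP => [->|kk0]; last first.
  rewrite mulr1; apply: eq_bigr => i _; rewrite /update xpair_eqE.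
  by case: (k =P k0) => // _; rewrite andbF.
rewrite (bigD1_seq i0) ?iota_uniq//= [in RHS](bigD1_seq i0) ?iota_uniq//=.
rewrite {1}/update eqxx ap mul1r mulrC; congr (_ * _).
by apply: eq_bigr => i /negbTE ii; rewrite /update xpair_eqE ii.
Qed.

Let rung l w : seq int := [seq p.2 | p <- l & rings (path_of N w) h p.1 p.2].

Lemma measurable_rung l (Q : seq int -> Prop) : measurable [set w | Q (rung l w)].
Proof.
elim: l Q => [|p l IH] Q.
  have [q|q] := pselect (Q [::]).
    by rewrite [X in measurable X](_ : _ = setT)//; apply/seteqP; split.
  by rewrite [X in measurable X](_ : _ = set0)//; apply/seteqP; split.
rewrite [X in measurable X](_ : _ =
    (ring_set N h p.1 p.2 `&` [set w | Q (p.2 :: rung l w)]) `|`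
    (~` ring_set N h p.1 p.2 `&` [set w | Q (rung l w)])).
  apply: measurableU; apply: measurableI => //; last exact: measurableC.
  exact: (IH (fun s => Q (p.2 :: s))).
apply/seteqP; split=> w; rewrite /rung /ring_set /=.
  by case: ifPn => r q /=; [left|right; split=> //; exact/negP].
by case: ifPn => r /= [[]|[]].
Qed.

Let expect_at l (G : config -> Prop) (eta : config) : R :=
  expect [seq (p.2, ring_prob c p.2 h) | p <- l] (fun e => (`[< G e >])%:R) eta.

(** One step of [expect] decides the first slot of [l]: it splits the cylinder
    according to the indicator of that slot and extends the assignment. *)
Let cylinder_law l a eta (G : config -> Prop) : uniq l ->
  {subset l <= slots m E} -> (forall p, p \in l -> a p = None) ->
  pr P (cylinder a `&` [set w | G (foldl exchange eta (rung l w))]) =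
  weight a * expect_at l G eta.
Proof.
elim: l a eta => [|p l IH] a eta /=.
  move=> _ _ _; rewrite /expect_at /=; case: asboolP => g.
    rewrite mulr1 (_ : [set _ | _] = setT) ?setIT ?pr_cylinder//.
    by apply/seteqP; split.
  rewrite mulr0 (_ : [set _ | _] = set0) ?setI0 ?pr_set0//.
  by apply/seteqP; split.
move=> /andP[pl ul] ls aN.
have pS : p \in slots m E by apply: ls; rewrite mem_head.
have aup b q : q \in l -> update a p b q = None.
  move=> ql; rewrite /update; case: eqP => [qp|_].
    by move: pl; rewrite -qp ql.
  by apply: aN; rewrite inE ql orbT.
have ls' : {subset l <= slots m E} by move=> q ql; apply: ls; rewrite inE ql orbT.
have cyl b w : cylinder (update a p b) w <->
    cylinder a w /\ rings (path_of N w) h p.1 p.2 = b.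
  rewrite !mem_cylinder; split=> [H|[H r] q qS].
    split=> [q qS|].
      have := H q qS; rewrite /update; case: eqP => [->|//].
      by rewrite aN ?mem_head.
    have := H p pS; rewrite /update eqxx /= /ring_set.
    by case: b {H} => //= /negP/negbTE.
  rewrite /update; case: eqP => [->|_]; last exact: H.
  by rewrite /= /ring_set; case: b r => //= r; rewrite r.
rewrite [X in pr P X](_ : _ =
   (cylinder (update a p true) `&` [set w | G (foldl exchange (exchange eta p.2) (rung l w))])
   `|` (cylinder (update a p false) `&` [set w | G (foldl exchange eta (rung l w))])); last first.
  apply/seteqP; split=> w /=.
    move=> [ca]; rewrite /rung /=.
    by case: ifPn => r g; [left|right]; split=> //; apply/cyl; split=> //; exact/negbTE.
  by move=> [] [/cyl[ca r] g]; split=> //; rewrite /rung /= r.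
rewrite pr_setU.
- rewrite !IH//; try by move=> q ql; exact: aup.
  by rewrite !weight_update ?aN ?mem_head//= /expect_at /=; ring.
- by apply: measurableI => //; exact: (measurable_rung l (fun s => G (foldl exchange _ s))).
- by apply: measurableI => //; exact: (measurable_rung l (fun s => G (foldl exchange _ s))).
- apply/seteqP; split=> w //= -[[/cyl[_ r1] _] [/cyl[_ r2] _]].
  by rewrite r1 in r2.
Qed.

(** By [pr_cylinder] the ring indicators are independent with success
    probabilities [ring_prob]; deciding them one slot at a time is the recursion
    of [expect]. *)
Lemma ring_list_law eta (G : config -> Prop) :
  pr P [set w | G (foldl exchange eta (ring_list (path_of N w) h m E))] =
  expect [seq (p.2, ring_prob c p.2 h) | p <- slots m E] (fun e => (`[< G e >])%:R) eta.
Proof.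
have us : uniq (slots m E).
  by apply: allpairs_uniq => //; [exact: iota_uniq|move=> [? ?] [? ?] _ _ /= [-> ->]].
have := @cylinder_law (slots m E) (fun=> None) eta G us (fun _ => id) (fun _ _ => erefl).
rewrite (_ : cylinder _ = setT).
  rewrite setTI => ->; rewrite /weight big1 ?mul1r// => k _.
  by rewrite big1.
by apply/seteqP; split=> // w _; apply/mem_cylinder => p.
Qed.

Lemma measurable_ring_list (Q : seq int -> Prop) :
  measurable [set w | Q (ring_list (path_of N w) h m E)].
Proof. exact: measurable_rung. Qed.

End ring_law.

Lemma evolve_cat (R : realType) (l1 l2 : seq (int * R)) u :
  evolve (l1 ++ l2) u = evolve l1 (evolve l2 u).
Proof. by rewrite /evolve foldr_cat. Qed.

(** The slots are listed cell by cell, so each cell contributes one sweep. *)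
Lemma evolve_slots (R : realType) (c : int -> R) h m E u :
  evolve [seq (p.2, ring_prob c p.2 h) | p <- slots m E] u =
  iter m (sweep c E h) u.
Proof.
rewrite /slots; move: 0%N; elim: m => [//|m IH] i /=.
rewrite map_cat evolve_cat IH -map_comp /=; congr sweep.
Qed.

(** * Silent bonds and calm cells *)

Section good_events.
Context {R : realType} {d : measure_display} {Omega : measurableType d}.
Variables (P : probability Omega R) (c : int -> R) (N : int -> R -> Omega -> nat).
Hypotheses (c_gt0 : forall k, 0 < c k).
Hypothesis N_poisson : independent_poisson_processes P c N.

Let measurable_increment k s t n : 0 <= s -> 0 <= t ->
  measurable [set w | (N k t w - N k s w)%N = n].
Proof.
move=> s0 t0.
have mf := measurable_fun_subn (measurable_count N_poisson k t0) (measurable_count N_poisson k s0).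
by have := mf measurableT [set n] I; rewrite setTI; apply.
Qed.

Lemma pr_double_jump k s t : 0 <= s -> s < t ->
  pr P [set w | ((N k s w).+1 < N k t w)%N] <= (c k * (t - s)) ^+ 2.
Proof.
move=> s0 st; have t0 : 0 <= t by apply: ltW; exact: le_lt_trans st.
have [Np _] := N_poisson; have [_ _ _ _ pmf _] := Np k.
set A := fun n => [set w | (N k t w - N k s w)%N = n].
have mA n : measurable (A n) by exact: measurable_increment.
have la0 : 0 < c k * (t - s) by rewrite mulr_gt0// subr_gt0.
rewrite (_ : [set w | _] = ~` (A 0%N `|` A 1%N)); last first.
  apply/seteqP; split=> w; rewrite /A /=; first by move=> lt [|]; lia.
  move=> /not_orP[n0 n1]; lia.
rewrite pr_setC ?pr_setU//; last 2 first.
- by apply/seteqP; split=> w //= -[]; rewrite /A /= => ->.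
- exact: measurableU.
rewrite /pr /A !pmf//= /poisson_pmf la0 expr0 fact0 expr1 invr1 !mul1r mulr1.
set x := c k * (t - s) in la0 *.
by have := expR_ge1Dx (- x); have := expR_ge0 (- x); nra.
Qed.

Let pr_two_rings h i k k' : 0 < h -> k != k' ->
  pr P (ring_set N h i k `&` ring_set N h i k') <= (c k * h) * (c k' * h).
Proof.
move=> h0 kk'; have [_ ind] := N_poisson.
have uk : uniq [:: k; k'] by rewrite /= inE kk'.
have := @independent_seq _ _ _ P _ _ [:: k; k'] (ring_set N h i) ind uk.
rewrite !big_cons !big_nil setIT mulr1 => ->.
- rewrite !(pr_ring c_gt0 N_poisson)//.
  have [p0 _ p1] := ring_prob_bounds c_gt0 k (ltW h0).
  have [q0 _ q1] := ring_prob_bounds c_gt0 k' (ltW h0).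
  exact: ler_pM.
- by move=> q _; apply: sigma_process_increase; rewrite mulr_ge0// ltW.
- by move=> q _; apply: (measurable_ring N_poisson); exact: ltW.
Qed.

(** There are [m] cells, and in each of them two rings occur with probability of
    order [1 / m ^ 2]. *)
Lemma calm_probability (T : R) L : 0 < T -> exists2 C, 0 <= C &
  forall m, (0 < m)%N -> exists2 B, measurable B & pr P B <= C / m%:R /\
    forall w, ~ B w -> calm (path_of N w) (T / m%:R) m L.
Proof.
move=> T0; pose S := \sum_(k <- bonds L) c k.
have S0 : 0 <= S by apply: sumr_ge0 => k _; exact: ltW.
exists (2 * (T * S) ^+ 2); first by rewrite mulr_ge0// sqr_ge0.
move=> m m0; have mR : 0 < m%:R :> R by rewrite ltr0n.
set h := T / m%:R; have h0 : 0 < h by rewrite divr_gt0.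
have g0 i : 0 <= i%:R * h by rewrite mulr_ge0// ltW.
have ch0 k : 0 <= c k * h by rewrite mulr_ge0// ltW.
pose D i k := [set w | ((N k (i%:R * h) w).+1 < N k (i.+1%:R * h) w)%N].
pose X i (p : int * int) := if p.1 == p.2 then set0
   else ring_set N h i p.1 `&` ring_set N h i p.2.
pose pairs := [seq (k, k') | k <- bonds L, k' <- bonds L].
pose F i := \big[setU/set0]_(k <- bonds L) D i k `|` \big[setU/set0]_(p <- pairs) X i p.
have mr i k : measurable (ring_set N h i k).
  by apply: (measurable_ring N_poisson); exact: ltW.
have mD i k : measurable (D i k).
  rewrite /D; rewrite (_ : [set _ | _] =
     [set w | (N k (i%:R * h) w + 1 < N k (i.+1%:R * h) w)%N]); last first.
    by apply/seteqP; split=> w /=; rewrite addn1.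
  rewrite -[X in measurable X]setTI.
  have mf : measurable_fun setT (fun w => (N k (i%:R * h) w + 1)%N).
    exact: (measurable_fun_addn (measurable_count N_poisson k (g0 i)) (@measurable_cst _ _ _ _ _ 1%N)).
  by have := measurable_fun_ltn mf (measurable_count N_poisson k (g0 i.+1)) measurableT; apply.
have mX i p : measurable (X i p).
  by rewrite /X; case: ifP => _ //; exact: measurableI.
have mF i : measurable (F i) by apply: measurableU; exact: measurable_bigU.
exists (\big[setU/set0]_(i <- iota 0 m) F i); first exact: measurable_bigU.
split.
  apply: (le_trans (pr_bigU_le P _ mF)).
  apply: (@le_trans _ _ (\sum_(i <- iota 0 m) 2 * (S * h) ^+ 2)); last first.
    rewrite big_const_seq count_predT iter_addr_0 size_iota -[_ *+ m]mulr_natr.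
    rewrite /h le_eqVlt; apply/orP; left; apply/eqP; field; exact: lt0r_neq0.
  apply: ler_sum => i _; apply: (le_trans (pr_setU_le P _ _)).
  - exact: measurable_bigU.
  - exact: measurable_bigU.
  have h1 : pr P (\big[setU/set0]_(k <- bonds L) D i k) <= (S * h) ^+ 2.
    apply: (le_trans (pr_bigU_le P _ (mD i))).
    apply: (@le_trans _ _ (\sum_(k <- bonds L) (c k * h) * (S * h))).
      rewrite big_seq [leRHS]big_seq; apply: ler_sum => k kL.
      apply: (le_trans (pr_double_jump k (g0 i) _)).
        by rewrite ltr_pM2r// ltr_nat.
      have -> : i.+1%:R * h - i%:R * h = h by rewrite -natr1; ring.
      have cS : c k <= S.
        rewrite /S (bigD1_seq k) ?uniq_bonds//= lerDl.
        by apply: sumr_ge0 => k' _; exact: ltW.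
      by rewrite expr2 ler_wpM2l//; exact: (ler_wpM2r (ltW h0) cS).
    by rewrite -mulr_suml -mulr_suml expr2.
  have h2 : pr P (\big[setU/set0]_(p <- pairs) X i p) <= (S * h) ^+ 2.
    apply: (le_trans (pr_bigU_le P _ (mX i))).
    apply: (@le_trans _ _ (\sum_(p <- pairs) (c p.1 * h) * (c p.2 * h))).
      apply: ler_sum => p _; rewrite /X; case: ifPn => pp; last exact: pr_two_rings.
      by rewrite pr_set0 mulr_ge0.
    have E : S * h = \sum_(k <- bonds L) c k * h by rewrite /S mulr_suml.
    rewrite /pairs big_allpairs /= expr2 {1}E mulr_suml.
    by apply: ler_sum => k _; rewrite E mulr_sumr.
  lra.
move=> w; rewrite -bigcup_seq => nB i im.
have nF : ~ F i w by move=> Fw; apply: nB; exists i => //=; rewrite mem_iota.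
split=> [k k' kL k'L rk rk'|k kL].
  apply/eqP/negPn/negP => kk'; apply: nF; right; rewrite -bigcup_seq.
  exists (k, k'); first by apply/allpairsP; exists (k, k').
  by rewrite /X /= (negbTE kk').
rewrite leqNgt; apply/negP => lt; apply: nF; left; rewrite -bigcup_seq.
by exists k.
Qed.

(** Otherwise the partial sums of [A - 1] would eventually decrease at rate [1 / 2]. *)
Lemma sublinear_frequent (A : nat -> R) : sublinear (fun i => A i - 1) ->
  forall M0, exists2 i, (M0 <= i)%N & 2^-1 <= A i.
Proof.
move=> sA M0; apply: contrapT => H.
have lt i : (M0 <= i)%N -> A i < 2^-1.
  by move=> Mi; rewrite ltNge; apply/negP => Ai; apply: H; exists i.
have [C C0 HC] := sA (4^-1) ltac:(by rewrite invr_gt0).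
set S0 := \sum_(0 <= i < M0) (A i - 1).
have up n : \sum_(0 <= i < M0 + n) (A i - 1) <= S0 - n%:R / 2.
  elim: n => [|n IH]; first by rewrite addn0 mul0r subr0.
  rewrite addnS big_nat_recr //= -[n.+1%:R]natr1.
  have := lt (M0 + n)%N (leq_addr _ _); lra.
(* At length [64 * n0] the drift [- 1 / 2] beats the allowed rate [1 / 4]. *)
have [n0 n00 Hn] := div_nat_small (S0 + C + M0%:R) (ltr01 : 0 < 1 :> R).
have := Hn (8 * n0)%N ltac:(by lia).
rewrite ler_pdivrMr ?ltr0n ?muln_gt0// mul1r.
have := up (8 * (8 * n0))%N; have := HC (M0 + 8 * (8 * n0))%N.
rewrite ler_norml => /andP[+ _]; rewrite natrD [(8 * (8 * n0))%:R]natrM.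
have : 0 < (8 * n0)%:R :> R by rewrite ltr0n muln_gt0.
have : 0 <= M0%:R :> R by [].
lra.
Qed.

Lemma sublinear_frequent_seq (A : nat -> R) : sublinear (fun i => A i - 1) ->
  forall M0 q, exists s : seq nat, [/\ size s = q, uniq s &
    forall i, i \in s -> (M0 <= i)%N /\ 2^-1 <= A i].
Proof.
move=> sA M0 q; elim: q => [|q [s [ss us Hs]]]; first by exists [::].
have [i Mi Ai] := sublinear_frequent sA (maxn M0 (\max_(j <- s) j).+1).
move: Mi; rewrite geq_max => /andP[Mi si].
exists (i :: s); split=> /=; first by rewrite ss.
  rewrite us andbT; apply/negP => is_.
  have : (i <= \max_(j <- s) j)%N by apply: leq_bigmax_seq.
  by rewrite leqNgt si.
by move=> j; rewrite inE => /orP[/eqP ->|]; [|exact: Hs].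
Qed.

Let pr_all_ring (T : R) (s : seq int) (b : R) : 0 < T -> uniq s ->
  (forall k, k \in s -> ring_prob c k T <= b) ->
  exists2 B, measurable B & pr P B <= b ^+ size s /\
    forall w, ~ B w -> exists2 k, k \in s & N k T w = 0%N.
Proof.
move=> T0 us sb; have [_ ind] := N_poisson; pose A k := ring_set N T 0 k.
have mA k : measurable (A k).
  by apply: (measurable_ring N_poisson); exact: ltW.
exists (\big[setI/setT]_(k <- s) A k).
  by apply: big_ind => //; exact: measurableI.
split.
  rewrite (independent_seq ind us) => [|k _|k _]; last exact: mA; last first.
    by apply: sigma_process_increase; rewrite mulr_ge0// ltW.
  have -> : b ^+ size s = \prod_(k <- s) b.
    by rewrite big_const_seq count_predT iter_mulr_1.
  rewrite big_seq [leRHS]big_seq; apply: ler_prod => k ks.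
  by rewrite pr_ge0 (pr_ring c_gt0 N_poisson)// sb.
move=> w; rewrite -bigcap_seq => nB; apply: contrapT => H; apply: nB => k ks.
have [Np _] := N_poisson; have [_ N0 _ _ _ _] := Np k.
rewrite /A /ring_set /= /rings /path_of !mul0r mul1r N0 lt0n.
by apply/eqP => NT; apply: H; exists k.
Qed.

Variable alpha : R.
Hypothesis alpha_gt0 : 0 < alpha.
Hypothesis resist_right : sublinear (fun i => resist c alpha i%:Z - 1).
Hypothesis resist_left : sublinear (fun i => resist c alpha (Negz i) - 1).

(** On both half-lines the resistance is infinitely often at least half of its
    mean. An edge with this property is silent up to time [T] with a
    probability bounded below, and [q] independent edges all ring with
    probability at most [b ^ q]. *)
Lemma walls_probability (T e : R) (rho : nat) : 0 < T -> 0 < e -> exists L0,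
  exists2 B, measurable B & pr P B <= e /\
    forall w, ~ B w -> exists k1 k2, [/\ N k1 T w = 0%N, N k2 T w = 0%N,
      - L0%:Z <= k1 < - rho%:Z & rho%:Z <= k2 <= L0%:Z].
Proof.
move=> T0 e0; pose b := 1 - expR (- (2 / alpha * T)).
have b1 : b < 1 by rewrite /b ltrBlDr ltrDl expR_gt0.
have b0 : 0 <= b.
  rewrite /b subr_ge0 -expR0 ler_expR oppr_le0 mulr_ge0 ?(ltW T0)//.
  by rewrite divr_ge0// ltW.
have rb k : 2^-1 <= resist c alpha k -> ring_prob c k T <= b.
  move=> rk; rewrite /ring_prob /b lerD2l lerN2 ler_expR lerN2 ler_wpM2r ?(ltW T0)//.
  move: rk; rewrite /resist lef_pV2 ?posrE ?mulr_gt0// => h.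
  by rewrite ler_pdivlMr// mulrC.
have e20 : 0 < e / 2 by rewrite divr_gt0.
have [q Hq] : exists q : nat, b ^+ q <= e / 2.
  have /cvgrPdist_le/(_ _ e20)[q _ Hq] : b ^+ n @[n --> \oo] --> 0.
    by apply: cvg_expr; rewrite ger0_norm.
  exists q; have := Hq q (leqnn q); rewrite /= sub0r normrN ger0_norm//.
  exact: exprn_ge0.
have [s1 [z1 u1 H1]] := sublinear_frequent_seq resist_right rho q.
have [s2 [z2 u2 H2]] := sublinear_frequent_seq resist_left rho q.
have v1 : uniq [seq i%:Z | i <- s1] by rewrite map_inj_uniq// => i j [].
have v2 : uniq [seq Negz i | i <- s2] by rewrite map_inj_uniq// => i j [].
have [B1 mB1 [p1 W1]] := @pr_all_ring T [seq i%:Z | i <- s1] b T0 v1 ltac:(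
  by move=> _ /mapP[i is1 ->]; apply: rb; have [] := H1 i is1).
have [B2 mB2 [p2 W2]] := @pr_all_ring T [seq Negz i | i <- s2] b T0 v2 ltac:(
  by move=> _ /mapP[i is2 ->]; apply: rb; have [] := H2 i is2).
rewrite size_map z1 in p1; rewrite size_map z2 in p2.
exists (\max_(i <- s1 ++ s2) i).+1; exists (B1 `|` B2); first exact: measurableU.
split; first by apply: (le_trans (pr_setU_le P mB1 mB2)); lra.
move=> w /not_orP[/W1[_ /mapP[i is1 ->] Ni] /W2[_ /mapP[j js2 ->] Nj]].
have im : (i <= \max_(i <- s1 ++ s2) i)%N.
  by apply: leq_bigmax_seq; rewrite // mem_cat is1.
have jm : (j <= \max_(i <- s1 ++ s2) i)%N.
  by apply: leq_bigmax_seq; rewrite // mem_cat js2 orbT.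
have [ri _] := H1 i is1; have [rj _] := H2 j js2.
exists (Negz j), i%:Z; move: im jm ri rj; move: (\max_(_ <- _) _) => b'.
by rewrite NegzE => im jm ri rj; split=> //; clear -im jm ri rj; lia.
Qed.

End good_events.

(** * Measurability of the exclusion process *)

Section countable_operations.
Context {d : measure_display} {T : measurableType d}.

Lemma countable_exists (I : countType) (Q : I -> T -> Prop) :
  (forall i, measurable [set w | Q i w]) -> measurable [set w | exists i, Q i w].
Proof.
move=> mQ; rewrite (_ : [set w | exists i, Q i w] = \bigcup_i [set w | Q i w]).
  by apply: countable_bigcupT_measurable => //; exact: countableP.
by apply/seteqP; split=> w [i]; [exists i|move=> _; exists i].
Qed.

Lemma countable_forall (I : countType) (Q : I -> T -> Prop) :
  (forall i, measurable [set w | Q i w]) -> measurable [set w | forall i, Q i w].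
Proof.
move=> mQ; rewrite -[X in measurable X]setCK; apply: measurableC.
rewrite (_ : ~` _ = [set w | exists i, ~ Q i w]).
  by apply: countable_exists => i; exact: (measurableC (mQ i)).
by apply/seteqP; split=> w /= H; apply/existsNP.
Qed.

Lemma measurable_and_prop (A B : T -> Prop) :
  measurable [set w | A w] -> measurable [set w | B w] -> measurable [set w | A w /\ B w].
Proof. by move=> mA mB; exact: (measurableI _ _ mA mB). Qed.

Lemma measurable_const_prop (A : Prop) : measurable [set _ : T | A].
Proof.
have [a|na] := pselect A.
  by rewrite (_ : [set _ | A] = setT)//; apply/seteqP; split.
by rewrite (_ : [set _ | A] = set0)//; apply/seteqP; split.
Qed.

End countable_operations.

Section component_measurable.
Context {R : realType} {d : measure_display} {Omega : measurableType d}.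
Variables (P : probability Omega R) (c : int -> R) (N : int -> R -> Omega -> nat).
Hypothesis N_poisson : independent_poisson_processes P c N.
Variable t : R.
Hypothesis t_gt0 : 0 < t.

Let active_meas k : measurable [set w | (1 <= path_of N w k t)%N].
Proof.
rewrite -[X in measurable X]setTI.
by have := measurable_count N_poisson k (ltW t_gt0) measurableT (Y := [set n | (1 <= n)%N]); apply.
Qed.

Let edge_meas y z : measurable [set w | edge (path_of N w) t y z].
Proof.
rewrite /edge; case: (z == y + 1); case: (y == z + 1); rewrite /=.
- rewrite (_ : [set w | _] = [set w | (1 <= path_of N w y t)%N] `|`
     [set w | (1 <= path_of N w z t)%N]); first exact: measurableU.
  by apply/seteqP; split=> w /=; [move/orP|move=> ?; apply/orP].
- by under eq_set do rewrite orbF; exact: active_meas.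
- exact: active_meas.
- exact: (measurable_const_prop false).
Qed.

Let path_meas x p : measurable [set w | path (edge (path_of N w) t) x p].
Proof.
elim: p x => [|y p IH] x /=; first exact: (measurable_const_prop true).
rewrite (_ : [set w | _] = [set w | edge (path_of N w) t x y] `&`
   [set w | path (edge (path_of N w) t) y p]); first exact: measurableI.
by apply/seteqP; split=> w /=; [move/andP|move=> ?; apply/andP].
Qed.

Let component_edges_meas x k : measurable [set w | component_edges (path_of N w) t x k].
Proof.
apply: measurable_and_prop; last exact: active_meas.
rewrite (_ : [set w | _] = [set w | exists p : seq int,
    path (edge (path_of N w) t) x p /\ k = last x p]).
  apply: countable_exists => p; apply: measurable_and_prop => //.
  exact: measurable_const_prop.
by apply/seteqP; split=> w [p]; [move=> ? ?; exists p|move=> [? ?]; exists p].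
Qed.

(** The empty value is also taken when the component is infinite; it is therefore
    treated as the complement of countably many nonempty values. *)
Lemma measurable_component_fset x (K : {fset int}) :
  measurable [set w | fset_set (component_edges (path_of N w) t x) = K].
Proof.
have main K' : K' != fset0 ->
    measurable [set w | fset_set (component_edges (path_of N w) t x) = K'].
  move=> K0.
  rewrite (_ : [set w | _] = [set w | forall k : int,
      component_edges (path_of N w) t x k <-> k \in K']).
    apply: countable_forall => k; case: (k \in K').
      rewrite (_ : [set w | _] = [set w | component_edges (path_of N w) t x k]) //.
      by apply/seteqP; split=> w /=; [case=> _; apply|move=> ?; split].
    rewrite (_ : [set w | _] = ~` [set w | component_edges (path_of N w) t x k]).
      exact: measurableC.
    by apply/seteqP; split=> w /=; [case=> h _ /h|move=> h; split].
  apply/seteqP; split=> w /= => [E k|H].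
    have fC : finite_set (component_edges (path_of N w) t x).
      apply: contrapT => inf; move: K0; rewrite -E /fset_set.
      by case: pselect => //; rewrite eqxx.
    by rewrite -E in_fset_set// inE.
  rewrite -[RHS]set_fsetK; congr fset_set.
  by apply/seteqP; split=> k; [move/H|move=> ?; apply/H].
have [->|/main//] := eqVneq K fset0.
rewrite (_ : [set w | _] = [set w | forall K' : {fset int}, K' != fset0 ->
   fset_set (component_edges (path_of N w) t x) <> K']).
  apply: countable_forall => K'; have [/eqP ->|K'0] := boolP (K' == fset0).
    by rewrite (_ : [set w | _] = setT)//; apply/seteqP; split.
  rewrite (_ : [set w | _] =
     ~` [set w | fset_set (component_edges (path_of N w) t x) = K']).
    by apply: measurableC; exact: main.
  by apply/seteqP; split=> w /=; [apply|].
apply/seteqP; split=> w /= => [-> K' K'0 /esym|H]; first exact/eqP.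
by apply/eqP/negPn/negP => h; exact: H h erefl.
Qed.

End component_measurable.

Section exclusion_measurable.
Context {R : realType} {d : measure_display} {Omega : measurableType d}.
Variables (P : probability Omega R) (c : int -> R) (N : int -> R -> Omega -> nat).
Hypothesis N_poisson : independent_poisson_processes P c N.
Variable t : R.
Hypothesis t_gt0 : 0 < t.

Lemma measurable_site (x : int) : measurable [set eta : config | eta x].
Proof. by apply: sub_sigma_algebra; exists x, [set true]; apply/seteqP; split. Qed.

(** A fixed list of exchanges permutes the sites. *)
Lemma foldl_exchange_site (l : seq int) (x : int) :
  exists y : int, forall eta : config, foldl exchange eta l x = eta y.
Proof.
elim: l => [|k l [y Hy]]; first by exists x.
exists (if y == k then k + 1 else if y == k + 1 then k else y) => eta /=.
by rewrite Hy /exchange; case: eqP => // _; case: eqP.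
Qed.

(** On every sample path, and not just almost surely, the exclusion
    configuration is the eventual value of its discretizations along finer
    and finer grids. *)
Let exclusion_limit (z : config * Omega) (x : int) :
  exclusion (path_of N z.2) z.1 t x <->
  exists K : {fset int}, fset_set (component_edges (path_of N z.2) t x) = K /\
    exists M0 : nat, forall m : nat,
      foldl exchange z.1 (ring_list (path_of N z.2) (t / (M0 + m).+1%:R) (M0 + m).+1 K) x.
Proof.
case: z => eta w /=; have path_w := poisson_path N_poisson w.
have [m0 m00 sep] := separated_eventually path_w
  (fset_set (component_edges (path_of N w) t x)) t_gt0.
have tm m : t = m.+1%:R * (t / m.+1%:R) :> R.
  by rewrite mulrC divfK// pnatr_eq0.
have hm m : 0 < t / m.+1%:R by rewrite divr_gt0// ltr0n.
have E m : (m0 <= m.+1)%N -> exclusion (path_of N w) eta t x =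
   foldl exchange eta (ring_list (path_of N w) (t / m.+1%:R) m.+1
     (fset_set (component_edges (path_of N w) t x))) x.
  by move=> mm; apply: (exclusion_ring_list path_w eta (hm m) (tm m) (sep _ mm)).
split=> [ex|[_ [<- [M0 H]]]].
  exists (fset_set (component_edges (path_of N w) t x)); split=> //.
  by exists m0 => m; rewrite -E//; lia.
by have := H m0; rewrite -E//; lia.
Qed.

Lemma measurable_exclusion_site (x : int) :
  measurable [set z : config * Omega | exclusion (path_of N z.2) z.1 t x].
Proof.
rewrite (_ : [set z | _] = [set z : config * Omega | exists K : {fset int},
   fset_set (component_edges (path_of N z.2) t x) = K /\
    exists M0 : nat, forall m : nat,
      foldl exchange z.1 (ring_list (path_of N z.2) (t / (M0 + m).+1%:R) (M0 + m).+1 K) x]);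
  last by apply/seteqP; split=> z; [move=> /exclusion_limit|move=> H; exact/exclusion_limit].
apply: countable_exists => K; apply: measurable_and_prop.
  rewrite (_ : [set z | _] = setT `*`
     [set w | fset_set (component_edges (path_of N w) t x) = K]).
    by apply: measurableX => //; exact: (measurable_component_fset N_poisson).
  by apply/seteqP; split=> [[eta w]|[eta w]] //= [].
apply: countable_exists => M0; apply: countable_forall => m.
set h := t / _; set m' := (M0 + m).+1.
rewrite (_ : [set z | _] = [set z : config * Omega | exists l : seq int,
   foldl exchange z.1 l x /\ ring_list (path_of N z.2) h m' K = l]); last first.
  apply/seteqP; split=> z /=; last by move=> [l [H E]]; move: H; rewrite -E.
  by move=> ?; exists (ring_list (path_of N z.2) h m' K).
apply: countable_exists => l.
have [y Hy] := foldl_exchange_site l x.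
rewrite (_ : [set z | _] = [set eta : config | eta y] `*`
   [set w | ring_list (path_of N w) h m' K = l]).
  apply: measurableX; first exact: measurable_site.
  apply: (@measurable_ring_list _ _ _ P c N N_poisson h m' K _ (fun s => s = l)).
  by rewrite divr_gt0// ltr0n.
by apply/seteqP; split=> [[eta w]|[eta w]] /=; rewrite Hy.
Qed.

Lemma measurable_exclusion :
  measurable_fun setT (fun z : config * Omega => exclusion (path_of N z.2) z.1 t : config).
Proof.
apply: (@measurability _ _ _ (g_sigma_algebraType cylinders) _ _ cylinders erefl).
move=> _ [_ [k [B ->]] <-].
rewrite setTI.
have mb : measurable_fun setT (fun z : config * Omega => exclusion (path_of N z.2) z.1 t k).
  apply: (measurable_fun_bool true); rewrite setTI.
  rewrite (_ : _ @^-1` _ = [set z : config * Omega | exclusion (path_of N z.2) z.1 t k]).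
    exact: measurable_exclusion_site.
  by apply/seteqP; split.
by have := mb measurableT B I; rewrite setTI.
Qed.

End exclusion_measurable.

(** * Empirical averages and duality *)

Section integer_sums.
Context {R : realType}.
Implicit Types (a : int -> R) (phi : R -> R).

Definition zigzag (i : nat) : int := if odd i then Negz i./2 else Posz i./2.

Lemma zigzag_bij : set_bij [set: nat] [set: int] zigzag.
Proof.
split=> [i _ //|i j _ _|[k|k] _].
- rewrite /zigzag; have := odd_double_half i; have := odd_double_half j.
  by case: (odd i); case: (odd j) => // ej ei [] E; rewrite -ei -ej E.
- by exists k.*2 => //; rewrite /zigzag odd_double doubleK.
- by exists k.*2.+1 => //; rewrite /zigzag /= odd_double /= uphalf_double.
Qed.

Lemma esum_zigzag (b : int -> \bar R) : (forall j, 0 <= b j)%E ->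
  (\esum_(j in [set: int]) b j = \sum_(0 <= i <oo) b (zigzag i))%E.
Proof. by move=> b0; rewrite (@reindex_esum _ _ _ _ _ _ b zigzag_bij) nneseries_esumT. Qed.

Lemma measurable_of_site (g : bool -> \bar R) (j : int) :
  measurable_fun setT (fun eta : config => g (eta j)).
Proof.
by move=> _ Y mY; rewrite setTI; apply: sub_sigma_algebra; exists j, (g @^-1` Y).
Qed.

Lemma measurable_esum_site (g : int -> bool -> \bar R) : (forall j b, 0 <= g j b)%E ->
  measurable_fun setT (fun eta : config => \esum_(j in [set: int]) g j (eta j))%E.
Proof.
move=> g0.
have -> : (fun eta : config => \esum_(j in [set: int]) g j (eta j))%E =
   (fun eta : config => \sum_(0 <= i <oo) g (zigzag i) (eta (zigzag i)))%E.
  by apply/funext => eta; exact: esum_zigzag.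
apply: ge0_emeasurable_sum => // k _.
exact: (measurable_of_site (g (zigzag k))).
Qed.

Lemma measurable_empirical n phi : measurable_fun setT (empirical n phi).
Proof.
apply: measurable_funeM; apply: emeasurable_funB.
  apply: (@measurable_esum_site (fun j b =>
    (Num.max (phi (j%:~R / n%:R) * b%:R) 0)%:E)).
  by move=> j b; rewrite lee_fin le_max lexx orbT.
apply: (@measurable_esum_site (fun j b =>
  (Num.max (- (phi (j%:~R / n%:R) * b%:R)) 0)%:E)).
by move=> j b; rewrite lee_fin le_max lexx orbT.
Qed.

Lemma measurable_deviates n phi rho delta : measurable (deviates n phi rho delta : set config).
Proof.
rewrite /deviates; set I := (\int[_]_x _)%E.
rewrite -[X in measurable X]setTI.
apply: emeasurable_fun_o_infty => //.
apply: measurableT_comp => //.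
by apply: emeasurable_funB; [exact: measurable_empirical|exact: measurable_cst].
Qed.

Lemma esum_window a L e : (forall j, 0 <= a j) ->
  (forall s : seq int, uniq s -> \sum_(j <- s | (L < `|j|)%N) a j <= e) ->
  exists r, (\esum_(j in [set: int]) (a j)%:E = r%:E)%E /\
    \sum_(j <- sites L) a j <= r <= \sum_(j <- sites L) a j + e.
Proof.
move=> a0 He; set S := \sum_(j <- sites L) a j.
have lo : (S%:E <= \esum_(j in [set: int]) (a j)%:E)%E.
  apply: esum_ge; exists [set` sites L]; first by split=> //; exact: finite_seq.
  by rewrite -fsbig_seq ?uniq_sites// sumEFin.
have up : (\esum_(j in [set: int]) (a j)%:E <= (S + e)%:E)%E.
  apply: ge_ereal_sup => _ [A [fA _] <-].
  rewrite fsbig_finite// sumEFin lee_fin.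
  rewrite (bigID (fun j : int => (L < `|j|)%N)) /= addrC; apply: lerD; last by apply: He; exact: fset_uniq.
  rewrite -big_filter; apply: ler_sum_sub => //; first by apply: filter_uniq; exact: fset_uniq.
  by move=> j; rewrite mem_filter mem_sites -leqNgt => /andP[].
move: lo up; case: esum => [r| |] //.
by rewrite !lee_fin => lo up; exists r; rewrite lo up.
Qed.

Lemma empirical_window n phi eta L e :
  (forall s : seq int, uniq s ->
     \sum_(j <- s | (L < `|j|)%N) `|phi (j%:~R / n%:R)| <= e) ->
  exists2 y, empirical n phi eta = y%:E &
    `|y - n%:R^-1 * \sum_(j <- sites L) phi (j%:~R / n%:R) * (eta j)%:R| <= n%:R^-1 * e.
Proof.
move=> He; pose u (j : int) : R := phi (j%:~R / n%:R) * (eta j)%:R.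
have tail (v : int -> R) : (forall j, v j <= `|phi (j%:~R / n%:R)|) ->
    forall s : seq int, uniq s -> \sum_(j <- s | (L < `|j|)%N) v j <= e.
  by move=> vp s us; apply: le_trans (He s us); apply: ler_sum => j _.
have ub j : `|u j| <= `|phi (j%:~R / n%:R)|.
  by rewrite normrM ler_piMr// ger0_norm//; case: (eta j).
have [r1 [E1 /andP[l1 u1]]] := @esum_window (u^\+) L e (fun j => funrpos_ge0 u j)
  (tail _ (fun j => le_trans (ltac:(by rewrite /funrpos ge_max normr_ge0 ler_norm) : u^\+ j <= `|u j|) (ub j))).
have [r2 [E2 /andP[l2 u2]]] := @esum_window (u^\-) L e (fun j => funrneg_ge0 u j)
  (tail _ (fun j => le_trans (ltac:(by rewrite /funrneg ge_max normr_ge0 -normrN ler_norm) : u^\- j <= `|u j|) (ub j))).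
exists (n%:R^-1 * (r1 - r2)).
  by rewrite /empirical /sumZ E1 E2 -EFinB -EFinM.
rewrite -mulrBr normrM ger0_norm ?invr_ge0// ler_wpM2l ?invr_ge0//.
have -> : \sum_(j <- sites L) phi (j%:~R / n%:R) * (eta j)%:R =
   \sum_(j <- sites L) u^\+ j - \sum_(j <- sites L) u^\- j.
  rewrite -sumrB; apply: eq_bigr => j _.
  by have := congr1 (fun f => f j) (funrposBneg u).
by rewrite ler_norml; lra.
Qed.

End integer_sums.

Section duality.
Context {R : realType}.
Variable alpha : R.
Hypothesis alpha_gt0 : 0 < alpha.
Local Notation leb := (@lebesgue_measure R).
Local Notation hk := (heat_kernel alpha).
Variables (phi rho : R -> R) (M B : R) (r : nat) (t : R).
Hypotheses (phi_cont : continuous phi) (phi_supp : supported_in r%:R phi).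
Hypotheses (phi_bound : forall x, `|phi x| <= M).
Hypotheses (rho_meas : measurable_fun setT rho) (rho_bound : forall x, `|rho x| <= B).
Hypothesis t_gt0 : 0 < t.

Let M_ge0 : 0 <= M. Proof. exact: le_trans (normr_ge0 _) (phi_bound 0). Qed.
Let B_ge0 : 0 <= B. Proof. exact: le_trans (normr_ge0 _) (rho_bound 0). Qed.
Let phi_meas : measurable_fun setT phi. Proof. exact: continuous_measurable_fun. Qed.

Let bounded_kernel_integrable (g : R -> R) C x : measurable_fun setT g ->
  (forall y, `|g y| <= C) -> leb.-integrable setT (EFin \o (fun y => hk t (x - y) * g y)).
Proof.
move=> mg gC; have C0 : 0 <= C by exact: le_trans (normr_ge0 _) (gC 0).
apply: (@le_integrable _ _ _ leb setT measurableT _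
  (EFin \o (fun y => C * hk t (x - y)))).
- apply/measurable_EFinP; apply: measurable_funM => //.
  exact: measurable_heat_kernel.
- move=> y _ /=; rewrite lee_fin normrM ger0_norm ?heat_kernel_ge0//.
  rewrite [leRHS]ger0_norm ?mulr_ge0 ?heat_kernel_ge0//.
  by rewrite mulrC ler_wpM2r ?heat_kernel_ge0.
- exact: (integrableZl measurableT C (integrable_heat_kernel alpha_gt0 x t_gt0)).
Qed.

Let kernel2_meas : measurable_fun setT (fun z : R * R => hk t (z.1 - z.2)).
Proof.
have mh : measurable_fun setT (hk t : R -> R) by exact: measurable_normal_pdf.
have md : measurable_fun setT (fun z : R * R => z.1 - z.2).
  by apply: measurable_funB; [exact: measurable_fst|exact: measurable_snd].
exact: (measurableT_comp mh md).
Qed.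

Let phi_integrable : leb.-integrable setT (EFin \o phi).
Proof.
apply/integrableP; split; first exact/measurable_EFinP.
have E : (fun x => `|(EFin \o phi) x|)%E = (EFin \o (fun x => `|phi x|)) \_ `[- r%:R, r%:R[.
  apply/funext => x; rewrite patchE; case: ifPn => // /negP xr /=.
  suff -> : phi x = 0 by rewrite normr0.
  apply: phi_supp; rewrite leNgt; apply/negP; rewrite ltr_norml => /andP[x1 x2].
  by apply: xr; rewrite inE /= in_itv /= x2 ltW.
rewrite E -integral_mkcond.
have mn : measurable_fun setT (fun x => `|phi x|) by exact: measurableT_comp.
have nb x : `|(fun x => `|phi x|) x| <= M by rewrite /= normr_id.
have /integrableP[_] := bounded_integrable_itv (- r%:R) r%:R mn nb.
apply: le_lt_trans; rewrite le_eqVlt; apply/orP; left; apply/eqP.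
by apply: eq_integral => x _ /=; rewrite normr_id.
Qed.

(** The heat semigroup is self-adjoint because its kernel is symmetric; Fubini's
    theorem applies since [phi] is integrable and [rho] is bounded. *)
Lemma heat_duality :
  (\int[leb]_x (heat_solution alpha phi x t * rho x)%:E =
   \int[leb]_x (phi x * heat_solution alpha rho x t)%:E)%E.
Proof.
pose F (z : R * R) : \bar R := (phi z.1 * (hk t (z.1 - z.2) * rho z.2))%:E.
have mF : measurable_fun setT F.
  apply/measurable_EFinP; apply: measurable_funM.
    exact: (measurableT_comp phi_meas measurable_fst).
  apply: measurable_funM => //.
  exact: (measurableT_comp rho_meas measurable_snd).
have i1 x := bounded_kernel_integrable x rho_meas rho_bound.
have i2 x := bounded_kernel_integrable x phi_meas phi_bound.
have iF : (leb \x leb)%E.-integrable setT F.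
  apply/(integrable12ltyP leb leb mF).
  apply: (@le_lt_trans _ _ (\int[leb]_x (B * `|phi x|)%:E)%E).
    apply: ge0_le_integral => //.
    - by move=> x _; apply: integral_ge0.
    - apply: (@measurable_fun_fubini_tonelli_F _ _ _ _ _ leb (fun z => `|F z|)%E) => //.
      exact: measurableT_comp.
    - by apply/measurable_EFinP; apply: measurable_funM => //; exact: measurableT_comp.
    move=> x _; apply: (@le_trans _ _ (\int[leb]_y ((B * `|phi x|) * hk t (x - y))%:E)%E).
      apply: ge0_le_integral => //.
      - by apply: measurableT_comp => //; exact: (measurableT_comp mF (pair1_measurable x)).
      - apply/measurable_EFinP; apply: measurable_funM => //; exact: measurable_heat_kernel.
      move=> y _; rewrite /F /= lee_fin !normrM (ger0_norm (heat_kernel_ge0 _ _ _)).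
      have q := mulr_ge0 (normr_ge0 (phi x)) (heat_kernel_ge0 alpha t (x - y)).
      by have := ler_wpM2l q (rho_bound y); lra.
    have := integrable_heat_kernel alpha_gt0 x t_gt0 => ih.
    under eq_integral do rewrite EFinM.
    rewrite integralZl//= -[X in (_ * X)%E]fineK; last exact: integrable_fin_num.
    by rewrite -/(Rintegral _ _ _) integral_heat_kernel// mule1.
  have [_] := integrableP _ _ _ (integrableZl measurableT B (integrable_norm phi_integrable)).
  apply: le_lt_trans; apply: ge0_le_integral => //.
  - by move=> x _; rewrite lee_fin mulr_ge0.
  - by apply/measurable_EFinP; apply: measurable_funM => //; exact: measurableT_comp.
  - apply: measurableT_comp => //; apply: measurable_funeM.
    by apply/measurable_EFinP; exact: measurableT_comp.
  - by move=> x _; exact: lee_abs.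
have E1 x : (\int[leb]_y F (x, y) = (phi x * heat_solution alpha rho x t)%:E)%E.
  rewrite /F /=; under eq_integral do rewrite EFinM.
  rewrite integralZl//; last exact: (i1 x).
  rewrite EFinM; congr (_ * _)%E.
  by rewrite -[LHS]fineK//; exact: (integrable_fin_num measurableT (i1 x)).
have E2 y : (\int[leb]_x F (x, y) = (heat_solution alpha phi y t * rho y)%:E)%E.
  have Fe x : F (x, y) = (rho y * (hk t (y - x) * phi x))%:E.
    by rewrite /F /= -[y - x]opprB heat_kernel_sym//; congr EFin; ring.
  under eq_integral do rewrite Fe EFinM.
  rewrite integralZl//; last exact: (i2 y).
  rewrite mulrC EFinM; congr (_ * _)%E.
  by rewrite -[LHS]fineK//; exact: (integrable_fin_num measurableT (i2 y)).
under eq_integral do rewrite -E2.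
under [RHS]eq_integral do rewrite -E1.
by rewrite (Fubini iF).
Qed.

End duality.

(** * Deviations from a fixed initial configuration *)

Section test_function.
Context {R : realType}.
Variable alpha : R.
Hypothesis alpha_gt0 : 0 < alpha.
Variables (phi : R -> R) (M : R) (r : nat) (t : R).
Hypotheses (phi_cont : continuous phi) (phi_supp : supported_in r%:R phi).
Hypotheses (phi_bound : forall x, `|phi x| <= M) (t_gt0 : 0 < t).
Local Notation f := (fun x => heat_solution alpha phi x t).

Lemma decay_small (e : R) : 0 < e -> exists2 A, 0 < A & forall x, A <= `|x| -> decay x <= e.
Proof.
move=> e0; exists e^-1; first by rewrite invr_gt0.
move=> x Ax; have q0 : 0 < 1 + `|x| by rewrite ltr_wpDr.
have q1 : (1 + `|x|)^-1 <= 1 by rewrite invf_le1// lerDl.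
have i0 : 0 <= (1 + `|x|)^-1 by rewrite invr_ge0 ltW.
apply: (@le_trans _ _ (1 + `|x|)^-1).
  rewrite /decay exprS ler_piMr// exprn_ile1//.
by rewrite -[e]invrK lef_pV2 ?posrE ?invr_gt0//; lra.
Qed.

(** The heat flow of a test function is not compactly supported: this is why the
    initial profile is tested against functions that merely decay at infinity. *)
Lemma heat_solution_C0 : C0 f.
Proof.
have [C C0 HC] := heat_solution_decay alpha_gt0 phi_cont phi_supp phi_bound t_gt0.
have small (e : R) : 0 < e -> exists2 A, 0 < A & forall x, A <= `|x| -> `|0 - f x| <= e.
  move=> e0; have C1 : 0 < C + 1 by rewrite ltr_wpDl.
  have [A A0 HA] := decay_small (divr_gt0 e0 C1).
  exists A => // x Ax; rewrite sub0r normrN; apply: (le_trans (HC x)).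
  have := HA x Ax; rewrite ler_pdivlMr// => h.
  by have := decay_ge0 x; lra.
split; first exact: (heat_solution_continuous alpha_gt0 phi_cont phi_supp phi_bound).
  apply/cvgrPdist_le => e e0; have [A A0 HA] := small e e0.
  near=> x; apply: HA; apply: le_trans (ler_norm x).
  by near: x; apply: nbhs_pinfty_ge; rewrite num_real.
apply/cvgrPdist_le => e e0; have [A A0 HA] := small e e0.
near=> x; apply: HA; rewrite -normrN; apply: le_trans (ler_norm (- x)).
rewrite lerNr; near: x; apply: nbhs_ninfty_le; rewrite num_real//.
Unshelve. all: by end_near.
Qed.

Lemma heat_solution_L1 : L1 f.
Proof.
have [C C0 HC] := heat_solution_dominated alpha_gt0 phi_cont phi_supp phi_bound t_gt0.
have t20 : 0 < 2 * t by rewrite mulr_gt0.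
have ih := integrable_heat_kernel alpha_gt0 0 t20.
apply: (@le_integrable _ _ _ lebesgue_measure setT measurableT _
  (EFin \o (fun y => C * heat_kernel alpha (2 * t) (0 - y)))).
- apply/measurable_EFinP; apply: continuous_measurable_fun.
  exact: (heat_solution_continuous alpha_gt0 phi_cont phi_supp phi_bound).
- move=> x _ /=; rewrite lee_fin sub0r heat_kernel_sym//.
  by apply: (le_trans (HC x)); exact: ler_norm.
- exact: (integrableZl measurableT C ih).
Qed.

End test_function.

Section section_bound.
Context {R : realType} {d : measure_display} {Omega : measurableType d}.
Variables (P : probability Omega R) (c : int -> R) (N : int -> R -> Omega -> nat).
Variables (alpha : R) (phi rho0 : R -> R) (M B : R) (r : nat) (t : R).
Hypotheses (c_gt0 : forall k, 0 < c k) (alpha_gt0 : 0 < alpha).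
Hypothesis resist_right : sublinear (fun i => resist c alpha i%:Z - 1).
Hypothesis resist_left : sublinear (fun i => resist c alpha (Negz i) - 1).
Hypothesis N_poisson : independent_poisson_processes P c N.
Hypotheses (phi_cont : continuous phi) (phi_supp : supported_in r%:R phi).
Hypotheses (phi_bound : forall x, `|phi x| <= M) (r_gt0 : (0 < r)%N).
Hypotheses (rho_meas : measurable_fun setT rho0) (rho_bound : forall x, `|rho0 x| <= B).
Hypothesis t_gt0 : 0 < t.
Local Notation f := (fun x => heat_solution alpha phi x t).

Let lattice_phi_supp n (j : int) : (0 < n)%N -> (r * n < `|j|)%N -> lattice n phi j = 0.
Proof.
move=> n0 jr; have nR : 0 < n%:R :> R by rewrite ltr0n.
apply: phi_supp; rewrite normrM normfV (gtr0_norm nR).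
rewrite ler_pdivlMr// -natrM -intr_norm -natr_absz ler_nat; exact: ltnW.
Qed.

Let pairing_phi_bound n L : (0 < n)%N ->
  pairing (sites L) (lattice n phi) (lattice n phi) <= M ^+ 2 * ((2 * r%:R + 1) * n%:R).
Proof.
move=> n0; have n1 : 1 <= n%:R :> R by rewrite ler1n.
have aM j : lattice n phi j * lattice n phi j <= M ^+ 2.
  rewrite -expr2 -(real_normK (num_real _)) lerXn2r ?nnegrE//; first exact: le_trans (normr_ge0 _) (phi_bound 0).
  exact: phi_bound.
rewrite /pairing (bigID (fun j : int => (r * n < `|j|)%N)) /= big1 ?add0r; last first.
  by move=> j jr; rewrite lattice_phi_supp// mul0r.
rewrite (eq_bigl (fun j : int => (`|j| <= r * n)%N)); last by move=> j; rewrite -leqNgt.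
apply: (le_trans (@sum_window _ _ (M ^+ 2) L (r * n) (sqr_ge0 M) (fun j _ _ => aM j))).
by rewrite natrM ler_wpM2l ?sqr_ge0//; have : 0 <= r%:R * n%:R :> R by []; lra.
Qed.

(** The exceptional event is the union of three: no silent edges inside the box,
    two rings in the same cell, and a deviation of the discretized process from
    its mean. Outside of it the deviation of the process splits into
    [delta / 3] for the chain against its mean, [delta / 12] for the mean against
    the evolved test function, [delta / 12] for the sites outside the box, and
    [delta / 3] for the initial configuration against the initial profile. *)
Lemma deviation_sections (delta e : R) : 0 < delta -> 0 < e ->
  exists2 n0, (0 < n0)%N & forall n, (n0 <= n)%N -> forall eta : config,
    ~ deviates n f rho0 (delta / 3) eta ->
    exists2 A, measurable A & pr P A <= e /\
    forall w, deviates n phi (fun x => heat_solution alpha rho0 x t) delta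
        (exclusion (path_of N w) eta (n%:R ^+ 2 * t)) -> A w.
Proof.
move=> d0 e0; have e30 : 0 < e / 3 by rewrite divr_gt0.
have d12 : 0 < delta / 12 by rewrite divr_gt0.
have d3 : 0 < delta / 3 by rewrite divr_gt0.
have [C C0 HC] := heat_solution_decay alpha_gt0 phi_cont phi_supp phi_bound t_gt0.
have [K K0 HK] := div_nat_small (4 * C) d12.
have [n1 n10 Hn] := evolution_converges c_gt0 alpha_gt0 resist_right resist_left
  phi_cont phi_supp phi_bound r_gt0 t_gt0 d12.
have [n2 n20 Hn2] := div_nat_small (M ^+ 2 * (2 * r%:R + 1) / (2 * (delta / 3) ^+ 2)) e30.
exists (maxn n1 n2) => [|n]; first by rewrite leq_max n10.
rewrite geq_max => /andP[nn1 nn2] eta ndev.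
have n_gt0 : (0 < n)%N by apply: leq_trans nn1.
have nR : 0 < n%:R :> R by rewrite ltr0n.
set T := n%:R ^+ 2 * t; have T0 : 0 < T by rewrite mulr_gt0 ?exprn_gt0.
have [L1 L10 HL] := Hn n nn1.
have [L2 [W mW [pW HW]]] := walls_probability c_gt0 N_poisson alpha_gt0
  resist_right resist_left (r * n) T0 e30.
(* The box contains the support of the test function and the silent edges, and
   carries almost all of the evolved test function. *)
pose L := maxn (maxn L1 L2) (maxn (r * n) (K * n)).
have LL1 : (L1 <= L)%N by rewrite !leq_max leqnn.
have LL2 : (L2 <= L)%N by rewrite !leq_max leqnn orbT.
have Lr : (r * n <= L)%N by rewrite !leq_max leqnn !orbT.
have LK : (K * n <= L)%N by rewrite !leq_max leqnn !orbT.
have [m1 m10 Hm] := HL L LL1.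
have [Cc Cc0 calmC] := calm_probability c_gt0 N_poisson L T0.
have [m2 m20 Hm2] := div_nat_small Cc e30.
pose m := maxn m1 m2.
have m_gt0 : (0 < m)%N by rewrite leq_max m10.
have mR : 0 < m%:R :> R by rewrite ltr0n.
have evol := Hm m (leq_maxl _ _).
have [Q mQ [pQ HQ]] := calmC m m_gt0.
pose h := n%:R ^+ 2 * (t / m%:R).
have hE : T / m%:R = h by rewrite /T /h mulrA.
have h0 : 0 < h by rewrite mulr_gt0 ?exprn_gt0// divr_gt0.
have TE : T = m%:R * h by rewrite -hE mulrC divfK// gt_eqF.
rewrite hE in HQ; rewrite -/h in evol.
set a := lattice n phi in evol.
set u := iter m (sweep c (bonds L) h) a in evol.
pose mean := pairing (sites L) u (occ eta).
pose G (z : config) : Prop := n%:R * (delta / 3) < `|pairing (sites L) a (occ z) - mean|.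
pose V := [set w | G (foldl exchange eta (ring_list (path_of N w) h m (bonds L)))].
have mV : measurable V.
  exact: (@measurable_ring_list _ _ _ P c N N_poisson h m (bonds L) h0
    (fun s => G (foldl exchange eta s))).
have pV : pr P V <= e / 3.
  rewrite /V (ring_list_law c_gt0 N_poisson m h0 (uniq_bonds L)).
  set l := [seq _ | p <- _].
  have bl : bernoulli l.
    move=> _ /mapP[p _ ->] /=; have [-> -> _] := ring_prob_bounds c_gt0 p.2 (ltW h0).
    by [].
  have il : inside (sites L) l.
    by move=> _ /mapP[_ /allpairsP[[i k] /= [_ kL ->]] ->] /=; exact: bond_sites.
  have ul : evolve l a = u by exact: evolve_slots.
  have nd : 0 < n%:R * (delta / 3) by rewrite mulr_gt0.
  have := expect_chebyshev a eta (uniq_sites L) bl il nd; rewrite ul -/mean => cheb.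
  apply: (@le_trans _ _ (pairing (sites L) a a / (2 * (n%:R * (delta / 3)) ^+ 2))).
    apply: le_trans cheb; apply: expect_le => // z.
    by rewrite /G asboolb.
  have q0 : 0 < 2 * (n%:R * (delta / 3)) ^+ 2 by rewrite mulr_gt0// exprn_gt0.
  apply: le_trans (Hn2 n nn2); rewrite ler_pdivrMr//.
  apply: (le_trans (pairing_phi_bound L n_gt0)).
  rewrite le_eqVlt; apply/orP; left; apply/eqP; field.
  by rewrite !gt_eqF.
exists (W `|` Q `|` V); first by apply: measurableU => //; exact: measurableU.
split.
  apply: (le_trans (pr_setU_le P _ mV)); first exact: measurableU.
  have := pr_setU_le P mW mQ; have := Hm2 m (leq_maxr _ _); lra.
move=> w dev; apply: contrapT => /not_orP[/not_orP[/HW[k1 [k2 [w1 w2 b1 b2]]] /HQ quiet] nV].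
pose z := foldl exchange eta (ring_list (path_of N w) h m (bonds L)).
have excl (x : int) : (`|x| <= r * n)%N -> exclusion (path_of N w) eta T x = z x.
  move=> xr; apply: (exclusion_box (poisson_path N_poisson w) eta h0 TE w1 w2 _ _ _ quiet).
  - by move: b1 LL2; clear; lia.
  - by move: b1 b2 xr; clear; lia.
  - by move: b2 LL2; clear; lia.
have X : `|pairing (sites L) a (occ z) - mean| <= n%:R * (delta / 3).
  by rewrite leNgt; apply/negP.
have tail0 (s : seq int) : uniq s ->
    \sum_(j <- s | (L < `|j|)%N) `|phi (j%:~R / n%:R)| <= 0 :> R.
  move=> us; rewrite big1// => j Lj.
  rewrite -[phi _]/(lattice n phi j) lattice_phi_supp ?normr0//.
  exact: leq_ltn_trans Lj.
have [y Ey Hy] := empirical_window (exclusion (path_of N w) eta T) tail0.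
have yE : y = n%:R^-1 * pairing (sites L) a (occ z).
  move: Hy; rewrite mulr0 normr_le0 subr_eq0 => /eqP ->; congr (_ * _).
  apply: eq_bigr => j _; have [jr|/lattice_phi_supp] := leqP `|j| (r * n).
    by rewrite excl.
  by rewrite /a /lattice => ->//; rewrite !mul0r.
have tailf (s : seq int) : uniq s ->
    \sum_(j <- s | (L < `|j|)%N) `|f (j%:~R / n%:R)| <= n%:R * (delta / 12).
  move=> us; apply: (@le_trans _ _ (C * \sum_(j <- s | (K * n < `|j|)%N) decay (j%:~R / n%:R : R))).
    rewrite mulr_sumr [leLHS]big_mkcond [leRHS]big_mkcond /=; apply: ler_sum => j _.
    case: ifPn => [Lj|_]; first by rewrite (leq_ltn_trans LK Lj) HC.
    by case: ifP => _ //; rewrite mulr_ge0 ?decay_ge0.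
  have := decay_sum_tail (R := R) K n_gt0 us; rewrite ler_pdivrMl// => h1.
  apply: (le_trans (ler_wpM2l C0 h1)); rewrite mulrCA ler_wpM2l//.
  by have := HK K.+1 (leqnSn _); rewrite mulrCA mulrA.
have [yf Eyf Hyf] := @empirical_window R n f eta L _ tailf.
rewrite mulKf ?gt_eqF// in Hyf.
have close : `|n%:R^-1 * mean - n%:R^-1 * \sum_(j <- sites L) f (j%:~R / n%:R) * (eta j)%:R|
    <= delta / 12.
  rewrite -mulrBr normrM ger0_norm ?invr_ge0 ?(ltW nR)//.
  apply: le_trans evol; rewrite ler_wpM2l ?invr_ge0 ?(ltW nR)//.
  rewrite /mean /pairing -sumrB; apply: (le_trans (ler_norm_sum _ _ _)).
  apply: ler_sum => j _; rewrite /occ -mulrBl normrM ler_piMr//.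
  by rewrite ger0_norm//; case: (eta j).
have X' : `|y - n%:R^-1 * mean| <= delta / 3.
  rewrite yE -mulrBr normrM ger0_norm ?invr_ge0 ?(ltW nR)//.
  by rewrite mulrC ler_pdivrMr// mulrC.
move: dev; rewrite /deviates /= Ey.
rewrite -(heat_duality alpha_gt0 phi_cont phi_supp phi_bound rho_meas rho_bound t_gt0).
move: ndev; rewrite /deviates /= Eyf.
set I := (\int[_]_x _)%E; case: I => [i| |] /=; try by move=> far _; apply: far; exact: ltry.
rewrite !lte_fin => /negP; rewrite -leNgt => Hi Hd.
have : `|y - i| <= delta / 3 + delta / 12 + delta / 12 + delta / 3.
  have -> : y - i = (y - n%:R^-1 * mean) +
    (n%:R^-1 * mean - n%:R^-1 * \sum_(j <- sites L) f (j%:~R / n%:R) * (eta j)%:R)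
    - (yf - n%:R^-1 * \sum_(j <- sites L) f (j%:~R / n%:R) * (eta j)%:R) + (yf - i).
    by ring.
  apply: (le_trans (ler_normD _ _)); apply: lerD => //.
  apply: (le_trans (ler_normB _ _)); apply: lerD => //.
  by apply: (le_trans (ler_normD _ _)); apply: lerD.
lra.
Qed.

End section_bound.

(** * Integration over the initial configuration *)

Section sections.
Context {R : realType} {d1 d2 : measure_display}.
Context {T1 : measurableType d1} {T2 : measurableType d2}.
Variables (mu : probability T1 R) (P : probability T2 R).

Lemma product_measure_exceptional (X : set (T1 * T2)) (D : set T1) (e : R) :
  measurable X -> measurable D -> 0 <= e ->
  (forall x, ~ D x -> (P (xsection X x) <= e%:E)%E) ->
  ((mu \x P) X <= e%:E + mu D)%E.
Proof.
move=> mX mD e0 He; rewrite /product_measure1.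
have mI : measurable_fun setT (fun x => (\1_D x)%:E : \bar R).
  by apply/measurable_EFinP; exact: measurable_indic.
apply: (@le_trans _ _ (\int[mu]_x (e%:E + (\1_D x)%:E))%E).
  apply: ge0_le_integral => //.
  - exact: measurable_fun_xsection.
  - exact: emeasurable_funD.
  move=> x _; rewrite indicE; case: (boolP (x \in D)) => [_|/negP xD].
    by rewrite /= (le_trans (probability_le1 _ (measurable_xsection _ mX)))// leeDr// lee_fin.
  by rewrite adde0; apply: He => Dx; apply: xD; rewrite inE.
rewrite ge0_integralD//.
by rewrite integral_cst// [X in (_ * X)%E]probability_setT mule1 integral_indic// setIT.
Qed.

End sections.

Lemma cvge0_squeeze {R : realType} (x y : nat -> \bar R) :
  (forall n, 0 <= x n)%E -> y n @[n --> \oo] --> 0%E ->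
  (forall e : R, 0 < e -> \forall n \near \oo, (x n <= e%:E + y n)%E) ->
  x n @[n --> \oo] --> 0%E.
Proof.
move=> x0 /fine_cvgP[yfin ycvg] H.
have xy (e : R) : 0 < e -> \forall n \near \oo, x n \is a fin_num /\ fine (x n) <= e + fine (y n).
  move=> e0; near=> n.
  have : (x n <= e%:E + y n)%E by near: n; exact: H.
  have : y n \is a fin_num by near: n.
  have := x0 n; case: (x n) => [a| |] //; case: (y n) => [b| |] //=.
apply/fine_cvgP; split; first by apply: filterS (xy 1 ltr01) => n [].
apply/cvgrPdist_le => e e0; have e20 : 0 < e / 2 by rewrite divr_gt0.
near=> n; have [_ h1] : x n \is a fin_num /\ fine (x n) <= e / 2 + fine (y n).
  by near: n; exact: xy.
have h2 : `|0 - fine (y n)| <= e / 2.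
  by near: n; move/cvgrPdist_le : ycvg; apply.
have h3 : 0 <= fine (x n) by rewrite fine_ge0.
suff : fine (x n) <= e by rewrite sub0r normrN ger0_norm.
move: h2; rewrite sub0r normrN => h2; have := le_trans (ler_norm _) h2; lra.
Unshelve. all: by end_near.
Qed.

Theorem theorem1 (R : realType) (c : int -> R) (alpha : R)
  (c_gt0 : forall k, 0 < c k)
  (alpha_gt0 : 0 < alpha)
  (c_right : k%:R^-1 * \sum_(0 <= j < k) (c j%:Z)^-1 @[k --> \oo] --> alpha)
  (c_left :
    k%:R^-1 * \sum_(1 <= j < k.+1) (c (- j%:Z))^-1 @[k --> \oo] --> alpha)
  (d : measure_display) (Omega : measurableType d) (P : probability Omega R)
  (N : int -> R -> Omega -> nat)
  (N_poisson : independent_poisson_processes P c N)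
  (rho0 : R -> R)
  (rho0_ge0 : forall x, 0 <= rho0 x)
  (rho0_bounded : exists M : R, forall x, rho0 x <= M)
  (rho0_borel : measurable_fun setT rho0)
  (mu : nat -> probability config R)
  (mu_profile : forall phi : R -> R, C0 phi -> L1 phi ->
    forall delta : R, 0 < delta ->
    mu n (deviates n phi rho0 delta) @[n --> \oo] --> 0%E) :
  forall (t : R) (phi : R -> R) (delta : R), 0 < t -> Cc phi -> 0 < delta ->
    exclusion_law P N (mu n)
      [set eta | deviates n phi (fun x => heat_solution alpha rho0 x t) delta
                   (eta (n%:R ^+ 2 * t))] @[n --> \oo] --> 0%E.
Proof.
move=> t phi delta t0 phi_Cc d0.
have [phi_cont _] := phi_Cc.
have [r r0 phi_supp] := Cc_supported phi_Cc.
have [M _ phi_bound] := supported_bounded phi_cont phi_supp.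
have [B HB] := rho0_bounded.
have rho_bound x : `|rho0 x| <= B by rewrite ger0_norm.
have right := resist_right_sublinear c_gt0 alpha_gt0 c_right.
have left := resist_left_sublinear c_gt0 alpha_gt0 c_left.
have d3 : 0 < delta / 3 by rewrite divr_gt0.
apply: cvge0_squeeze (mu_profile _
  (heat_solution_C0 alpha_gt0 phi_cont phi_supp phi_bound t0)
  (heat_solution_L1 alpha_gt0 phi_cont phi_supp phi_bound t0) _ d3) _ => //.
move=> e e0; have [n0 n0_gt0 Hn] := deviation_sections c_gt0 alpha_gt0 right left
  N_poisson phi_cont phi_supp phi_bound r0 rho0_borel rho_bound t0 d0 e0.
exists n0 => // n /= n0n; have n_gt0 := leq_trans n0_gt0 n0n.
have T0 : 0 < n%:R ^+ 2 * t by rewrite mulr_gt0// exprn_gt0// ltr0n.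
rewrite /exclusion_law; set X := [set z | _].
have mX : measurable X.
  have := measurable_exclusion N_poisson T0 measurableT (measurable_deviates n phi
    (fun x => heat_solution alpha rho0 x t) delta).
  by rewrite setTI.
apply: product_measure_exceptional => //; first exact: measurable_deviates.
  exact: ltW.
move=> eta /(Hn n n0n eta)[A mA [pA HA]].
apply: (@le_trans _ _ (P A)); last by rewrite prE// lee_fin.
apply: le_measure; rewrite ?inE//; first exact: measurable_xsection.
by move=> w; rewrite /xsection /= inE; exact: HA.
Qed.
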